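(* Let $\theta \in \mathbb{R}$ and consider the planar system $$\dot{x} = y, \qquad \dot{y} = -x(x^2-1)^2 + \theta y (x^2-1)^2 .$$ The equilibrium points $E_1 = (-1,0)$ and $E_2 = (1,0)$ of this system are cusps.
   Context: All notions refer to the flow of the autonomous planar system of ordinary differential equations in the claim, with $(x,y) \in \mathbb{R}^2$. An isolated equilibrium $p$ of a planar analytic system is a cusp if a sufficiently small deleted neighborhood of $p$ consists of exactly two hyperbolic sectors and two separatrices: there are exactly two orbits, other than $p$, that have $p$ as a limit as $t \to +\infty$ or $t \to -\infty$ (one tending to $p$ as $t \to +\infty$ and one tending to $p$ as $t \to -\infty$); these two orbits (the separatrices) divide the deleted neighborhood into two sectors, each of which is a hyperbolic sector. A hyperbolic sector at $p$ is a sector with vertex $p$ (bounded by two orbit arcs ending at $p$) that is topologically equivalent, possibly after reversing the direction of time, to a neighborhood of the origin in the closed first quadrant for the linear saddle $\dot u = u$, $\dot v = -v$; in particular, every orbit through an interior point of the sector leaves the neighborhood in both forward and backward time. *)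

(* Defs.v *)
From Stdlib Require Import Reals.
From Coquelicot Require Import Coquelicot.
Open Scope R_scope.

Definition vector_field := R * R -> R * R.

(* Two-sided derivatives at the end points of [I] lose no generality: a solution
   on a closed interval extends differentiably (e.g. affinely) past them. *)
Definition solution_on (F : vector_field) (I : R -> Prop) (g : R -> R * R) : Prop :=
  forall t, I t -> is_derive g t (F (g t)).

(* [w] is reached from [z] in forward time along a trajectory staying in [D]. *)
Definition reach_in (F : vector_field) (D : R * R -> Prop) (z w : R * R) : Prop :=
  exists (g : R -> R * R) (T : R),
    0 <= T /\ solution_on F (fun t => 0 <= t <= T) g /\
    (forall t, 0 <= t <= T -> D (g t)) /\ g 0 = z /\ g T = w.

Definition reach (F : vector_field) : R * R -> R * R -> Prop :=
  reach_in F (fun _ => True).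

Definition orbit (F : vector_field) (z w : R * R) : Prop :=
  reach F z w \/ reach F w z.

Definition is_orbit (F : vector_field) (G : R * R -> Prop) : Prop :=
  exists z, forall w, G w <-> orbit F z w.

Definition tends_forward (F : vector_field) (p z : R * R) : Prop :=
  exists g : R -> R * R,
    solution_on F (fun t => 0 <= t) g /\ g 0 = z /\
    filterlim g (Rbar_locally p_infty) (locally p).

Definition tends_backward (F : vector_field) (p z : R * R) : Prop :=
  exists g : R -> R * R,
    solution_on F (fun t => t <= 0) g /\ g 0 = z /\
    filterlim g (Rbar_locally m_infty) (locally p).

Definition arc_ending_at (F : vector_field) (p : R * R) (A : R * R -> Prop) : Prop :=
  exists z, z <> p /\
    ((tends_forward F p z /\ forall w, A w <-> reach F z w) \/
     (tends_backward F p z /\ forall w, A w <-> reach F w z)).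

Definition homeomorphism_between (Q S : R * R -> Prop) (h : R * R -> R * R) : Prop :=
  exists k : R * R -> R * R,
    continuous_on Q h /\ continuous_on S k /\
    (forall z, Q z -> S (h z) /\ k (h z) = z) /\
    (forall w, S w -> Q (k w) /\ h (k w) = w).

(* [h] carries the oriented orbit arcs of [F1] in [Q] onto those of [F2] in [S]. *)
Definition topological_equivalence (F1 : vector_field) (Q : R * R -> Prop)
    (F2 : vector_field) (S : R * R -> Prop) (h : R * R -> R * R) : Prop :=
  homeomorphism_between Q S h /\
  forall z w, Q z -> Q w -> (reach_in F1 Q z w <-> reach_in F2 S (h z) (h w)).

Definition reverse (F : vector_field) : vector_field :=
  fun z => (- fst (F z), - snd (F z)).

Definition saddle : vector_field := fun z => (fst z, - snd z).

(* [S] contains its vertex [p] and its bounding arcs [A] and [B], which are the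
   images of the two positive half-axes. *)
Definition hyperbolic_sector (F : vector_field) (p : R * R)
    (S A B : R * R -> Prop) : Prop :=
  arc_ending_at F p A /\ arc_ending_at F p B /\
  (exists (U : R * R -> Prop) (h : R * R -> R * R),
     locally ((0, 0) : R * R) U /\
     let Q := fun z => U z /\ 0 <= fst z /\ 0 <= snd z in
     (topological_equivalence saddle Q F S h \/
      topological_equivalence saddle Q (reverse F) S h) /\
     h (0, 0) = p /\
     (forall w, A w <-> exists u, 0 < u /\ Q (u, 0) /\ w = h (u, 0)) /\
     (forall w, B w <-> exists v, 0 < v /\ Q (0, v) /\ w = h (0, v))) /\
  (forall z, S z -> z <> p -> ~ A z -> ~ B z ->
     (exists w, reach F z w /\ ~ S w) /\ (exists w, reach F w z /\ ~ S w)).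

Definition is_equilibrium (F : vector_field) (p : R * R) : Prop := F p = (0, 0).

Definition is_isolated_equilibrium (F : vector_field) (p : R * R) : Prop :=
  is_equilibrium F p /\
  locally p (fun z => is_equilibrium F z -> z = p).

(* [Gs] and [Gu] are the separatrices tending to [p] in forward and in backward
   time; they are complete orbits, and [A], [B] are the arcs of them that cut the
   neighborhood [N] into the two sectors. *)
Definition is_cusp (F : vector_field) (p : R * R) : Prop :=
  is_isolated_equilibrium F p /\
  exists Gs Gu : R * R -> Prop,
    is_orbit F Gs /\ is_orbit F Gu /\ ~ Gs p /\ ~ Gu p /\
    ~ (forall z, Gs z <-> Gu z) /\
    (forall z, z <> p -> (tends_forward F p z <-> Gs z)) /\
    (forall z, z <> p -> (tends_backward F p z <-> Gu z)) /\
    forall eps : R, 0 < eps ->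
      exists N S1 S2 A B : R * R -> Prop,
        locally p N /\ (forall z, N z -> ball p eps z) /\
        (forall z, A z -> Gs z) /\ (forall z, B z -> Gu z) /\
        hyperbolic_sector F p S1 A B /\ hyperbolic_sector F p S2 A B /\
        (forall z, N z <-> S1 z \/ S2 z) /\
        (forall z, z <> p -> (S1 z /\ S2 z <-> A z \/ B z)).

Definition cusp_system (theta : R) : vector_field := fun z =>
  let (x, y) := z in
  (y, - x * (x ^ 2 - 1) ^ 2 + theta * y * (x ^ 2 - 1) ^ 2).

(* Main.v *)
(* By the symmetry z -> -z it suffices to treat the equilibrium (1, 0).  In the coordinate
   c = (x^2 - 1)^3 / 6 the two equations share the factor (x^2 - 1)^2, so that near (1, 0)
   the orbits lie on the integral curves of a scalar equation dc/dy = slope y c without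
   singularity at (0, 0).  Its right-hand side is not Lipschitz in c, because x is a cube
   root of c there; but theta enters with a factor y^2, which |dc/dy| >= (2/3)|y| controls,
   and x is monotone in c, so the Picard operator is nevertheless a contraction.  The curves
   therefore foliate a strip |y| <= delta, and (label of the curve, y) is a homeomorphic
   chart in which the flow is horizontal, y strictly decreasing, interrupted only at the
   equilibrium.  The map (u, v) -> (u v, u - v) straightens the closed first quadrant of the
   saddle to a half plane in the same way, which gives the two hyperbolic sectors; the
   separatrices are the two halves of the curve with label 0.  The reflection
   (x, y, t, theta) -> (x, -y, -t, -theta) exchanges them. *)
Require Import Defs.
From Stdlib Require Import Reals Lra Lia Psatz Ranalysis5 ClassicalEpsilon.
From Coquelicot Require Import Coquelicot.
Open Scope R_scope.

(** * Derivatives and limits *)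

(** On the line [x = 1] the field is [(y, 0)]: the ordinate of an orbit is momentarily stationary at
    every crossing and cannot be used there as a regular parameter. So the invariance of the leaves
    is not read off from uniqueness for the scalar equation. The contraction estimate is instead
    proved along an arbitrary monotone [Y]: the identity when leaves are constructed and compared,
    the ordinate of a solution when the flow is compared with a leaf. The contraction factor is 1/2.
    It comes as 1/4 from each of the two ranges on which [y], hence [slope], keeps its sign, and the
    constant 1/200 in [small] is fixed by this requirement. Two points are not local. Orbits and
    limits refer to the whole plane, so uniqueness of solutions is needed there and not only in the
    box around the cusp. And the two separatrices could a priori belong to one homoclinic orbit;
    this is excluded with the energy [y ^ 2 / 2 + Gam x], which is conserved for [theta = 0] and
    monotone along orbits otherwise. *)

Lemma continuous_eps (f : R -> R) (x : R) :
  (forall eps, 0 < eps -> exists del, 0 < del /\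
     forall y, Rabs (y - x) < del -> Rabs (f y - f x) < eps) -> continuous f x.
Proof.
  intros H P [eps HP]. destruct (H eps (cond_pos eps)) as [del [Hdel Hf]].
  exists (mkposreal del Hdel). intros y Hy. apply HP, Hf, Hy.
Qed.

Lemma eps_continuous (f : R -> R) (x : R) :
  continuous f x -> forall eps, 0 < eps -> exists del, 0 < del /\
     forall y, Rabs (y - x) < del -> Rabs (f y - f x) < eps.
Proof.
  intros H eps Heps.
  destruct (H (ball (f x) eps)) as [del Hd].
  { exists (mkposreal eps Heps). intros y Hy. exact Hy. }
  exists del. split; [apply cond_pos|]. intros y Hy. apply Hd, Hy.
Qed.

Lemma continuous_lipschitz (f : R -> R) (L : R) :
  (forall x y, Rabs (f y - f x) <= L * Rabs (y - x)) -> forall x, continuous f x.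
Proof.
  intros H x. apply continuous_eps. intros eps Heps.
  assert (HL : 0 < Rabs L + 1) by (pose proof (Rabs_pos L); lra).
  exists (eps / (Rabs L + 1)). split; [apply Rdiv_lt_0_compat; lra|].
  intros y Hy. apply Rle_lt_trans with (1 := H x y).
  apply Rle_lt_trans with ((Rabs L + 1) * Rabs (y - x)).
  - apply Rmult_le_compat_r; [apply Rabs_pos|]. pose proof (Rle_abs L); lra.
  - apply Rmult_lt_compat_l with (r := Rabs L + 1) in Hy; [|lra].
    replace ((Rabs L + 1) * (eps / (Rabs L + 1))) with eps in Hy by (field; lra). lra.
Qed.

Lemma derive_continuity_pt (f : R -> R) (x l : R) : is_derive f x l -> continuity_pt f x.
Proof.
  intros H. apply derivable_continuous_pt. exists l. now apply is_derive_Reals.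
Qed.

Lemma derive_nondecreasing (f df : R -> R) (a b : R) :
  a <= b -> (forall t, a <= t <= b -> is_derive f t (df t)) ->
  (forall t, a <= t <= b -> 0 <= df t) -> f a <= f b.
Proof.
  intros Hab Hd Hp. destruct (Req_dec a b) as [->|Hn]; [lra|].
  destruct (MVT_cor2 f df a b) as [c [Hc Hc']]; [lra| |].
  - intros c Hc. apply is_derive_Reals, Hd, Hc.
  - assert (0 <= df c) by (apply Hp; lra). nra.
Qed.

Lemma derive_growth (f df : R -> R) (a b m : R) :
  a <= b -> (forall t, a <= t <= b -> is_derive f t (df t)) ->
  (forall t, a <= t <= b -> m <= df t) -> f a + m * (b - a) <= f b.
Proof.
  intros Hab Hd Hp.
  pose proof (derive_nondecreasing (fun t => f t - m * t) (fun t => df t - m) a b Hab) as H.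
  cbv beta in H. enough (f a - m * a <= f b - m * b) by lra. apply H.
  - intros t Ht. apply (is_derive_minus f (fun t => m * t)); [auto|].
    auto_derive; [easy|ring].
  - intros t Ht. specialize (Hp t Ht). lra.
Qed.

(** Both [g - f] and [g + f] are nondecreasing. This replaces integral estimates throughout: [g] is
    an explicit primitive of the bound. *)
Lemma derive_bound (f df g dg : R -> R) (a b : R) :
  a <= b -> (forall t, a <= t <= b -> is_derive f t (df t)) ->
  (forall t, a <= t <= b -> is_derive g t (dg t)) ->
  (forall t, a <= t <= b -> Rabs (df t) <= dg t) -> Rabs (f b - f a) <= g b - g a.
Proof.
  intros Hab Hf Hg H.
  assert (H1 : g a - f a <= g b - f b).
  { apply (derive_nondecreasing (fun t => g t - f t) (fun t => dg t - df t)); [lra| |].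
    - intros t Ht. apply (is_derive_minus g f); auto.
    - intros t Ht. specialize (H t Ht). apply Rabs_le_between in H. lra. }
  assert (H2 : g a + f a <= g b + f b).
  { apply (derive_nondecreasing (fun t => g t + f t) (fun t => dg t + df t)); [lra| |].
    - intros t Ht. apply (is_derive_plus g f); auto.
    - intros t Ht. specialize (H t Ht). apply Rabs_le_between in H. lra. }
  apply Rabs_le. lra.
Qed.

Lemma ivt_decr (f : R -> R) (a b y : R) :
  a <= b -> (forall t, a <= t <= b -> continuity_pt f t) -> f b <= y <= f a ->
  exists t, a <= t <= b /\ f t = y.
Proof.
  intros Hab Hc Hy.
  destruct (Req_dec (f a) y) as [Ha|Ha]; [exists a; split; [lra|easy]|].
  destruct (Req_dec (f b) y) as [Hb|Hb]; [exists b; split; [lra|easy]|].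
  assert (a < b) by (destruct (Req_dec a b) as [->|]; lra).
  destruct (IVT_interv (fun t => y - f t) a b) as [t [Ht Hz]]; try lra.
  - intros t Ht. apply continuity_pt_minus; [|now apply Hc].
    apply continuity_pt_const. intros u v; reflexivity.
  - exists t. split; [easy|lra].
Qed.

Lemma ivt_incr (f : R -> R) (a b y : R) :
  a <= b -> (forall t, a <= t <= b -> continuity_pt f t) -> f a <= y <= f b ->
  exists t, a <= t <= b /\ f t = y.
Proof.
  intros Hab Hc Hy.
  destruct (ivt_decr (fun t => - f t) a b (- y)) as [t [Ht He]]; try lra.
  - intros t Ht. apply continuity_pt_opp. now apply Hc.
  - exists t. split; [easy|lra].
Qed.

(** * Truncation, cube roots, and the abscissa as a function of [Gam] *)

Definition clamp (lo hi x : R) : R := Rmax lo (Rmin hi x).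

Lemma clamp_range (lo hi x : R) : lo <= hi -> lo <= clamp lo hi x <= hi.
Proof.
  intros H. unfold clamp. split; [apply Rmax_l|].
  apply Rmax_lub; [easy|apply Rmin_l].
Qed.

Lemma clamp_id (lo hi x : R) : lo <= x <= hi -> clamp lo hi x = x.
Proof.
  intros H. unfold clamp. rewrite Rmin_right, Rmax_right; lra.
Qed.

Lemma clamp_lipschitz (lo hi x y : R) :
  Rabs (clamp lo hi x - clamp lo hi y) <= Rabs (x - y).
Proof.
  unfold clamp, Rmax, Rmin.
  repeat destruct Rle_dec; unfold Rabs; repeat destruct Rcase_abs; lra.
Qed.

Lemma clamp_monotone (lo hi x y : R) : x <= y -> clamp lo hi x <= clamp lo hi y.
Proof.
  intros H. unfold clamp, Rmax, Rmin. repeat destruct Rle_dec; lra.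
Qed.

Lemma continuous_clamp (lo hi x : R) : continuous (clamp lo hi) x.
Proof.
  apply (continuous_lipschitz _ 1). intros u v. rewrite Rmult_1_l.
  apply clamp_lipschitz.
Qed.

Lemma cube_root_exists (a : R) : {s : R | s ^ 3 = a}.
Proof.
  destruct (IVT_gen (fun s => s ^ 3) (- (Rabs a + 1)) (Rabs a + 1) a) as [s [_ Hs]].
  - intros s. apply derivable_continuous_pt, derivable_pt_pow.
  - pose proof (Rabs_pos a). pose proof (Rle_abs a). pose proof (Rle_abs (- a)).
    rewrite Rabs_Ropp in *. set (b := Rabs a) in *.
    assert (b + 1 <= (b + 1) ^ 3) by nra.
    split.
    + apply Rle_trans with (1 := Rmin_l _ _). cbv beta.
      replace ((- (b + 1)) ^ 3) with (- (b + 1) ^ 3) by ring. lra.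
    + apply Rle_trans with (2 := Rmax_r _ _). cbv beta. lra.
  - now exists s.
Qed.

Definition cbrt (a : R) : R := proj1_sig (cube_root_exists a).

Lemma cbrt_cube (a : R) : cbrt a ^ 3 = a.
Proof. exact (proj2_sig (cube_root_exists a)). Qed.

Lemma cube_le_inv (s r : R) : s ^ 3 <= r ^ 3 -> s <= r.
Proof.
  intros H. destruct (Rle_or_lt s r) as [|Hlt]; [easy|exfalso].
  assert (0 < s ^ 3 - r ^ 3); [|lra].
  replace (s ^ 3 - r ^ 3) with ((s - r) * ((s + r / 2) ^ 2 + 3 / 4 * r ^ 2)) by field.
  apply Rmult_lt_0_compat; [lra|].
  destruct (Req_dec r 0) as [->|Hr].
  - replace ((s + 0 / 2) ^ 2 + 3 / 4 * 0 ^ 2) with (s ^ 2) by field. now apply pow_lt.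
  - pose proof (pow2_ge_0 (s + r / 2)). pose proof (pow2_gt_0 r Hr). lra.
Qed.

(** Holds because [4 * (s ^ 2 + s * r + r ^ 2) - (s - r) ^ 2 = 3 * (s + r) ^ 2]. It says that the
    cube root is Hölder continuous of exponent 1/3, which is all the regularity that [xi] has at
    0. *)
Lemma cube_dist (s r : R) : Rabs (s - r) ^ 3 <= 4 * Rabs (s ^ 3 - r ^ 3).
Proof.
  replace (s ^ 3 - r ^ 3) with ((s - r) * (s ^ 2 + s * r + r ^ 2)) by ring.
  rewrite Rabs_mult. pose proof (Rabs_pos (s - r)) as H0.
  assert (H1 : Rabs (s - r) ^ 2 = (s - r) ^ 2) by (apply pow2_abs).
  replace (Rabs (s - r) ^ 3) with (Rabs (s - r) * Rabs (s - r) ^ 2) by ring.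
  assert (H2 : (s - r) ^ 2 <= 4 * (s ^ 2 + s * r + r ^ 2)).
  { pose proof (pow2_ge_0 (s + r)). simpl in *. lra. }
  rewrite H1, (Rabs_pos_eq (s ^ 2 + s * r + r ^ 2)).
  - apply Rmult_le_compat_l with (r := Rabs (s - r)) in H2; lra.
  - pose proof (pow2_ge_0 (s - r)). lra.
Qed.

Lemma cbrt_monotone (a b : R) : a <= b -> cbrt a <= cbrt b.
Proof. intros H. apply cube_le_inv. now rewrite !cbrt_cube. Qed.

Lemma cube_cbrt (s : R) : cbrt (s ^ 3) = s.
Proof. apply Rle_antisym; apply cube_le_inv; rewrite cbrt_cube; lra. Qed.

Lemma cube_lt_inv (s r : R) : s ^ 3 < r ^ 3 -> s < r.
Proof.
  intros H. destruct (Rlt_or_le s r) as [|Hle]; [easy|exfalso].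
  assert (r <= s -> r ^ 3 <= s ^ 3); [|specialize (H0 Hle); lra].
  intros Hrs. replace (s ^ 3) with (r ^ 3 + (s - r) * ((s + r / 2) ^ 2 + 3 / 4 * r ^ 2)) by field.
  enough (0 <= (s - r) * ((s + r / 2) ^ 2 + 3 / 4 * r ^ 2)) by lra.
  apply Rmult_le_pos; [lra|nra].
Qed.

Lemma continuous_cbrt (a : R) : continuous cbrt a.
Proof.
  apply continuous_eps. intros eps Heps. exists (eps ^ 3 / 4).
  split; [apply Rdiv_lt_0_compat; [now apply pow_lt|lra]|].
  intros b Hb. apply cube_lt_inv.
  apply Rle_lt_trans with (1 := cube_dist _ _). rewrite !cbrt_cube. lra.
Qed.

(* On the leaves of the flow the abscissa enters only through [Gam x]; the factor
   [(x^2 - 1)^2] common to the two equations then cancels. *)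
Definition Gam (x : R) : R := (x ^ 2 - 1) ^ 3 / 6.

(** The inverse of [Gam] on [[1/2, 3/2]], extended to a bounded monotone function on the whole line;
    the limits of the clamp are the squares of 1/2 and 3/2. *)
Definition xi (c : R) : R := sqrt (clamp (1 / 4) (9 / 4) (1 + cbrt (6 * c))).

Lemma xi_range (c : R) : 1 / 2 <= xi c <= 3 / 2.
Proof.
  unfold xi. destruct (clamp_range (1 / 4) (9 / 4) (1 + cbrt (6 * c))) as [H1 H2]; [lra|].
  split.
  - replace (1 / 2) with (sqrt ((1 / 2) ^ 2)) by (apply sqrt_pow2; lra).
    apply sqrt_le_1_alt. lra.
  - replace (3 / 2) with (sqrt ((3 / 2) ^ 2)) by (apply sqrt_pow2; lra).
    apply sqrt_le_1_alt. lra.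
Qed.

Lemma xi_monotone (a b : R) : a <= b -> xi a <= xi b.
Proof.
  intros H. apply sqrt_le_1_alt, clamp_monotone.
  assert (cbrt (6 * a) <= cbrt (6 * b)) by (apply cbrt_monotone; lra). lra.
Qed.

Lemma continuous_xi (c : R) : continuous xi c.
Proof.
  unfold xi. apply (continuous_comp (fun c => clamp (1 / 4) (9 / 4) (1 + cbrt (6 * c))) sqrt).
  - apply (continuous_comp (fun c => 1 + cbrt (6 * c)) (clamp (1 / 4) (9 / 4))).
    + apply (continuous_plus (fun _ => 1) (fun c => cbrt (6 * c))).
      * apply continuous_const.
      * apply (continuous_comp (fun c => 6 * c) cbrt); [|apply continuous_cbrt].
        apply (continuous_mult (fun _ => 6) (fun c => c)); [apply continuous_const|apply continuous_id].
    + apply continuous_clamp.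
  - apply continuous_sqrt.
Qed.

Lemma xi_Gam (x : R) : 1 / 2 <= x <= 3 / 2 -> xi (Gam x) = x.
Proof.
  intros H. unfold xi, Gam.
  replace (6 * ((x ^ 2 - 1) ^ 3 / 6)) with ((x ^ 2 - 1) ^ 3) by field.
  rewrite cube_cbrt, clamp_id by nra.
  replace (1 + (x ^ 2 - 1)) with (x ^ 2) by ring. apply sqrt_pow2. lra.
Qed.

Lemma Gam_xi (c : R) : Rabs c <= 1 / 20 -> Gam (xi c) = c.
Proof.
  intros H. apply Rabs_le_between in H. unfold Gam, xi.
  assert (H1 : - (3 / 4) <= cbrt (6 * c)).
  { apply cube_le_inv. rewrite cbrt_cube. nra. }
  assert (H2 : cbrt (6 * c) <= 5 / 4).
  { apply cube_le_inv. rewrite cbrt_cube. nra. }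
  rewrite clamp_id, pow2_sqrt by lra.
  replace (1 + cbrt (6 * c) - 1) with (cbrt (6 * c)) by ring. rewrite cbrt_cube. field.
Qed.

(** From [x ^ 2 - 1 = (x - 1) * (x + 1)] with [x + 1 >= 1]. Smallness of [Gam] is thus turned back
    into closeness to the abscissa 1, at the price of a cube. *)
Lemma Gam_dist (x : R) : 0 <= x -> Rabs (x - 1) ^ 3 <= 6 * Rabs (Gam x).
Proof.
  intros Hx. unfold Gam, Rdiv. rewrite Rabs_mult, (Rabs_pos_eq (/ 6)) by lra.
  rewrite <- RPow_abs.
  assert (H : Rabs (x - 1) <= Rabs (x ^ 2 - 1)).
  { replace (x ^ 2 - 1) with ((x - 1) * (x + 1)) by ring.
    rewrite Rabs_mult, (Rabs_pos_eq (x + 1)) by lra. pose proof (Rabs_pos (x - 1)). nra. }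
  pose proof (pow_incr _ _ 3 (conj (Rabs_pos _) H)). lra.
Qed.

Definition Phi (c : R) : R := RInt xi 0 c.

Lemma is_derive_Phi (c : R) : is_derive Phi c (xi c).
Proof.
  apply (is_derive_RInt xi Phi 0); [|apply continuous_xi].
  apply filter_forall. intros b. apply (RInt_correct (V := R_CompleteNormedModule) xi 0 b).
  apply (ex_RInt_continuous xi). intros z _. apply continuous_xi.
Qed.

Lemma Phi_growth (a b : R) : a <= b -> 1 / 2 * (b - a) <= Phi b - Phi a <= 3 / 2 * (b - a).
Proof.
  intros H.
  pose proof (derive_growth Phi xi a b (1 / 2) H (fun t _ => is_derive_Phi t)
    (fun t _ => proj1 (xi_range t))).
  pose proof (derive_growth (fun t => - Phi t) (fun t => - xi t) a b (- (3 / 2)) H) as H2.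
  cbv beta in H2. split; [lra|].
  enough (- Phi a + - (3 / 2) * (b - a) <= - Phi b) by lra. apply H2.
  - intros t _. apply (is_derive_opp Phi), is_derive_Phi.
  - intros t _. pose proof (xi_range t). lra.
Qed.

(* [xi] is not Lipschitz, but [k * (Phi (c + d) - Phi (c - d))] has derivative
   [k * c' * (xi (c + d) - xi (c - d))], so a monotone [c] turns a bound by the
   oscillation of [xi] into one that is linear in [d]. *)
Lemma monotone_oscillation_bound (k d : R) (c m E e : R -> R) (a b : R) :
  a <= b -> 0 <= k -> 0 <= d ->
  (forall t, a <= t <= b -> is_derive c t (m t)) ->
  (forall t, a <= t <= b -> is_derive E t (e t)) ->
  (forall t, a <= t <= b -> Rabs (e t) <= k * Rabs (m t) * (xi (c t + d) - xi (c t - d))) ->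
  ((forall t, a <= t <= b -> 0 <= m t) \/ (forall t, a <= t <= b -> m t <= 0)) ->
  Rabs (E b - E a) <= 2 * k * d.
Proof.
  intros Hab Hk Hd Hc HE He Hm.
  set (W := fun t => Phi (c t + d) - Phi (c t - d)).
  assert (HW : forall t, a <= t <= b ->
    is_derive W t (m t * xi (c t + d) - m t * xi (c t - d))).
  { intros t Ht. unfold W.
    apply (is_derive_minus (fun t => Phi (c t + d)) (fun t => Phi (c t - d))).
    - apply (is_derive_comp Phi (fun t => c t + d)); [apply is_derive_Phi|].
      replace (m t) with (m t + 0) by ring.
      apply (is_derive_plus c (fun _ => d)); [auto|apply is_derive_Reals, derivable_pt_lim_const].
    - apply (is_derive_comp Phi (fun t => c t - d)); [apply is_derive_Phi|].
      replace (m t) with (m t - 0) by ring.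
      apply (is_derive_minus c (fun _ => d)); [auto|apply is_derive_Reals, derivable_pt_lim_const]. }
  (* [W t] integrates [xi], which lies between 1/2 and 3/2, over an interval of length [2 * d]; so
     [W] varies by at most [2 * d], however far [c] travels. *)
  assert (HWr : forall t, d <= W t <= 3 * d).
  { intros t. unfold W. pose proof (Phi_growth (c t - d) (c t + d)). lra. }
  pose proof (HWr a). pose proof (HWr b).
  destruct Hm as [Hm|Hm].
  - assert (HB : Rabs (E b - E a) <= k * W b - k * W a); [|nra].
    apply (derive_bound E e (fun t => k * W t)
      (fun t => k * (m t * xi (c t + d) - m t * xi (c t - d)))); auto.
    + intros t Ht. apply is_derive_scal. auto.
    + intros t Ht. specialize (He t Ht). rewrite (Rabs_pos_eq (m t)) in He by auto. lra.
  - assert (HB : Rabs (E b - E a) <= - k * W b - - k * W a); [|nra].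
    apply (derive_bound E e (fun t => - k * W t)
      (fun t => - k * (m t * xi (c t + d) - m t * xi (c t - d)))); auto.
    + intros t Ht. apply is_derive_scal. auto.
    + intros t Ht. specialize (He t Ht). rewrite (Rabs_left1 (m t)) in He by auto. lra.
Qed.

(** * Limits of geometrically convergent sequences *)

Lemma half_contracts : Rabs (1 / 2) < 1.
Proof. rewrite Rabs_pos_eq; lra. Qed.

Lemma geometric_limit (u : nat -> R) (a : R) :
  (forall n, Rabs (u (S n) - u n) <= a / 2 ^ n) ->
  exists l, forall n, Rabs (l - u n) <= 2 * a / 2 ^ n.
Proof.
  intros H.
  assert (Ha : 0 <= a).
  { specialize (H O). pose proof (Rabs_pos (u 1%nat - u O)). simpl in H. lra. }
  assert (H2 : forall n, 0 < 2 ^ n) by (intros n; apply pow_lt; lra).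
  (* The subtracted term is the bound still available to the later steps; with it the telescoping
     estimate goes through by induction on [p]. *)
  assert (HC : forall n p, Rabs (u (n + p)%nat - u n) <= 2 * a / 2 ^ n - 2 * a / 2 ^ (n + p)).
  { intros n p. induction p as [|p IH].
    - rewrite Nat.add_0_r, Rminus_diag, Rabs_R0. lra.
    - rewrite Nat.add_succ_r. specialize (H (n + p)%nat).
      replace (u (S (n + p)) - u n) with ((u (S (n + p)) - u (n + p)%nat) + (u (n + p)%nat - u n)) by ring.
      apply Rle_trans with (1 := Rabs_triang _ _).
      assert (2 * a / 2 ^ (n + p) = a / 2 ^ (n + p) + 2 * a / 2 ^ (S (n + p))).
      { simpl. field. specialize (H2 (n + p)%nat). lra. }
      lra. }
  assert (HC' : forall n p, Rabs (u (n + p)%nat - u n) <= 2 * a / 2 ^ n).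
  { intros n p. specialize (HC n p).
    assert (0 <= 2 * a / 2 ^ (n + p)) by (apply Rdiv_le_0_compat; [lra|apply H2]). lra. }
  assert (Hcv : ex_finite_lim_seq u).
  { apply ex_lim_seq_cauchy_corr. intros eps.
    destruct (pow_lt_1_zero (1 / 2) half_contracts (eps / (4 * a + 1)))
      as [N HN]; [apply Rdiv_lt_0_compat; [apply cond_pos|lra]|].
    specialize (HN N (le_n N)). rewrite Rabs_pos_eq in HN by (apply pow_le; lra).
    assert (Hb : 4 * a / 2 ^ N < eps).
    { replace (4 * a / 2 ^ N) with (4 * a * (1 / 2) ^ N).
      - apply Rle_lt_trans with ((4 * a + 1) * (1 / 2) ^ N).
        + pose proof (pow_le (1 / 2) N ltac:(lra)). nra.
        + apply Rmult_lt_compat_l with (r := 4 * a + 1) in HN; [|lra].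
          replace ((4 * a + 1) * (eps / (4 * a + 1))) with (pos eps) in HN by (field; lra). lra.
      - replace (1 / 2) with (/ 2) by field. rewrite pow_inv. reflexivity. }
    exists N. intros n m Hn Hm.
    replace n with (N + (n - N))%nat by lia. replace m with (N + (m - N))%nat by lia.
    pose proof (HC' N (n - N)%nat) as A1. pose proof (HC' N (m - N)%nat) as A2.
    set (p := u (N + (n - N))%nat) in *. set (q := u (N + (m - N))%nat) in *.
    apply Rle_lt_trans with (Rabs (p - u N) + Rabs (q - u N)).
    - replace (p - q) with ((p - u N) - (q - u N)) by ring.
      apply Rle_trans with (1 := Rabs_triang _ _). rewrite Rabs_Ropp. lra.
    - assert (4 * a / 2 ^ N = 2 * a / 2 ^ N + 2 * a / 2 ^ N) by (field; specialize (H2 N); lra).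
      lra. }
  destruct Hcv as [l Hl]. exists l. intros n.
  assert (Hle : Rbar_le (Rabs (l - u n)) (2 * a / 2 ^ n)); [|exact Hle].
  apply (is_lim_seq_le (fun p => Rabs (u (p + n)%nat - u n)) (fun _ => 2 * a / 2 ^ n)).
  - intros p. rewrite Nat.add_comm. apply HC'.
  - apply (is_lim_seq_abs _ (l - u n)).
    apply is_lim_seq_minus'; [|apply is_lim_seq_const].
    now apply (is_lim_seq_incr_n u n l).
  - apply is_lim_seq_const.
Qed.

Lemma le_geometric_0 (x M : R) : (forall n, Rabs x <= M / 2 ^ n) -> x = 0.
Proof.
  intros H. destruct (Req_dec x 0) as [|Hx]; [easy|exfalso].
  apply Rabs_pos_lt in Hx.
  assert (HM : 0 < M) by (specialize (H O); simpl in H; lra).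
  destruct (pow_lt_1_zero (1 / 2) half_contracts (Rabs x / M))
    as [N HN]; [apply Rdiv_lt_0_compat; lra|].
  specialize (HN N (le_n N)). rewrite Rabs_pos_eq in HN by (apply pow_le; lra).
  specialize (H N). apply Rmult_lt_compat_l with (r := M) in HN; [|lra].
  replace (M * (Rabs x / M)) with (Rabs x) in HN by (field; lra).
  replace (M / 2 ^ N) with (M * (1 / 2) ^ N) in H; [lra|].
  replace (1 / 2) with (/ 2) by field. rewrite pow_inv. reflexivity.
Qed.

(** The convergence is only locally uniform: the weight [w] may be unbounded, but its continuity
    bounds it by [w t + 1] near [t]. The exponential weight of the planar Picard iteration requires
    this generality. *)
Lemma continuous_geometric_limit (u : nat -> R -> R) (f w : R -> R) :
  (forall n t, continuous (u n) t) -> (forall t, continuous w t) ->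
  (forall n t, Rabs (f t - u n t) <= w t / 2 ^ n) -> forall t, continuous f t.
Proof.
  intros Hu Hw Hf t. apply continuous_eps. intros eps Heps.
  assert (Hw0 : 0 <= w t).
  { specialize (Hf O t). pose proof (Rabs_pos (f t - u O t)). simpl in Hf. lra. }
  destruct (eps_continuous w t (Hw t) 1 Rlt_0_1) as [d1 [Hd1 H1]].
  destruct (pow_lt_1_zero (1 / 2) half_contracts (eps / (4 * (w t + 1))))
    as [N HN]; [apply Rdiv_lt_0_compat; lra|].
  specialize (HN N (le_n N)). rewrite Rabs_pos_eq in HN by (apply pow_le; lra).
  replace ((1 / 2) ^ N) with (/ 2 ^ N) in HN
    by (replace (1 / 2) with (/ 2) by field; now rewrite pow_inv).
  assert (H2 : 0 < / 2 ^ N) by (apply Rinv_0_lt_compat, pow_lt; lra).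
  destruct (eps_continuous (u N) t (Hu N t) (eps / 4) ltac:(lra)) as [d2 [Hd2 H3]].
  exists (Rmin d1 d2). split; [now apply Rmin_pos|]. intros s Hs.
  assert (A1 : Rabs (w s - w t) < 1) by (apply H1, Rlt_le_trans with (1 := Hs), Rmin_l).
  assert (A2 : Rabs (u N s - u N t) < eps / 4) by (apply H3, Rlt_le_trans with (1 := Hs), Rmin_r).
  pose proof (Hf N t) as B1. pose proof (Hf N s) as B2.
  apply Rabs_lt_between in A1.
  assert (C : (w t + 1) * / 2 ^ N < eps / 4).
  { apply Rmult_lt_compat_l with (r := w t + 1) in HN; [|lra].
    replace ((w t + 1) * (eps / (4 * (w t + 1)))) with (eps / 4) in HN by (field; lra). lra. }
  assert (C1 : w t / 2 ^ N <= (w t + 1) * / 2 ^ N) by (unfold Rdiv; nra).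
  assert (C2 : w s / 2 ^ N <= (w t + 1) * / 2 ^ N) by (unfold Rdiv; nra).
  replace (f s - f t) with ((f s - u N s) + (u N s - u N t) + - (f t - u N t)) by ring.
  apply Rle_lt_trans with (1 := Rabs_triang _ _). rewrite Rabs_Ropp.
  apply Rle_lt_trans with (Rabs (f s - u N s) + Rabs (u N s - u N t) + Rabs (f t - u N t)).
  - apply Rplus_le_compat_r, Rabs_triang.
  - lra.
Qed.

(** * The leaves as solutions of a scalar equation *)

Lemma geometric_limit_fun {I : Type} (u : nat -> I -> R) (a : I -> R) :
  (forall n i, Rabs (u (S n) i - u n i) <= a i / 2 ^ n) ->
  exists f : I -> R, forall n i, Rabs (f i - u n i) <= 2 * a i / 2 ^ n.
Proof.
  intros H.
  exists (fun i => proj1_sig (constructive_indefinite_description _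
    (geometric_limit (fun n => u n i) (a i) (fun n => H n i)))).
  intros n i. destruct constructive_indefinite_description as [l Hl]. apply Hl.
Qed.

(** With 1/20, a leaf whose label is at most 1/100 in modulus keeps [|Gam|] below 3/200, hence
    [|x - 1| < 1/2]. With 1/200, the factor [16 * |theta| * y ^ 2] of [slope_diff] is at most
    [1/8 * (2/3 * |y|)]. *)
Definition small (theta delta : R) : Prop :=
  0 < delta <= 1 / 20 /\ Rabs theta * delta <= 1 / 200.

(** The quotient of the derivatives of [Gam x] and [y] along the flow, after cancelling
    [(x ^ 2 - 1) ^ 2], with [x] expressed as [xi c]. *)
Definition slope (theta y c : R) : R := - y * xi c / (xi c - theta * y).

Lemma small_mult {theta delta : R} (Hs : small theta delta) (y : R) :
  -delta <= y <= delta -> - (1 / 200) <= theta * y <= 1 / 200.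
Proof.
  intros Hy. destruct Hs as [Hd Ht]. apply Rabs_le_between. rewrite Rabs_mult.
  apply Rle_trans with (2 := Ht). apply Rmult_le_compat_l; [apply Rabs_pos|].
  now apply Rabs_le.
Qed.

Lemma small_opp {theta delta : R} : small theta delta -> small (- theta) delta.
Proof. intros [H1 H2]. split; [easy|now rewrite Rabs_Ropp]. Qed.

Lemma slope_factor {theta delta : R} (Hs : small theta delta) (y c : R) :
  -delta <= y <= delta -> 2 / 3 <= xi c / (xi c - theta * y) <= 2.
Proof.
  intros Hy. pose proof (small_mult Hs y Hy). pose proof (xi_range c).
  split.
  - apply -> Rle_div_r; lra.
  - apply <- Rle_div_l; lra.
Qed.

Lemma slope_sign {theta delta : R} (Hs : small theta delta) (y c : R) :
  -delta <= y <= delta -> (0 <= y -> slope theta y c <= 0) /\ (y <= 0 -> 0 <= slope theta y c).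
Proof.
  intros Hy. pose proof (slope_factor Hs y c Hy) as H.
  unfold slope, Rdiv in *. rewrite (Rmult_assoc (- y)).
  revert H. generalize (xi c * / (xi c - theta * y)). intros f H. split; intros; nra.
Qed.

Lemma slope_abs {theta delta : R} (Hs : small theta delta) (y c : R) :
  -delta <= y <= delta -> 2 / 3 * Rabs y <= Rabs (slope theta y c) <= 2 * Rabs y.
Proof.
  intros Hy. pose proof (slope_factor Hs y c Hy) as H.
  unfold slope, Rdiv in *. rewrite (Rmult_assoc (- y)), (Rabs_mult (- y)), Rabs_Ropp.
  rewrite (Rabs_pos_eq (xi c * _)) by lra. pose proof (Rabs_pos y).
  revert H. generalize (xi c * / (xi c - theta * y)). intros f H. split; nra.
Qed.

Lemma slope_diff {theta delta : R} (Hs : small theta delta) (y a b : R) :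
  -delta <= y <= delta ->
  Rabs (slope theta y a - slope theta y b) <= 16 * Rabs theta * y ^ 2 * Rabs (xi a - xi b).
Proof.
  intros Hy. pose proof (small_mult Hs y Hy). pose proof (xi_range a). pose proof (xi_range b).
  unfold slope.
  replace (- y * xi a / (xi a - theta * y) - - y * xi b / (xi b - theta * y)) with
    (theta * y ^ 2 * (xi a - xi b) * / ((xi a - theta * y) * (xi b - theta * y)))
    by (field; lra).
  assert (Hq : 0 < / ((xi a - theta * y) * (xi b - theta * y)) <= 16).
  { split; [apply Rinv_0_lt_compat; nra|].
    replace 16 with (/ (1 / 16)) by field. apply Rinv_le_contravar; nra. }
  set (q := / _) in *.
  rewrite (Rabs_mult _ q), (Rabs_mult (theta * y ^ 2)), (Rabs_mult theta), (Rabs_pos_eq q), (Rabs_pos_eq (y ^ 2)) by (apply pow2_ge_0 || lra).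
  assert (0 <= Rabs theta * y ^ 2 * Rabs (xi a - xi b)).
  { apply Rmult_le_pos; [apply Rmult_le_pos; [|apply pow2_ge_0]|]; apply Rabs_pos. }
  nra.
Qed.

(** Prepares [monotone_oscillation_bound]. The point [e] at which the right-hand slope is taken is
    unrelated to [a], [b] and [c], because the lower bound [2/3 * |y|] for the slope is uniform.
    Numerically, [16/200 <= 1/8 * 2/3]. *)
Lemma slope_oscillation {theta delta : R} (Hs : small theta delta) (y a b c d e : R) :
  -delta <= y <= delta -> Rabs (a - c) <= d -> Rabs (b - c) <= d ->
  Rabs (slope theta y a - slope theta y b) <=
    1 / 8 * Rabs (slope theta y e) * (xi (c + d) - xi (c - d)).
Proof.
  intros Hy Ha Hb. apply Rle_trans with (1 := slope_diff Hs y a b Hy).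
  apply Rabs_le_between in Ha. apply Rabs_le_between in Hb.
  assert (Hx : Rabs (xi a - xi b) <= xi (c + d) - xi (c - d)).
  { pose proof (xi_monotone a (c + d)). pose proof (xi_monotone b (c + d)).
    pose proof (xi_monotone (c - d) a). pose proof (xi_monotone (c - d) b).
    apply Rabs_le. lra. }
  apply Rmult_le_compat; [| |clear Hx|exact Hx].
  - apply Rmult_le_pos; [|apply pow2_ge_0]. pose proof (Rabs_pos theta). lra.
  - apply Rabs_pos.
  - pose proof (slope_abs Hs y e Hy) as [Hl _]. destruct Hs as [Hd Ht].
    assert (Hy' : Rabs y <= delta) by now apply Rabs_le.
    rewrite <- pow2_abs. pose proof (Rabs_pos y). pose proof (Rabs_pos theta).
    assert (Rabs theta * Rabs y <= 1 / 200) by nra.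
    apply Rle_trans with (16 * (1 / 200) * Rabs y); nra.
Qed.

(** The distance [d] is measured from a reference curve [c] rather than between [a] and [b]: [c]
    must be monotone with a slope comparable to [|y|]. It may be driven by another function [e], so
    that a Picard image can serve as reference. Monotonicity of [c] follows from the constant signs
    of [dY] and [Y]. *)
Lemma slope_contraction_half {theta delta : R} (Hs : small theta delta)
    (Y dY c e a b E : R -> R) (d t1 t2 : R) :
  t1 <= t2 -> 0 <= d ->
  (forall t, t1 <= t <= t2 -> -delta <= Y t <= delta) ->
  (forall t, t1 <= t <= t2 -> is_derive c t (dY t * slope theta (Y t) (e t))) ->
  (forall t, t1 <= t <= t2 ->
     is_derive E t (dY t * (slope theta (Y t) (a t) - slope theta (Y t) (b t)))) ->
  (forall t, t1 <= t <= t2 -> Rabs (a t - c t) <= d) ->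
  (forall t, t1 <= t <= t2 -> Rabs (b t - c t) <= d) ->
  ((forall t, t1 <= t <= t2 -> 0 <= dY t) \/ (forall t, t1 <= t <= t2 -> dY t <= 0)) ->
  ((forall t, t1 <= t <= t2 -> 0 <= Y t) \/ (forall t, t1 <= t <= t2 -> Y t <= 0)) ->
  Rabs (E t2 - E t1) <= d / 4.
Proof.
  intros H12 Hd HY Hc HE Ha Hb HdY Hsg.
  replace (d / 4) with (2 * (1 / 8) * d) by field.
  apply (monotone_oscillation_bound (1 / 8) d c _ E _ t1 t2 H12 ltac:(lra) Hd Hc HE).
  - intros t Ht. rewrite !Rabs_mult.
    pose proof (slope_oscillation Hs (Y t) (a t) (b t) (c t) d (e t) (HY t Ht) (Ha t Ht) (Hb t Ht)).
    pose proof (Rabs_pos (dY t)). nra.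
  - assert (S := fun t Ht => slope_sign Hs (Y t) (e t) (HY t Ht)).
    destruct HdY as [HdY|HdY]; destruct Hsg as [Hsg|Hsg];
      [right|left|left|right]; intros t Ht; specialize (HdY t Ht); specialize (Hsg t Ht);
      destruct (S t Ht) as [S1 S2]; nra.
Qed.

Lemma slope_contraction {theta delta : R} (Hs : small theta delta)
    (Y dY c e a b E : R -> R) (d t1 t2 : R) :
  t1 <= t2 -> 0 <= d ->
  (forall t, t1 <= t <= t2 -> -delta <= Y t <= delta) ->
  (forall t, t1 <= t <= t2 -> is_derive Y t (dY t)) ->
  (forall t, t1 <= t <= t2 -> is_derive c t (dY t * slope theta (Y t) (e t))) ->
  (forall t, t1 <= t <= t2 ->
     is_derive E t (dY t * (slope theta (Y t) (a t) - slope theta (Y t) (b t)))) ->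
  (forall t, t1 <= t <= t2 -> Rabs (a t - c t) <= d) ->
  (forall t, t1 <= t <= t2 -> Rabs (b t - c t) <= d) ->
  ((forall t, t1 <= t <= t2 -> 0 <= dY t) \/ (forall t, t1 <= t <= t2 -> dY t <= 0)) ->
  Rabs (E t2 - E t1) <= d / 2.
Proof.
  intros H12 Hd HY HYd Hc HE Ha Hb HdY.
  (* The slope changes sign with [Y], and [Y] is monotone, so one cut at a zero of [Y] leaves two
     intervals on which [c] is monotone. If [Y] keeps its sign, the first interval is the single
     point [t1]. *)
  assert (Hsplit : exists tm, t1 <= tm <= t2 /\
    ((forall t, t1 <= t <= tm -> 0 <= Y t) \/ (forall t, t1 <= t <= tm -> Y t <= 0)) /\
    ((forall t, tm <= t <= t2 -> 0 <= Y t) \/ (forall t, tm <= t <= t2 -> Y t <= 0))).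
  { assert (Hcont : forall t, t1 <= t <= t2 -> continuity_pt Y t).
    { intros t Ht. apply (derive_continuity_pt _ _ _ (HYd t Ht)). }
    destruct HdY as [HdY|HdY].
    - assert (Hmon : forall s t, t1 <= s -> s <= t -> t <= t2 -> Y s <= Y t).
      { intros s t Hs1 Hst Ht2. apply (derive_nondecreasing Y dY); [easy| |];
          intros; [apply HYd|apply HdY]; lra. }
      destruct (Rle_or_lt 0 (Y t1)) as [H1|H1]; [|destruct (Rle_or_lt (Y t2) 0) as [H2|H2]].
      + exists t1. split; [lra|]. split; left; intros t Ht;
          apply Rle_trans with (1 := H1); apply Hmon; lra.
      + exists t1. split; [lra|]. split; right; intros t Ht;
          apply Rle_trans with (2 := H2); apply Hmon; lra.
      + destruct (ivt_incr Y t1 t2 0) as [tm [Htm H0]]; [easy|easy|lra|].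
        exists tm. split; [easy|]. split; [right|left]; intros t Ht;
          rewrite <- H0; apply Hmon; lra.
    - assert (Hmon : forall s t, t1 <= s -> s <= t -> t <= t2 -> Y t <= Y s).
      { intros s t Hs1 Hst Ht2.
        enough (- Y s <= - Y t) by lra.
        apply (derive_nondecreasing (fun t => - Y t) (fun t => - dY t)); [easy| |].
        - intros r Hr. apply (is_derive_opp Y). apply HYd. lra.
        - intros r Hr. specialize (HdY r). lra. }
      destruct (Rle_or_lt (Y t1) 0) as [H1|H1]; [|destruct (Rle_or_lt 0 (Y t2)) as [H2|H2]].
      + exists t1. split; [lra|]. split; right; intros t Ht;
          apply Rle_trans with (2 := H1); apply Hmon; lra.
      + exists t1. split; [lra|]. split; left; intros t Ht;
          apply Rle_trans with (1 := H2); apply Hmon; lra.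
      + destruct (ivt_decr Y t1 t2 0) as [tm [Htm H0]]; [easy|easy|lra|].
        exists tm. split; [easy|]. split; [left|right]; intros t Ht;
          rewrite <- H0; apply Hmon; lra. }
  destruct Hsplit as [tm [Htm [S1 S2]]].
  assert (A1 : Rabs (E tm - E t1) <= d / 4).
  { apply (slope_contraction_half Hs Y dY c e a b E); try easy; try lra;
      try (intros t Ht; (apply HY || apply Hc || apply HE || apply Ha || apply Hb); lra).
    destruct HdY as [H|H]; [left|right]; intros t Ht; apply H; lra. }
  assert (A2 : Rabs (E t2 - E tm) <= d / 4).
  { apply (slope_contraction_half Hs Y dY c e a b E); try easy; try lra;
      try (intros t Ht; (apply HY || apply Hc || apply HE || apply Ha || apply Hb); lra).
    destruct HdY as [H|H]; [left|right]; intros t Ht; apply H; lra. }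
  replace (E t2 - E t1) with ((E t2 - E tm) + (E tm - E t1)) by ring.
  apply Rle_trans with (1 := Rabs_triang _ _). lra.
Qed.

(** * Leaves: existence, uniqueness, and dependence on the base point *)

Definition is_leaf (theta delta : R) (psi : R -> R) : Prop :=
  forall y, -delta <= y <= delta -> is_derive psi y (slope theta y (psi y)).

Lemma slope_contraction_id {theta delta : R} (Hs : small theta delta)
    (c e a b E : R -> R) (d y1 y2 : R) :
  -delta <= y1 <= delta -> -delta <= y2 <= delta -> 0 <= d ->
  (forall t, -delta <= t <= delta -> is_derive c t (slope theta t (e t))) ->
  (forall t, -delta <= t <= delta ->
     is_derive E t (slope theta t (a t) - slope theta t (b t))) ->
  (forall t, -delta <= t <= delta -> Rabs (a t - c t) <= d) ->
  (forall t, -delta <= t <= delta -> Rabs (b t - c t) <= d) ->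
  Rabs (E y2 - E y1) <= d / 2.
Proof.
  intros H1 H2 Hd Hc HE Ha Hb.
  assert (Hm : forall s t, -delta <= s -> s <= t -> t <= delta -> Rabs (E t - E s) <= d / 2).
  { intros s t Hsd Hst Ht.
    apply (slope_contraction Hs (fun t => t) (fun _ => 1) c e a b E); try easy;
      try (intros r Hr; (apply Ha || apply Hb); lra).
    - intros r Hr. lra.
    - intros r Hr. apply (is_derive_id r).
    - intros r Hr. rewrite Rmult_1_l. apply Hc. lra.
    - intros r Hr. rewrite Rmult_1_l. apply HE. lra.
    - left. intros; lra. }
  destruct (Rle_or_lt y1 y2); [apply Hm; lra|].
  rewrite Rabs_minus_sym. apply Hm; lra.
Qed.

Lemma abs_max (f : R -> R) (a b : R) :
  a <= b -> (forall t, a <= t <= b -> continuity_pt f t) ->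
  exists t0, a <= t0 <= b /\ forall t, a <= t <= b -> Rabs (f t) <= Rabs (f t0).
Proof.
  intros Hab Hf.
  destruct (continuity_ab_maj (fun t => Rabs (f t)) a b Hab) as [t0 [H1 H2]].
  - intros t Ht. apply (continuity_pt_comp f Rabs); [now apply Hf|apply Rcontinuity_abs].
  - now exists t0.
Qed.

(** If [d] is the maximum of [|p - q|] over the strip, attained at [t0], then contraction gives
    [d <= d / 2 + |p y0 - q y0|]. This absorption takes the place of Gronwall's inequality, which
    would require [slope] to be Lipschitz in [c]. *)
Lemma leaf_lipschitz {theta delta : R} (Hs : small theta delta) (p q : R -> R) (y0 y : R) :
  is_leaf theta delta p -> is_leaf theta delta q ->
  -delta <= y0 <= delta -> -delta <= y <= delta ->
  Rabs (p y - q y) <= 2 * Rabs (p y0 - q y0).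
Proof.
  intros Hp Hq Hy0 Hy.
  assert (HE : forall t, -delta <= t <= delta ->
    is_derive (fun t => p t - q t) t (slope theta t (p t) - slope theta t (q t))).
  { intros t Ht. apply (is_derive_minus p q); [apply Hp|apply Hq]; easy. }
  destruct (abs_max (fun t => p t - q t) (-delta) delta) as [t0 [Ht0 Hmax]].
  - destruct Hs. lra.
  - intros t Ht. apply (derive_continuity_pt _ _ _ (HE t Ht)).
  - apply Rle_trans with (1 := Hmax y Hy).
    set (d := Rabs (p t0 - q t0)) in *.
    assert (A : Rabs ((p t0 - q t0) - (p y0 - q y0)) <= d / 2).
    { apply (slope_contraction_id Hs p p p q (fun t => p t - q t)); try easy.
      - apply Rabs_pos.
      - intros t Ht. rewrite Rminus_diag, Rabs_R0. apply Rabs_pos.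
      - intros t Ht. rewrite Rabs_minus_sym. now apply Hmax. }
    assert (B : d <= Rabs ((p t0 - q t0) - (p y0 - q y0)) + Rabs (p y0 - q y0)).
    { unfold d. replace (p t0 - q t0) with ((p t0 - q t0 - (p y0 - q y0)) + (p y0 - q y0)) at 1 by ring.
      apply Rabs_triang. }
    lra.
Qed.

Lemma leaf_growth {theta delta : R} (Hs : small theta delta) (p : R -> R) (r y y' : R) :
  is_leaf theta delta p -> r <= delta -> -r <= y <= r -> -r <= y' <= r ->
  Rabs (p y - p y') <= 2 * r * Rabs (y - y').
Proof.
  intros Hp Hr Hy Hy'.
  assert (Hm : forall s t, -r <= s -> s <= t -> t <= r -> Rabs (p t - p s) <= 2 * r * (t - s)).
  { intros s t H1 H2 H3. replace (2 * r * (t - s)) with (2 * r * t - 2 * r * s) by ring.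
    apply (derive_bound p (fun t => slope theta t (p t)) (fun t => 2 * r * t) (fun _ => 2 * r)); try easy.
    - intros u Hu. apply Hp. lra.
    - intros u Hu. auto_derive; [easy|ring].
    - intros u Hu. apply Rle_trans with (1 := proj2 (slope_abs Hs u (p u) ltac:(lra))).
      assert (Rabs u <= r) by (apply Rabs_le; lra). lra. }
  destruct (Rle_or_lt y' y).
  - rewrite (Rabs_pos_eq (y - y')) by lra. apply Hm; lra.
  - rewrite (Rabs_minus_sym (p y)), (Rabs_minus_sym y), (Rabs_pos_eq (y' - y)) by lra.
    apply Hm; lra.
Qed.

(** Clamping the variable of integration keeps the denominator of [slope] positive, so that the
    integrand is continuous on the whole line and the integral is differentiable even at the ends of
    the strip. *)
Definition picard (theta delta y0 c0 : R) (u : R -> R) (t : R) : R :=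
  c0 + RInt (fun s => slope theta (clamp (-delta) delta s) (u s)) y0 t.

Lemma continuous_slope {theta delta : R} (Hs : small theta delta) (u : R -> R) (t : R) :
  (forall s, continuous u s) ->
  continuous (fun s => slope theta (clamp (-delta) delta s) (u s)) t.
Proof.
  intros Hu. unfold slope, Rdiv.
  assert (Hc : continuous (clamp (- delta) delta) t) by apply continuous_clamp.
  assert (Hx : continuous (fun s => xi (u s)) t)
    by (apply (continuous_comp u xi); [apply Hu|apply continuous_xi]).
  apply (continuous_mult (fun s => - clamp (- delta) delta s * xi (u s))
    (fun s => / (xi (u s) - theta * clamp (- delta) delta s))).
  - apply (continuous_mult (fun s => - clamp (- delta) delta s)); [|easy].
    now apply (continuous_opp (clamp (- delta) delta)).
  - apply continuous_Rinv_comp.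
    + apply (continuous_minus (fun s => xi (u s))); [easy|].
      apply (continuous_mult (fun _ => theta)); [apply continuous_const|easy].
    + pose proof (xi_range (u t)). destruct (Hs) as [Hd _].
      pose proof (small_mult Hs _ (clamp_range (- delta) delta t ltac:(lra))). lra.
Qed.

Lemma is_derive_primitive (f : R -> R) (c0 t0 t : R) :
  (forall s, continuous f s) -> is_derive (fun t => c0 + RInt f t0 t) t (f t).
Proof.
  intros Hf. replace (f t) with (0 + f t) by ring.
  apply (is_derive_plus (fun _ => c0) (RInt f t0)).
  - apply is_derive_Reals, derivable_pt_lim_const.
  - apply (is_derive_RInt f (RInt f t0) t0); [|apply Hf].
    apply filter_forall. intros b. apply (RInt_correct (V := R_CompleteNormedModule) f t0 b).
    apply (ex_RInt_continuous f). intros z _. apply Hf.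
Qed.

Lemma is_derive_picard {theta delta : R} (Hs : small theta delta) (y0 c0 : R) (u : R -> R) (t : R) :
  (forall s, continuous u s) ->
  is_derive (picard theta delta y0 c0 u) t (slope theta (clamp (-delta) delta t) (u t)).
Proof.
  intros Hu.
  apply (is_derive_primitive (fun s => slope theta (clamp (-delta) delta s) (u s)) c0 y0 t).
  intros s. now apply continuous_slope.
Qed.

Lemma picard_init (theta delta y0 c0 : R) (u : R -> R) : picard theta delta y0 c0 u y0 = c0.
Proof.
  unfold picard. rewrite (RInt_point (V := R_CompleteNormedModule) y0).
  unfold zero; simpl. ring.
Qed.

(** Not a contraction between arbitrary functions: both arguments have to lie within [d] of one
    Picard image, the reference curve. Consecutive iterates and the limit do so, with the image of
    an earlier iterate. *)
Lemma picard_contraction {theta delta : R} (Hs : small theta delta) (y0 c0 : R)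
    (u v w : R -> R) (d : R) :
  -delta <= y0 <= delta -> 0 <= d ->
  (forall s, continuous u s) -> (forall s, continuous v s) -> (forall s, continuous w s) ->
  (forall t, -delta <= t <= delta -> Rabs (u t - picard theta delta y0 c0 w t) <= d) ->
  (forall t, -delta <= t <= delta -> Rabs (v t - picard theta delta y0 c0 w t) <= d) ->
  forall t, -delta <= t <= delta ->
    Rabs (picard theta delta y0 c0 u t - picard theta delta y0 c0 v t) <= d / 2.
Proof.
  intros Hy0 Hd Hu Hv Hw Hud Hvd t Ht.
  assert (HP : forall f, (forall s, continuous f s) -> forall s, -delta <= s <= delta ->
    is_derive (picard theta delta y0 c0 f) s (slope theta s (f s))).
  { intros f Hf s Hsd. pose proof (is_derive_picard Hs y0 c0 f s Hf) as H.
    now rewrite clamp_id in H. }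
  pose proof (slope_contraction_id Hs (picard theta delta y0 c0 w) w u v
    (fun t => picard theta delta y0 c0 u t - picard theta delta y0 c0 v t) d y0 t) as H.
  cbv beta in H. rewrite !picard_init, Rminus_diag, Rminus_0_r in H.
  apply H; try easy.
  - intros s Hsd. now apply HP.
  - intros s Hsd. apply (is_derive_minus (picard theta delta y0 c0 u)); now apply HP.
Qed.

Lemma leaf_exists {theta delta : R} (Hs : small theta delta) (y0 c0 : R) :
  -delta <= y0 <= delta -> exists psi, is_leaf theta delta psi /\ psi y0 = c0.
Proof.
  intros Hy0. destruct (Hs) as [Hd _].
  set (cl := clamp (- delta) delta). set (T := picard theta delta y0 c0).
  (* Precomposing with [cl] freezes the iterates outside the strip, which makes the bounds on the
     increments valid for every real [t]. *)
  set (u := fix u n := match n with O => fun _ : R => c0 | S n => fun t => T (u n) (cl t) end).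
  assert (Hcl : forall t, -delta <= cl t <= delta) by (intros t; apply clamp_range; lra).
  assert (Hu : forall n t, continuous (u n) t).
  { induction n as [|n IH]; intros t; [apply continuous_const|].
    apply (continuous_comp cl (T (u n))); [apply continuous_clamp|].
    apply (ex_derive_continuous (T (u n))). eexists. now apply is_derive_picard. }
  set (M := 2 * (2 * delta * (2 * delta))).
  assert (HM : 0 <= M) by (unfold M; nra).
  assert (H2 : forall n, 0 < 2 ^ n) by (intros n; apply pow_lt; lra).
  assert (Hin : forall n t, -delta <= t <= delta -> u (S n) t = T (u n) t).
  { intros n t Ht. simpl. unfold cl. now rewrite clamp_id. }
  assert (Hstep : forall n t, Rabs (u (S n) t - u n t) <= M / 2 ^ n).
  { induction n as [|n IH]; intros t.
    - assert (Hl : forall s t, -delta <= s -> s <= t -> t <= delta ->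
        Rabs (T (u O) t - T (u O) s) <= M).
      { intros s r H3 H4 H5. apply Rle_trans with (2 * delta * r - 2 * delta * s); [|unfold M; nra].
        apply (derive_bound (T (u O)) (fun t => slope theta (cl t) (u O t))
          (fun t => 2 * delta * t) (fun _ => 2 * delta)); try easy.
        - intros v Hv. now apply is_derive_picard.
        - intros v Hv. auto_derive; [easy|ring].
        - intros v Hv. apply Rle_trans with (1 := proj2 (slope_abs Hs _ (u O v) (Hcl v))).
          assert (Rabs (cl v) <= delta) by (apply Rabs_le, Hcl). lra. }
      unfold Rdiv; rewrite pow_O, Rinv_1, Rmult_1_r.
      change (u 1%nat t - u O t) with (T (u O) (cl t) - c0).
      rewrite <- (picard_init theta delta y0 c0 (u O)). fold T.
      pose proof (Hcl t). destruct (Rle_or_lt y0 (cl t)); [apply Hl; lra|].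
      rewrite Rabs_minus_sym. apply Hl; lra.
    - change (u (S (S n)) t - u (S n) t) with (T (u (S n)) (cl t) - T (u n) (cl t)).
      replace (M / 2 ^ S n) with (M / 2 ^ n / 2) by (simpl; field; specialize (H2 n); lra).
      apply (picard_contraction Hs y0 c0 (u (S n)) (u n) (u n)); try easy.
      + apply Rdiv_le_0_compat; auto.
      + intros r Hr. rewrite Hin by easy. fold T. rewrite Rminus_diag, Rabs_R0.
        apply Rdiv_le_0_compat; auto.
      + intros r Hr. fold T. rewrite <- Hin, Rabs_minus_sym by easy. apply IH. }
  destruct (geometric_limit_fun u (fun _ => M) Hstep) as [phi Hphi].
  assert (Hphic : forall t, continuous phi t).
  { apply (continuous_geometric_limit u phi (fun _ => 2 * M)); auto.
    intros t. apply continuous_const. }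
  assert (Hfix : forall t, -delta <= t <= delta -> T phi t = phi t).
  { intros t Ht. apply Rminus_diag_uniq. apply (le_geometric_0 _ (2 * M)). intros n.
    assert (Hdn : 0 <= M / 2 ^ n) by (apply Rdiv_le_0_compat; auto).
    assert (Hh : 2 * M / 2 ^ S n = M / 2 ^ n) by (simpl; field; specialize (H2 n); lra).
    assert (A : Rabs (T phi t - T (u n) t) <= M / 2 ^ n / 2).
    { apply (picard_contraction Hs y0 c0 phi (u n) (u n)); try easy.
      - intros r Hr. fold T. rewrite <- Hin by easy.
        apply Rle_trans with (1 := Hphi (S n) r). lra.
      - intros r Hr. fold T. rewrite <- Hin, Rabs_minus_sym by easy. apply Hstep. }
    pose proof (Hphi (S n) t) as B. rewrite Hin in B by easy. rewrite Hh in B.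
    replace (T phi t - phi t) with ((T phi t - T (u n) t) + - (phi t - T (u n) t)) by ring.
    apply Rle_trans with (1 := Rabs_triang _ _). rewrite Rabs_Ropp.
    unfold Rdiv in *. lra. }
  (* [phi] agrees with [T phi] on the strip only; the two-sided derivatives required at its ends are
     available for the integral [T phi]. *)
  exists (T phi). split; [|apply picard_init].
  intros y Hy. rewrite Hfix by easy.
  pose proof (is_derive_picard Hs y0 c0 phi y Hphic) as H. now rewrite clamp_id in H.
Qed.

Definition leaf (theta delta y0 c0 : R) : R -> R :=
  epsilon (inhabits (fun _ => 0)) (fun psi => is_leaf theta delta psi /\ psi y0 = c0).

Lemma leaf_spec {theta delta : R} (Hs : small theta delta) (y0 c0 : R) :
  -delta <= y0 <= delta ->
  is_leaf theta delta (leaf theta delta y0 c0) /\ leaf theta delta y0 c0 y0 = c0.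
Proof. intros Hy. unfold leaf. apply epsilon_spec. now apply leaf_exists. Qed.

Lemma leaf_unique {theta delta : R} (Hs : small theta delta) (p q : R -> R) (y0 y : R) :
  is_leaf theta delta p -> is_leaf theta delta q -> p y0 = q y0 ->
  -delta <= y0 <= delta -> -delta <= y <= delta -> p y = q y.
Proof.
  intros Hp Hq He Hy0 Hy. pose proof (leaf_lipschitz Hs p q y0 y Hp Hq Hy0 Hy) as H.
  rewrite He, Rminus_diag, Rabs_R0 in H. apply Rminus_diag_uniq.
  destruct (Req_dec (p y - q y) 0) as [|Hn]; [easy|].
  apply Rabs_pos_lt in Hn. lra.
Qed.

(** The reflection of the plane in the x-axis, seen on leaves. It lets every statement about the
    unstable side be deduced from the stable one with parameter [- theta]. *)
Lemma leaf_reflect {theta delta : R} (p : R -> R) :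
  is_leaf theta delta p -> is_leaf (- theta) delta (fun y => p (- y)).
Proof.
  intros Hp y Hy.
  replace (slope (- theta) y (p (- y))) with (-1 * slope theta (- y) (p (- y))).
  - apply (is_derive_comp p (fun y => - y)); [apply Hp; lra|].
    auto_derive; [easy|ring].
  - unfold slope, Rdiv. replace (xi (p (- y)) - - theta * y) with (xi (p (- y)) - theta * - y) by ring.
    ring.
Qed.

(* Base points outside the strip [|y| <= delta] are moved to its boundary, so that
   both functions below are defined and Lipschitz on the whole plane. *)
Definition leaf_from (theta delta kappa y : R) : R :=
  leaf theta delta 0 kappa (clamp (-delta) delta y).

Definition leaf_label (theta delta c y : R) : R :=
  leaf theta delta (clamp (-delta) delta y) c 0.

Lemma leaf_from_lipschitz {theta delta : R} (Hs : small theta delta) (k y k' y' : R) :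
  Rabs (leaf_from theta delta k y - leaf_from theta delta k' y') <=
    2 * Rabs (k - k') + Rabs (y - y').
Proof.
  destruct (Hs) as [Hd _]. unfold leaf_from. set (cl := clamp (- delta) delta).
  assert (H0 : -delta <= 0 <= delta) by lra.
  assert (Hcl : forall t, -delta <= cl t <= delta) by (intros t; apply clamp_range; lra).
  destruct (leaf_spec Hs 0 k H0) as [P1 P2]. destruct (leaf_spec Hs 0 k' H0) as [Q1 Q2].
  set (p := leaf theta delta 0 k) in *. set (q := leaf theta delta 0 k') in *.
  pose proof (leaf_lipschitz Hs p q 0 (cl y) P1 Q1 H0 (Hcl y)) as A. rewrite P2, Q2 in A.
  pose proof (leaf_growth Hs q delta (cl y) (cl y') Q1 (Rle_refl _) (Hcl y) (Hcl y')) as B.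
  pose proof (clamp_lipschitz (- delta) delta y y') as C. fold cl in C.
  pose proof (Rabs_pos (cl y - cl y')).
  replace (p (cl y) - q (cl y')) with ((p (cl y) - q (cl y)) + (q (cl y) - q (cl y'))) by ring.
  apply Rle_trans with (1 := Rabs_triang _ _). nra.
Qed.

Lemma leaf_label_lipschitz {theta delta : R} (Hs : small theta delta) (c y c' y' : R) :
  Rabs (leaf_label theta delta c y - leaf_label theta delta c' y') <=
    2 * Rabs (c - c') + Rabs (y - y').
Proof.
  destruct (Hs) as [Hd _]. unfold leaf_label. set (cl := clamp (- delta) delta).
  assert (H0 : -delta <= 0 <= delta) by lra.
  assert (Hcl : forall t, -delta <= cl t <= delta) by (intros t; apply clamp_range; lra).
  destruct (leaf_spec Hs (cl y) c (Hcl y)) as [P1 P2].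
  destruct (leaf_spec Hs (cl y') c' (Hcl y')) as [Q1 Q2].
  set (p := leaf theta delta (cl y) c) in *. set (q := leaf theta delta (cl y') c') in *.
  pose proof (leaf_lipschitz Hs p q (cl y) 0 P1 Q1 (Hcl y) H0) as A.
  pose proof (leaf_growth Hs q delta (cl y') (cl y) Q1 (Rle_refl _) (Hcl y') (Hcl y)) as B.
  pose proof (clamp_lipschitz (- delta) delta y y') as C. fold cl in C.
  rewrite (Rabs_minus_sym (cl y')) in B. pose proof (Rabs_pos (cl y - cl y')).
  assert (D : Rabs (p (cl y) - q (cl y)) <= Rabs (c - c') + Rabs (q (cl y') - q (cl y))).
  { rewrite P2. replace (c - q (cl y)) with ((c - c') + (q (cl y') - q (cl y))) by (rewrite Q2; ring).
    apply Rabs_triang. }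
  nra.
Qed.

Lemma leaf_label_unique {theta delta : R} (Hs : small theta delta) (p : R -> R) (c y : R) :
  is_leaf theta delta p -> -delta <= y <= delta -> p y = c -> leaf_label theta delta c y = p 0.
Proof.
  intros Hp Hy He. destruct (Hs) as [Hd _]. unfold leaf_label. rewrite clamp_id by easy.
  destruct (leaf_spec Hs y c Hy) as [P1 P2].
  apply (leaf_unique Hs _ p y); try easy; [now rewrite P2|lra].
Qed.

Lemma leaf_from_unique {theta delta : R} (Hs : small theta delta) (p : R -> R) (y : R) :
  is_leaf theta delta p -> -delta <= y <= delta -> leaf_from theta delta (p 0) y = p y.
Proof.
  intros Hp Hy. destruct (Hs) as [Hd _]. unfold leaf_from. rewrite clamp_id by easy.
  destruct (leaf_spec Hs 0 (p 0) ltac:(lra)) as [P1 P2].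
  apply (leaf_unique Hs _ p 0); try easy; lra.
Qed.

Lemma leaf_from_is_leaf {theta delta : R} (Hs : small theta delta) (k : R) :
  exists p, is_leaf theta delta p /\ p 0 = k /\
    forall y, -delta <= y <= delta -> leaf_from theta delta k y = p y.
Proof.
  destruct (Hs) as [Hd _]. destruct (leaf_spec Hs 0 k ltac:(lra)) as [P1 P2].
  exists (leaf theta delta 0 k). split; [easy|]. split; [easy|].
  intros y Hy. unfold leaf_from. now rewrite clamp_id.
Qed.

Lemma leaf_label_is_leaf {theta delta : R} (Hs : small theta delta) (c y : R) :
  -delta <= y <= delta ->
  exists p, is_leaf theta delta p /\ p 0 = leaf_label theta delta c y /\ p y = c.
Proof.
  intros Hy. destruct (leaf_spec Hs y c Hy) as [P1 P2].
  exists (leaf theta delta y c). split; [easy|]. split; [|easy].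
  unfold leaf_label. now rewrite clamp_id.
Qed.

Lemma leaf_label_from {theta delta : R} (Hs : small theta delta) (k y : R) :
  -delta <= y <= delta -> leaf_label theta delta (leaf_from theta delta k y) y = k.
Proof.
  intros Hy. destruct (leaf_from_is_leaf Hs k) as [p [P1 [P2 P3]]].
  rewrite P3, <- P2 by easy. now apply leaf_label_unique.
Qed.

Lemma leaf_from_label {theta delta : R} (Hs : small theta delta) (c y : R) :
  -delta <= y <= delta -> leaf_from theta delta (leaf_label theta delta c y) y = c.
Proof.
  intros Hy. destruct (leaf_label_is_leaf Hs c y Hy) as [p [P1 [P2 P3]]].
  rewrite <- P2, <- P3. now apply leaf_from_unique.
Qed.

Lemma leaf_label_reflect {theta delta : R} (Hs : small theta delta) (c y : R) :
  -delta <= y <= delta -> leaf_label (- theta) delta c (- y) = leaf_label theta delta c y.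
Proof.
  intros Hy. destruct (leaf_label_is_leaf Hs c y Hy) as [p [P1 [P2 P3]]].
  rewrite <- P2. rewrite <- Ropp_0 at 1.
  apply (leaf_label_unique (small_opp Hs) (fun y => p (- y))).
  - now apply leaf_reflect.
  - lra.
  - now rewrite Ropp_involutive.
Qed.

Lemma leaf_from_bound {theta delta : R} (Hs : small theta delta) (k y r : R) :
  r <= delta -> -r <= y <= r -> Rabs (leaf_from theta delta k y - k) <= 2 * r * Rabs y.
Proof.
  intros Hr Hy. destruct (leaf_from_is_leaf Hs k) as [p [P1 [P2 P3]]].
  rewrite P3 by lra. rewrite <- P2.
  replace (Rabs y) with (Rabs (y - 0)) by (f_equal; ring).
  apply (leaf_growth Hs); try easy. lra.
Qed.

(** * Planar solutions *)

Lemma is_derive_pair (g : R -> R * R) (t a b : R) :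
  is_derive g t ((a, b) : R * R) <->
  is_derive (fun t => fst (g t)) t a /\ is_derive (fun t => snd (g t)) t b.
Proof.
  split.
  - intros H. split.
    + apply (filterdiff_ext_lin _ (fun y : R => fst (scal y ((a, b) : R * R)))).
      * apply (filterdiff_comp g fst _ fst H). apply filterdiff_linear, is_linear_fst.
      * reflexivity.
    + apply (filterdiff_ext_lin _ (fun y : R => snd (scal y ((a, b) : R * R)))).
      * apply (filterdiff_comp g snd _ snd H). apply filterdiff_linear, is_linear_snd.
      * reflexivity.
  - intros [H1 H2].
    apply (filterdiff_ext (fun t => (fst (g t), snd (g t)))).
    + intros s. now rewrite <- surjective_pairing.
    + apply (filterdiff_comp_2 (fun t => fst (g t)) (fun t => snd (g t)) pair _ _ pair H1 H2).
      apply (filterdiff_ext (fun u => u)); [now intros [u v]|].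
      apply (filterdiff_ext_lin _ (fun u => u)); [apply filterdiff_id|now intros [u v]].
Qed.

Definition vel (theta x y : R) : R := (x ^ 2 - 1) ^ 2 * (theta * y - x).

Lemma cusp_solution_iff (theta : R) (I : R -> Prop) (g : R -> R * R) :
  solution_on (cusp_system theta) I g <->
  forall t, I t -> is_derive (fun t => fst (g t)) t (snd (g t)) /\
                   is_derive (fun t => snd (g t)) t (vel theta (fst (g t)) (snd (g t))).
Proof.
  assert (H : forall z, cusp_system theta z = (snd z, vel theta (fst z) (snd z))).
  { intros [x y]. unfold cusp_system, vel. simpl. f_equal. ring. }
  split; intros Hs t Ht; specialize (Hs t Ht).
  - rewrite H in Hs. now apply is_derive_pair.
  - rewrite H. now apply is_derive_pair.
Qed.

(** [w * exp (- C * t)] is nonincreasing and [w * exp (C * t)] nondecreasing; the first settles the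
    times after [t0], the second those before. *)
Lemma gronwall_zero (w dw : R -> R) (C a b t0 : R) :
  a <= t0 <= b -> (forall t, a <= t <= b -> is_derive w t (dw t)) ->
  (forall t, a <= t <= b -> 0 <= w t) ->
  (forall t, a <= t <= b -> Rabs (dw t) <= C * w t) -> w t0 = 0 ->
  forall t, a <= t <= b -> w t = 0.
Proof.
  intros Ht0 Hd Hp Hb H0 t Ht.
  assert (He : forall K s, a <= s <= b ->
    is_derive (fun s => w s * exp (K * s)) s ((dw s + K * w s) * exp (K * s))).
  { intros K s Hs. replace ((dw s + K * w s) * exp (K * s)) with
      (dw s * exp (K * s) + w s * (K * exp (K * s))) by ring.
    apply (is_derive_mult w (fun s => exp (K * s))); [now apply Hd| |intros; apply Rmult_comm].
    auto_derive; [easy|ring]. }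
  apply Rle_antisym; [|now apply Hp].
  destruct (Rle_or_lt t0 t) as [Hle|Hlt].
  - assert (A : - (w t0 * exp (- C * t0)) <= - (w t * exp (- C * t))).
    { apply (derive_nondecreasing (fun s => - (w s * exp (- C * s)))
        (fun s => - ((dw s + - C * w s) * exp (- C * s)))); [easy| |].
      - intros s Hs. apply (is_derive_opp (fun s => w s * exp (- C * s))), He. lra.
      - intros s Hs. specialize (Hb s). apply Rabs_le_between in Hb; [|lra].
        pose proof (exp_pos (- C * s)). nra. }
    rewrite H0 in A. pose proof (exp_pos (- C * t)). nra.
  - assert (A : w t * exp (C * t) <= w t0 * exp (C * t0)).
    { apply (derive_nondecreasing (fun s => w s * exp (C * s))
        (fun s => (dw s + C * w s) * exp (C * s))); [lra| |].
      - intros s Hs. apply He. lra.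
      - intros s Hs. specialize (Hb s). apply Rabs_le_between in Hb; [|lra].
        pose proof (exp_pos (C * s)). nra. }
    rewrite H0 in A. pose proof (exp_pos (C * t)). nra.
Qed.

Lemma vel_diff (theta x1 y1 x2 y2 : R) :
  vel theta x1 y1 - vel theta x2 y2 =
  (- (x1 ^ 2 - 1) ^ 2 + (theta * y2 - x2) * (x1 + x2) * (x1 ^ 2 + x2 ^ 2 - 2)) * (x1 - x2) +
  (theta * (x1 ^ 2 - 1) ^ 2) * (y1 - y2).
Proof. unfold vel. ring. Qed.

(** The two solutions may lie anywhere in the plane, where the field has no global Lipschitz
    constant. But the coefficients [A] and [B] of [vel_diff] are continuous along the given
    solutions, hence bounded on [[a, b]], and Gronwall applies to the squared distance. *)
Lemma cusp_unique (theta : R) (g1 g2 : R -> R * R) (a b t0 : R) :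
  a <= t0 <= b ->
  solution_on (cusp_system theta) (fun t => a <= t <= b) g1 ->
  solution_on (cusp_system theta) (fun t => a <= t <= b) g2 ->
  g1 t0 = g2 t0 -> forall t, a <= t <= b -> g1 t = g2 t.
Proof.
  intros Ht0 H1 H2 H0 t Ht.
  rewrite cusp_solution_iff in H1, H2.
  set (x1 := fun t => fst (g1 t)). set (y1 := fun t => snd (g1 t)).
  set (x2 := fun t => fst (g2 t)). set (y2 := fun t => snd (g2 t)).
  assert (Hd : forall s, a <= s <= b ->
    is_derive x1 s (y1 s) /\ is_derive y1 s (vel theta (x1 s) (y1 s)) /\
    is_derive x2 s (y2 s) /\ is_derive y2 s (vel theta (x2 s) (y2 s))).
  { intros s Hs. destruct (H1 s Hs), (H2 s Hs). easy. }
  assert (Hex : forall s, a <= s <= b -> ex_derive x1 s /\ ex_derive y1 s /\ ex_derive x2 s /\ ex_derive y2 s).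
  { intros s Hs. destruct (Hd s Hs) as [A [B [C D]]]. repeat split; eexists; eassumption. }
  set (A := fun s => - (x1 s ^ 2 - 1) ^ 2 +
    (theta * y2 s - x2 s) * (x1 s + x2 s) * (x1 s ^ 2 + x2 s ^ 2 - 2)).
  set (B := fun s => theta * (x1 s ^ 2 - 1) ^ 2).
  assert (Hab : a <= b) by lra.
  assert (Hcont : forall f s, ex_derive f s -> continuity_pt f s).
  { intros f s [l Hl]. now apply derive_continuity_pt with l. }
  destruct (abs_max A a b Hab) as [ta [_ HA]].
  { intros s Hs. apply Hcont. unfold A. destruct (Hex s Hs) as [E1 [E2 [E3 E4]]].
    auto_derive. repeat split; easy. }
  destruct (abs_max B a b Hab) as [tb [_ HB]].
  { intros s Hs. apply Hcont. unfold B. destruct (Hex s Hs) as [E1 [E2 [E3 E4]]].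
    auto_derive. repeat split; easy. }
  set (LA := Rabs (A ta)) in *. set (LB := Rabs (B tb)) in *.
  set (w := fun s => (x1 s - x2 s) ^ 2 + (y1 s - y2 s) ^ 2).
  assert (Hw : w t = 0).
  { apply (gronwall_zero w (fun s => 2 * (x1 s - x2 s) * (y1 s - y2 s) +
      2 * (y1 s - y2 s) * (A s * (x1 s - x2 s) + B s * (y1 s - y2 s)))
      (1 + LA + 2 * LB) a b t0); try easy.
    - intros s Hs. destruct (Hd s Hs) as [D1 [D2 [D3 D4]]].
      unfold A, B. rewrite <- vel_diff.
      assert (P1 : is_derive (fun s => x1 s - x2 s) s (y1 s - y2 s))
        by now apply (is_derive_minus x1 x2).
      assert (P2 : is_derive (fun s => y1 s - y2 s) s
        (vel theta (x1 s) (y1 s) - vel theta (x2 s) (y2 s)))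
        by now apply (is_derive_minus y1 y2).
      set (dv := vel theta (x1 s) (y1 s) - vel theta (x2 s) (y2 s)) in *.
      replace (2 * (x1 s - x2 s) * (y1 s - y2 s) + 2 * (y1 s - y2 s) * dv) with
        ((y1 s - y2 s) * (2 * (x1 s - x2 s)) + dv * (2 * (y1 s - y2 s))) by ring.
      apply (is_derive_plus (fun s => (x1 s - x2 s) ^ 2) (fun s => (y1 s - y2 s) ^ 2)).
      + apply (is_derive_comp (fun u => u ^ 2) (fun s => x1 s - x2 s)); [|exact P1].
        auto_derive; [easy|ring].
      + apply (is_derive_comp (fun u => u ^ 2) (fun s => y1 s - y2 s)); [|exact P2].
        auto_derive; [easy|ring].
    - intros s Hs. apply Rplus_le_le_0_compat; apply pow2_ge_0.
    - intros s Hs. specialize (HA s Hs). specialize (HB s Hs). unfold w.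
      set (u := x1 s - x2 s). set (v := y1 s - y2 s).
      replace (2 * u * v + 2 * v * (A s * u + B s * v)) with
        ((1 + A s) * (2 * u * v) + B s * (2 * v ^ 2)) by ring.
      apply Rle_trans with (1 := Rabs_triang _ _). rewrite !Rabs_mult.
      rewrite (Rabs_pos_eq (v ^ 2)) by apply pow2_ge_0.
      rewrite (Rabs_pos_eq 2) by lra.
      assert (K1 : 2 * Rabs u * Rabs v <= u ^ 2 + v ^ 2).
      { rewrite <- (pow2_abs u), <- (pow2_abs v).
        pose proof (pow2_ge_0 (Rabs u - Rabs v)). nra. }
      assert (K2 : Rabs (1 + A s) <= 1 + LA).
      { apply Rle_trans with (1 := Rabs_triang _ _). rewrite Rabs_R1. lra. }
      pose proof (Rabs_pos (1 + A s)). pose proof (Rabs_pos (B s)).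
      pose proof (pow2_ge_0 u). pose proof (pow2_ge_0 v).
      assert (Rabs (1 + A s) * (2 * Rabs u * Rabs v) <= (1 + LA) * (u ^ 2 + v ^ 2)).
      { apply Rmult_le_compat; try easy.
        pose proof (Rabs_pos u). pose proof (Rabs_pos v). nra. }
      assert (Rabs (B s) * (2 * v ^ 2) <= LB * (2 * v ^ 2)) by (apply Rmult_le_compat_r; nra).
      assert (0 <= LB) by lra. nra.
    - unfold w, x1, x2, y1, y2. rewrite H0. ring. }
  unfold w in Hw.
  pose proof (pow2_ge_0 (x1 t - x2 t)). pose proof (pow2_ge_0 (y1 t - y2 t)).
  assert (Ex : (x1 t - x2 t) ^ 2 = 0) by lra. assert (Ey : (y1 t - y2 t) ^ 2 = 0) by lra.
  assert (x1 t = x2 t) by (apply Rminus_diag_uniq; simpl in Ex; nra).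
  assert (y1 t = y2 t) by (apply Rminus_diag_uniq; simpl in Ey; nra).
  rewrite (surjective_pairing (g1 t)), (surjective_pairing (g2 t)). now f_equal.
Qed.

(* Clamping makes the field globally Lipschitz, so its solutions are defined for
   all times; they solve the original system as long as they stay in the box. *)
Definition velc (theta delta x y : R) : R :=
  vel theta (clamp (1 / 2) (3 / 2) x) (clamp (-delta) delta y).

Lemma velc_lipschitz {theta delta : R} (Hs : small theta delta) (x1 y1 x2 y2 : R) :
  Rabs (velc theta delta x1 y1 - velc theta delta x2 y2) <=
    60 * (1 + Rabs theta) * (Rabs (x1 - x2) + Rabs (y1 - y2)).
Proof.
  unfold velc. destruct (Hs) as [Hd _].
  pose proof (clamp_lipschitz (1 / 2) (3 / 2) x1 x2) as Hx.
  pose proof (clamp_lipschitz (- delta) delta y1 y2) as Hy.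
  pose proof (clamp_range (1 / 2) (3 / 2) x1 ltac:(lra)) as Rx1.
  pose proof (clamp_range (1 / 2) (3 / 2) x2 ltac:(lra)) as Rx2.
  pose proof (clamp_range (- delta) delta y2 ltac:(lra)) as Ry2.
  set (a1 := clamp (1 / 2) (3 / 2) x1) in *. set (a2 := clamp (1 / 2) (3 / 2) x2) in *.
  set (b1 := clamp (- delta) delta y1) in *. set (b2 := clamp (- delta) delta y2) in *.
  pose proof (small_mult Hs b2 Ry2) as Htb.
  pose proof (Rabs_pos theta) as Ht. pose proof (Rabs_pos (a1 - a2)). pose proof (Rabs_pos (b1 - b2)).
  rewrite vel_diff.
  assert (S1 : 0 <= (a1 ^ 2 - 1) ^ 2 <= 4).
  { assert (- (3 / 4) <= a1 ^ 2 - 1 <= 5 / 4) by (simpl; nra).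
    revert H1. generalize (a1 ^ 2 - 1). intros u Hu. simpl. nra. }
  assert (SA : Rabs (- (a1 ^ 2 - 1) ^ 2 +
    (theta * b2 - a2) * (a1 + a2) * (a1 ^ 2 + a2 ^ 2 - 2)) <= 60).
  { assert (U1 : Rabs (theta * b2 - a2) <= 2) by (apply Rabs_le; lra).
    assert (U2 : Rabs (a1 + a2) <= 3) by (apply Rabs_le; lra).
    assert (U3 : Rabs (a1 ^ 2 + a2 ^ 2 - 2) <= 3) by (apply Rabs_le; simpl; nra).
    apply Rle_trans with (1 := Rabs_triang _ _).
    rewrite Rabs_Ropp, (Rabs_pos_eq ((a1 ^ 2 - 1) ^ 2)) by lra. rewrite !Rabs_mult.
    assert (Rabs (theta * b2 - a2) * Rabs (a1 + a2) <= 2 * 3)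
      by (apply Rmult_le_compat; auto using Rabs_pos).
    assert (Rabs (theta * b2 - a2) * Rabs (a1 + a2) * Rabs (a1 ^ 2 + a2 ^ 2 - 2) <= 2 * 3 * 3).
    { apply Rmult_le_compat; auto using Rabs_pos.
      apply Rmult_le_pos; apply Rabs_pos. }
    lra. }
  assert (SB : Rabs (theta * (a1 ^ 2 - 1) ^ 2) <= 60 * Rabs theta).
  { rewrite Rabs_mult, (Rabs_pos_eq ((a1 ^ 2 - 1) ^ 2)) by lra. nra. }
  apply Rle_trans with (1 := Rabs_triang _ _). rewrite (Rabs_mult _ (a1 - a2)), (Rabs_mult _ (b1 - b2)).
  apply Rle_trans with (60 * Rabs (x1 - x2) + 60 * Rabs theta * Rabs (y1 - y2)).
  - apply Rplus_le_compat; apply Rmult_le_compat; auto using Rabs_pos.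
  - pose proof (Rabs_pos (x1 - x2)). pose proof (Rabs_pos (y1 - y2)). nra.
Qed.

Lemma velc_nonpos {theta delta : R} (Hs : small theta delta) (x y : R) :
  velc theta delta x y <= 0.
Proof.
  unfold velc, vel. destruct (Hs) as [Hd _].
  pose proof (clamp_range (1 / 2) (3 / 2) x ltac:(lra)).
  pose proof (small_mult Hs _ (clamp_range (- delta) delta y ltac:(lra))).
  set (s := _ ^ 2 - 1). pose proof (pow2_ge_0 s). nra.
Qed.

Lemma velc_id (theta delta x y : R) :
  1 / 2 <= x <= 3 / 2 -> -delta <= y <= delta -> velc theta delta x y = vel theta x y.
Proof. intros Hx Hy. unfold velc. now rewrite !clamp_id. Qed.

Lemma continuous_velc {theta delta : R} (Hs : small theta delta) (X Y : R -> R) (t : R) :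
  continuous X t -> continuous Y t -> continuous (fun s => velc theta delta (X s) (Y s)) t.
Proof.
  intros HX HY. apply continuous_eps. intros eps Heps.
  set (L := 60 * (1 + Rabs theta)). assert (HL : 0 < L) by (unfold L; pose proof (Rabs_pos theta); lra).
  destruct (eps_continuous X t HX (eps / (4 * L))) as [d1 [Hd1 H1]]; [apply Rdiv_lt_0_compat; lra|].
  destruct (eps_continuous Y t HY (eps / (4 * L))) as [d2 [Hd2 H2]]; [apply Rdiv_lt_0_compat; lra|].
  exists (Rmin d1 d2). split; [now apply Rmin_pos|]. intros s Hsd.
  specialize (H1 s (Rlt_le_trans _ _ _ Hsd (Rmin_l _ _))).
  specialize (H2 s (Rlt_le_trans _ _ _ Hsd (Rmin_r _ _))).
  apply Rle_lt_trans with (1 := velc_lipschitz Hs _ _ _ _). fold L.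
  apply Rle_lt_trans with (L * (eps / (4 * L) + eps / (4 * L))); [apply Rmult_le_compat_l; lra|].
  replace (L * (eps / (4 * L) + eps / (4 * L))) with (eps / 2) by (field; lra). lra.
Qed.

Lemma derive_bound_exp (f df : R -> R) (K D t : R) :
  0 < K -> 0 <= D -> 0 <= t -> f 0 = 0 -> (forall s, 0 <= s -> is_derive f s (df s)) ->
  (forall s, 0 <= s -> Rabs (df s) <= D * exp (K * s)) -> Rabs (f t) <= D / K * exp (K * t).
Proof.
  intros HK HD Ht H0 Hd Hb.
  assert (A : Rabs (f t - f 0) <= D / K * exp (K * t) - D / K * exp (K * 0)).
  { apply (derive_bound f df (fun s => D / K * exp (K * s)) (fun s => D * exp (K * s))); [easy| | |].
    - intros s Hs. apply Hd. lra.
    - intros s Hs. auto_derive; [easy|field; lra].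
    - intros s Hs. apply Hb. lra. }
  rewrite H0, Rminus_0_r, Rmult_0_r, exp_0 in A.
  assert (0 <= D / K) by (apply Rdiv_le_0_compat; lra). lra.
Qed.

(** Distances are weighted by [exp (- K * t)], which makes the Picard operator contract on the whole
    half-line at once. Integration gains a factor [1 / K], and [K] is twice [1 + L], with [L] the
    Lipschitz constant of [velc], so that [D / K + L * D / K = D / 2]. *)
Lemma clamped_contraction {theta delta : R} (Hs : small theta delta) (x0 y0 D : R)
    (X Y X' Y' : R -> R) (K := 2 * (1 + 60 * (1 + Rabs theta))) :
  0 <= D ->
  (forall t, continuous X t) -> (forall t, continuous Y t) ->
  (forall t, continuous X' t) -> (forall t, continuous Y' t) ->
  (forall t, 0 <= t -> Rabs (X t - X' t) + Rabs (Y t - Y' t) <= D * exp (K * t)) ->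
  forall t, 0 <= t ->
    Rabs ((x0 + RInt Y 0 t) - (x0 + RInt Y' 0 t)) +
    Rabs ((y0 + RInt (fun s => velc theta delta (X s) (Y s)) 0 t) -
          (y0 + RInt (fun s => velc theta delta (X' s) (Y' s)) 0 t)) <= D / 2 * exp (K * t).
Proof.
  intros HD CX CY CX' CY' H t Ht. set (L := 60 * (1 + Rabs theta)) in *.
  assert (HL : 0 < L) by (unfold L; pose proof (Rabs_pos theta); lra).
  assert (HK : 0 < K) by (unfold K; lra).
  assert (R0 : forall f : R -> R, RInt f 0 0 = 0)
    by (intros f; exact (RInt_point (V := R_CompleteNormedModule) 0 f)).
  assert (A : Rabs ((x0 + RInt Y 0 t) - (x0 + RInt Y' 0 t)) <= D / K * exp (K * t)).
  { apply (derive_bound_exp (fun t => (x0 + RInt Y 0 t) - (x0 + RInt Y' 0 t))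
      (fun s => Y s - Y' s)); try easy.
    - rewrite !R0. ring.
    - intros s Hs0. apply (is_derive_minus (fun t => x0 + RInt Y 0 t));
        now apply is_derive_primitive.
    - intros s Hs0. specialize (H s Hs0). pose proof (Rabs_pos (X s - X' s)). lra. }
  assert (B : Rabs ((y0 + RInt (fun s => velc theta delta (X s) (Y s)) 0 t) -
          (y0 + RInt (fun s => velc theta delta (X' s) (Y' s)) 0 t)) <= L * D / K * exp (K * t)).
  { apply (derive_bound_exp (fun t => (y0 + RInt (fun s => velc theta delta (X s) (Y s)) 0 t) -
          (y0 + RInt (fun s => velc theta delta (X' s) (Y' s)) 0 t))
      (fun s => velc theta delta (X s) (Y s) - velc theta delta (X' s) (Y' s))); try easy.
    - apply Rmult_le_pos; lra.
    - rewrite !R0. ring.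
    - intros s Hs0.
      apply (is_derive_minus (fun t => y0 + RInt (fun s => velc theta delta (X s) (Y s)) 0 t)).
      + apply (is_derive_primitive (fun s => velc theta delta (X s) (Y s))).
        intros r. now apply continuous_velc.
      + apply (is_derive_primitive (fun s => velc theta delta (X' s) (Y' s))).
        intros r. now apply continuous_velc.
    - intros s Hs0. apply Rle_trans with (1 := velc_lipschitz Hs _ _ _ _). fold L.
      rewrite Rmult_assoc. apply Rmult_le_compat_l; [lra|auto]. }
  replace (D / 2 * exp (K * t)) with (D / K * exp (K * t) + L * D / K * exp (K * t)); [lra|].
  unfold K. field. lra.
Qed.

Lemma clamped_solution {theta delta : R} (Hs : small theta delta) (x0 y0 : R) :
  exists X Y : R -> R, X 0 = x0 /\ Y 0 = y0 /\
    forall t, 0 <= t -> is_derive X t (Y t) /\ is_derive Y t (velc theta delta (X t) (Y t)).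
Proof.
  set (K := 2 * (1 + 60 * (1 + Rabs theta))).
  assert (HK : 1 <= K) by (unfold K; pose proof (Rabs_pos theta); lra).
  set (PX := fun (Y : R -> R) t => x0 + RInt Y 0 t).
  set (PY := fun (X Y : R -> R) t => y0 + RInt (fun s => velc theta delta (X s) (Y s)) 0 t).
  (* [Rmax 0 t] freezes the iterates for negative times, so that continuity and the estimates hold
     for all real [t] although the weight serves only [t >= 0]. *)
  set (u := fix u n : (R -> R) * (R -> R) := match n with
    | O => (fun _ => x0, fun _ => y0)
    | S n => (fun t => PX (snd (u n)) (Rmax 0 t), fun t => PY (fst (u n)) (snd (u n)) (Rmax 0 t))
    end).
  assert (Cm : forall t, continuous (Rmax 0) t).
  { apply (continuous_lipschitz _ 1). intros a b. rewrite Rmult_1_l.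
    unfold Rmax. repeat destruct Rle_dec; unfold Rabs; repeat destruct Rcase_abs; lra. }
  assert (DX : forall Y t, (forall s, continuous Y s) -> is_derive (PX Y) t (Y t)).
  { intros Y t HY. now apply is_derive_primitive. }
  assert (DY : forall X Y t, (forall s, continuous X s) -> (forall s, continuous Y s) ->
    is_derive (PY X Y) t (velc theta delta (X t) (Y t))).
  { intros X Y t HX HY. apply (is_derive_primitive (fun s => velc theta delta (X s) (Y s))).
    intros s. now apply continuous_velc. }
  assert (Cu : forall n, (forall t, continuous (fst (u n)) t) /\ (forall t, continuous (snd (u n)) t)).
  { induction n as [|n [IH1 IH2]]; [split; intros t; apply continuous_const|].
    split; intros t.
    - apply (continuous_comp (Rmax 0) (PX (snd (u n)))); [apply Cm|].
      apply (ex_derive_continuous (PX (snd (u n)))). eexists. now apply DX.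
    - apply (continuous_comp (Rmax 0) (PY (fst (u n)) (snd (u n)))); [apply Cm|].
      apply (ex_derive_continuous (PY (fst (u n)) (snd (u n)))). eexists. now apply DY. }
  assert (H2 : forall n, 0 < 2 ^ n) by (intros n; apply pow_lt; lra).
  assert (Hpos : forall n t, 0 <= t -> fst (u (S n)) t = PX (snd (u n)) t /\
    snd (u (S n)) t = PY (fst (u n)) (snd (u n)) t).
  { intros n t Ht. simpl. now rewrite Rmax_right. }
  set (M := Rabs y0 + Rabs (velc theta delta x0 y0)).
  assert (HM : 0 <= M).
  { unfold M. pose proof (Rabs_pos y0). pose proof (Rabs_pos (velc theta delta x0 y0)). lra. }
  assert (HMn : forall n, 0 <= M / 2 ^ n) by (intros n; apply Rdiv_le_0_compat; auto).
  assert (Hstep : forall n t, 0 <= t ->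
    Rabs (fst (u (S n)) t - fst (u n) t) + Rabs (snd (u (S n)) t - snd (u n) t) <=
    M / 2 ^ n * exp (K * t)).
  { induction n as [|n IH]; intros t Ht.
    - destruct (Hpos O t Ht) as [-> ->]. unfold PX, PY; simpl fst; simpl snd.
      replace (x0 + RInt (fun _ => y0) 0 t - x0) with (y0 * t).
      2:{ rewrite (RInt_const (V := R_CompleteNormedModule) 0 t y0).
          unfold scal; simpl; unfold mult; simpl. ring. }
      replace (y0 + RInt (fun _ => velc theta delta x0 y0) 0 t - y0) with (velc theta delta x0 y0 * t).
      2:{ rewrite (RInt_const (V := R_CompleteNormedModule) 0 t (velc theta delta x0 y0)).
          unfold scal; simpl; unfold mult; simpl. ring. }
      rewrite !Rabs_mult, (Rabs_pos_eq t) by easy.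
      pose proof (exp_ineq1_le (K * t)). simpl. rewrite Rdiv_1_r.
      replace (Rabs y0 * t + Rabs (velc theta delta x0 y0) * t) with (M * t) by (unfold M; ring).
      apply Rmult_le_compat_l; [easy|]. nra.
    - destruct (Hpos (S n) t Ht) as [-> ->]. destruct (Hpos n t Ht) as [-> ->].
      replace (M / 2 ^ S n) with (M / 2 ^ n / 2) by (simpl; field; specialize (H2 n); lra).
      apply (clamped_contraction Hs x0 y0 (M / 2 ^ n) (fst (u (S n))) (snd (u (S n)))
        (fst (u n)) (snd (u n)) (HMn n) (proj1 (Cu (S n))) (proj2 (Cu (S n)))
        (proj1 (Cu n)) (proj2 (Cu n)) IH t Ht). }
  assert (Hstep' : forall n t,
    Rabs (fst (u (S n)) t - fst (u n) t) + Rabs (snd (u (S n)) t - snd (u n) t) <=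
    M * exp (K * Rmax 0 t) / 2 ^ n).
  { intros n t. specialize (Hstep n (Rmax 0 t) (Rmax_l 0 t)).
    replace (M * exp (K * Rmax 0 t) / 2 ^ n) with (M / 2 ^ n * exp (K * Rmax 0 t))
      by (field; specialize (H2 n); lra).
    assert (E : forall n, fst (u n) t = fst (u n) (Rmax 0 t) /\ snd (u n) t = snd (u n) (Rmax 0 t)).
    { intros [|m]; [easy|]. simpl. rewrite (Rmax_right 0 (Rmax 0 t)) by apply Rmax_l. easy. }
    destruct (E (S n)) as [-> ->]. destruct (E n) as [-> ->]. exact Hstep. }
  destruct (geometric_limit_fun (fun n => fst (u n)) (fun t => M * exp (K * Rmax 0 t))) as [X HX].
  { intros n t. specialize (Hstep' n t). pose proof (Rabs_pos (snd (u (S n)) t - snd (u n) t)). lra. }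
  destruct (geometric_limit_fun (fun n => snd (u n)) (fun t => M * exp (K * Rmax 0 t))) as [Y HY].
  { intros n t. specialize (Hstep' n t). pose proof (Rabs_pos (fst (u (S n)) t - fst (u n) t)). lra. }
  assert (Cw : forall t, continuous (fun t => 2 * (M * exp (K * Rmax 0 t))) t).
  { intros t. apply (continuous_comp (Rmax 0) (fun r => 2 * (M * exp (K * r)))); [apply Cm|].
    apply (ex_derive_continuous (fun r => 2 * (M * exp (K * r)))). auto_derive. easy. }
  assert (CX : forall t, continuous X t).
  { apply (continuous_geometric_limit (fun n => fst (u n)) X (fun t => 2 * (M * exp (K * Rmax 0 t)))
      (fun n => proj1 (Cu n)) Cw HX). }
  assert (CY : forall t, continuous Y t).
  { apply (continuous_geometric_limit (fun n => snd (u n)) Y (fun t => 2 * (M * exp (K * Rmax 0 t)))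
      (fun n => proj2 (Cu n)) Cw HY). }
  assert (Hfix : forall t, 0 <= t -> PX Y t = X t /\ PY X Y t = Y t).
  { intros t Ht.
    assert (B : forall n, Rabs (PX Y t - X t) + Rabs (PY X Y t - Y t) <= 4 * (M * exp (K * t)) / 2 ^ n).
    { intros n.
      assert (A : Rabs (PX Y t - PX (snd (u n)) t) + Rabs (PY X Y t - PY (fst (u n)) (snd (u n)) t)
        <= (4 * M / 2 ^ n) / 2 * exp (K * t)).
      { apply (clamped_contraction Hs x0 y0 (4 * M / 2 ^ n) X Y (fst (u n)) (snd (u n))); try easy.
        - apply Rdiv_le_0_compat; [lra|auto].
        - exact (proj1 (Cu n)).
        - exact (proj2 (Cu n)).
        - intros s Hs0. pose proof (HX n s) as A1. pose proof (HY n s) as A2.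
          rewrite Rmax_right in A1, A2 by easy.
          fold K. replace (4 * M / 2 ^ n * exp (K * s)) with
            (2 * (M * exp (K * s)) / 2 ^ n + 2 * (M * exp (K * s)) / 2 ^ n)
            by (field; specialize (H2 n); lra).
          lra. }
      destruct (Hpos n t Ht) as [E1 E2]. rewrite <- E1, <- E2 in A.
      pose proof (HX (S n) t) as A1. pose proof (HY (S n) t) as A2.
      rewrite Rmax_right in A1, A2 by easy.
      replace (2 * (M * exp (K * t)) / 2 ^ S n) with (M * exp (K * t) / 2 ^ n) in A1, A2
        by (simpl; field; specialize (H2 n); lra).
      replace (4 * M / 2 ^ n / 2 * exp (K * t)) with (2 * (M * exp (K * t) / 2 ^ n)) in A
        by (field; specialize (H2 n); lra).
      replace (4 * (M * exp (K * t)) / 2 ^ n) with (4 * (M * exp (K * t) / 2 ^ n))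
        by (field; specialize (H2 n); lra).
      replace (PX Y t - X t) with ((PX Y t - fst (u (S n)) t) + - (X t - fst (u (S n)) t)) by ring.
      replace (PY X Y t - Y t) with ((PY X Y t - snd (u (S n)) t) + - (Y t - snd (u (S n)) t)) by ring.
      pose proof (Rabs_triang (PX Y t - fst (u (S n)) t) (- (X t - fst (u (S n)) t))).
      pose proof (Rabs_triang (PY X Y t - snd (u (S n)) t) (- (Y t - snd (u (S n)) t))).
      rewrite Rabs_Ropp in *. lra. }
    split; apply Rminus_diag_uniq, (le_geometric_0 _ (4 * (M * exp (K * t)))); intros n;
      specialize (B n); pose proof (Rabs_pos (PX Y t - X t)); pose proof (Rabs_pos (PY X Y t - Y t)); lra. }
  (* As for the leaves, the Picard images rather than the limits are taken, since they have a
     two-sided derivative at 0. *)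
  exists (PX Y), (PY X Y). split; [|split].
  - unfold PX. rewrite (RInt_point (V := R_CompleteNormedModule) 0). unfold zero; simpl. ring.
  - unfold PY. rewrite (RInt_point (V := R_CompleteNormedModule) 0). unfold zero; simpl. ring.
  - intros t Ht. destruct (Hfix t Ht) as [E1 E2]. rewrite E1, E2. split; [now apply DX|now apply DY].
Qed.

(** A bootstrap: up to the supremum [m] of the times reached with the strict bound, the weak bound
    holds by continuity, hence the strict one by hypothesis, and continuity carries it beyond
    [m]. *)
Lemma continuous_induction (f : R -> R) (M T : R) :
  (forall t, 0 <= t <= T -> continuity_pt f t) -> f 0 < M ->
  (forall t, 0 <= t <= T -> (forall s, 0 <= s <= t -> f s <= M) -> f t < M) ->
  forall t, 0 <= t <= T -> f t < M.
Proof.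
  intros Hc H0 Hi t Ht. apply NNPP. intros Hn.
  set (E := fun s => 0 <= s <= t /\ forall r, 0 <= r <= s -> f r < M).
  assert (E0 : E 0).
  { split; [lra|]. intros r Hr. replace r with 0 by lra. exact H0. }
  destruct (completeness E) as [m [Hub Hlub]].
  { exists t. intros s Hs. apply Hs. }
  { now exists 0. }
  assert (Hm0 : 0 <= m) by now apply Hub.
  assert (Hmt : m <= t) by (apply Hlub; intros s Hs; apply Hs).
  assert (Hbelow : forall r, 0 <= r < m -> f r < M).
  { intros r Hr. apply NNPP. intros Hr'. apply (Rlt_not_le m r); [lra|].
    apply Hlub. intros s [Hs Hs']. destruct (Rle_or_lt s r); [easy|].
    exfalso. apply Hr', Hs'. lra. }
  assert (Hcm : forall eps, 0 < eps -> exists d, 0 < d /\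
    forall s, Rabs (s - m) < d -> Rabs (f s - f m) < eps).
  { apply eps_continuous. apply continuity_pt_filterlim, Hc. lra. }
  assert (Hfm : f m < M).
  { apply Hi; [lra|]. intros s Hs. destruct (Rlt_or_le s m) as [Hlt|Hge].
    - apply Rlt_le, Hbelow. lra.
    - replace s with m by lra. apply Rnot_lt_le. intros Hgt.
      destruct (Hcm (f m - M)) as [d [Hd Hf]]; [lra|].
      assert (Hm' : 0 < m).
      { destruct (Req_dec m 0) as [Hz|]; [|lra]. rewrite Hz in Hgt. lra. }
      set (r := Rmax 0 (m - d / 2)).
      assert (Hr : 0 <= r < m /\ m - d / 2 <= r).
      { unfold r. split; [split; [apply Rmax_l|apply Rmax_lub_lt; lra]|apply Rmax_r]. }
      specialize (Hbelow r (proj1 Hr)).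
      specialize (Hf r). rewrite (Rabs_minus_sym r), Rabs_pos_eq in Hf by lra.
      specialize (Hf ltac:(lra)). apply Rabs_lt_between in Hf. lra. }
  destruct (Hcm (M - f m)) as [d [Hd Hf]]; [lra|].
  assert (Hmt' : m < t).
  { destruct (Req_dec m t) as [Hz|]; [|lra]. exfalso. apply Hn. now rewrite <- Hz. }
  set (s := Rmin t (m + d / 2)).
  assert (Hs : m < s /\ s <= t /\ s <= m + d / 2).
  { unfold s. split; [apply Rmin_glb_lt; lra|]. split; [apply Rmin_l|apply Rmin_r]. }
  assert (HE : E s).
  { split; [lra|]. intros r Hr. destruct (Rlt_or_le r m); [apply Hbelow; lra|].
    assert (Hrd : Rabs (r - m) < d) by (rewrite Rabs_pos_eq; lra).
    specialize (Hf r Hrd). apply Rabs_lt_between in Hf. lra. }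
  specialize (Hub s HE). lra.
Qed.

(** * The flow in the leaf chart *)

Definition in_box (delta : R) (z : R * R) : Prop :=
  1 / 2 <= fst z <= 3 / 2 /\ -delta <= snd z <= delta.

(** A first integral of the flow in the box: the label of the leaf through [z], that is, the value
    of [Gam] at which this leaf meets the x-axis. *)
Definition chart (theta delta : R) (z : R * R) : R :=
  leaf_label theta delta (Gam (fst z)) (snd z).

Lemma vel_nonpos {theta delta : R} (Hs : small theta delta) (z : R * R) :
  in_box delta z -> vel theta (fst z) (snd z) <= 0.
Proof.
  intros [Hx Hy]. rewrite <- (velc_id theta delta) by easy. now apply velc_nonpos.
Qed.

Lemma vel_slope {theta delta : R} (Hs : small theta delta) (x y : R) :
  1 / 2 <= x <= 3 / 2 -> -delta <= y <= delta ->
  vel theta x y * slope theta y (Gam x) = x * (x ^ 2 - 1) ^ 2 * y.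
Proof.
  intros Hx Hy. unfold slope, vel. rewrite xi_Gam by easy.
  pose proof (small_mult Hs y Hy). field. lra.
Qed.

(** The contraction is run in the time of the solution, with [Y] its ordinate, which is monotone
    although its derivative vanishes on [x = 1]. The maximum [d] of the deviation then satisfies
    [d <= d / 2], the deviation being 0 at [t0]. *)
Lemma flow_preserves_leaf {theta delta : R} (Hs : small theta delta) (p : R -> R)
    (g : R -> R * R) (a b t0 : R) :
  is_leaf theta delta p -> a <= t0 <= b ->
  solution_on (cusp_system theta) (fun t => a <= t <= b) g ->
  (forall t, a <= t <= b -> in_box delta (g t)) ->
  Gam (fst (g t0)) = p (snd (g t0)) ->
  forall t, a <= t <= b -> Gam (fst (g t)) = p (snd (g t)).
Proof.
  intros Hp Ht0 Hg Hbox H0. rewrite cusp_solution_iff in Hg.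
  set (X := fun t => fst (g t)). set (Y := fun t => snd (g t)).
  assert (HX : forall t, a <= t <= b -> is_derive X t (Y t)) by (intros t Ht; now apply Hg).
  assert (HY : forall t, a <= t <= b -> is_derive Y t (vel theta (X t) (Y t)))
    by (intros t Ht; now apply Hg).
  set (c := fun t => Gam (X t)). set (E := fun t => c t - p (Y t)).
  assert (Hc : forall t, a <= t <= b ->
    is_derive c t (vel theta (X t) (Y t) * slope theta (Y t) (c t))).
  { intros t Ht. destruct (Hbox t Ht) as [B1 B2]. unfold c.
    rewrite (vel_slope Hs) by easy.
    replace (X t * (X t ^ 2 - 1) ^ 2 * Y t) with (Y t * (X t * (X t ^ 2 - 1) ^ 2)) by ring.
    apply (is_derive_comp Gam X); [|now apply HX].
    unfold Gam. auto_derive; [easy|field]. }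
  assert (HE : forall t, a <= t <= b -> is_derive E t
    (vel theta (X t) (Y t) * (slope theta (Y t) (c t) - slope theta (Y t) (p (Y t))))).
  { intros t Ht. rewrite Rmult_minus_distr_l.
    apply (is_derive_minus c (fun t => p (Y t))); [now apply Hc|].
    apply (is_derive_comp p Y); [apply Hp; now apply Hbox|now apply HY]. }
  destruct (abs_max E a b) as [tm [Htm Hmax]]; [lra| |].
  { intros t Ht. apply (derive_continuity_pt _ _ _ (HE t Ht)). }
  set (d := Rabs (E tm)) in *.
  assert (Hm : forall s t, a <= s -> s <= t -> t <= b -> Rabs (E t - E s) <= d / 2).
  { intros s t Has Hst Htb.
    apply (slope_contraction Hs Y (fun t => vel theta (X t) (Y t)) c c c (fun t => p (Y t)) E);
      try easy; try (intros r Hr; (apply Hbox || apply HY || apply Hc || apply HE); lra).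
    - apply Rabs_pos.
    - intros r Hr. rewrite Rminus_diag, Rabs_R0. apply Rabs_pos.
    - intros r Hr. rewrite Rabs_minus_sym. apply Hmax. lra.
    - right. intros r Hr. apply (vel_nonpos Hs), Hbox. lra. }
  assert (E0 : E t0 = 0) by (unfold E, c, X, Y; rewrite H0; ring).
  assert (Hd : d <= d / 2).
  { unfold d at 1. destruct (Rle_or_lt t0 tm).
    - specialize (Hm t0 tm). rewrite E0, Rminus_0_r in Hm. apply Hm; lra.
    - specialize (Hm tm t0). rewrite E0, Rabs_minus_sym, Rminus_0_r in Hm. apply Hm; lra. }
  intros t Ht. specialize (Hmax t Ht). pose proof (Rabs_pos (E t)).
  assert (Et : E t = 0).
  { destruct (Req_dec (E t) 0) as [|Hn]; [easy|]. apply Rabs_pos_lt in Hn. lra. }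
  unfold E, c, X, Y in Et. lra.
Qed.

Lemma chart_constant {theta delta : R} (Hs : small theta delta)
    (g : R -> R * R) (a b s t : R) :
  solution_on (cusp_system theta) (fun t => a <= t <= b) g ->
  (forall t, a <= t <= b -> in_box delta (g t)) ->
  a <= s <= b -> a <= t <= b -> chart theta delta (g t) = chart theta delta (g s).
Proof.
  intros Hg Hbox Hsd Ht. destruct (Hbox s Hsd) as [_ Hy].
  destruct (leaf_label_is_leaf Hs (Gam (fst (g s))) (snd (g s)) Hy) as [p [P1 [P2 P3]]].
  unfold chart at 2. rewrite <- P2. apply (leaf_label_unique Hs); [easy|now apply Hbox|].
  symmetry. now apply (flow_preserves_leaf Hs p g a b s).
Qed.

Lemma ordinate_nonincreasing {theta delta : R} (Hs : small theta delta)
    (g : R -> R * R) (a b s t : R) :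
  solution_on (cusp_system theta) (fun t => a <= t <= b) g ->
  (forall t, a <= t <= b -> in_box delta (g t)) ->
  a <= s -> s <= t -> t <= b -> snd (g t) <= snd (g s).
Proof.
  intros Hg Hbox H1 H2 H3. rewrite cusp_solution_iff in Hg.
  enough (- snd (g s) <= - snd (g t)) by lra.
  apply (derive_nondecreasing (fun t => - snd (g t)) (fun t => - vel theta (fst (g t)) (snd (g t))));
    [easy| |].
  - intros r Hr. apply (is_derive_opp (fun t => snd (g t))), Hg. lra.
  - intros r Hr. pose proof (vel_nonpos Hs (g r) (Hbox r ltac:(lra))). lra.
Qed.

Lemma chart_bound {theta delta : R} (Hs : small theta delta) (z : R * R) (r : R) :
  r <= delta -> -r <= snd z <= r ->
  Rabs (Gam (fst z) - chart theta delta z) <= 2 * r * Rabs (snd z).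
Proof.
  intros Hr Hy. rewrite <- (leaf_from_label Hs (Gam (fst z)) (snd z)) by lra.
  now apply leaf_from_bound.
Qed.

Lemma chart_injective {theta delta : R} (Hs : small theta delta) (z w : R * R) :
  in_box delta z -> in_box delta w -> chart theta delta z = chart theta delta w ->
  snd z = snd w -> z = w.
Proof.
  intros [Hzx Hzy] [Hwx Hwy] Hc Hy. unfold chart in Hc.
  assert (HG : Gam (fst z) = Gam (fst w)).
  { rewrite <- (leaf_from_label Hs (Gam (fst z)) (snd z)), Hc, Hy by easy.
    now apply leaf_from_label. }
  rewrite (surjective_pairing z), (surjective_pairing w). f_equal; [|easy].
  rewrite <- (xi_Gam (fst z)), <- (xi_Gam (fst w)) by easy. now f_equal.
Qed.

Lemma in_box_cusp {theta delta : R} (Hs : small theta delta) : in_box delta (1, 0).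
Proof. destruct Hs as [Hd _]. unfold in_box; simpl. lra. Qed.

Lemma chart_cusp {theta delta : R} (Hs : small theta delta) : chart theta delta (1, 0) = 0.
Proof.
  destruct (Hs) as [Hd _].
  pose proof (chart_bound Hs (1, 0) delta (Rle_refl _)) as H. simpl in H.
  rewrite Rabs_R0, Rmult_0_r in H. specialize (H ltac:(lra)).
  replace (Gam 1) with 0 in H by (unfold Gam; field).
  set (k := chart theta delta (1, 0)) in *.
  destruct (Req_dec (0 - k) 0) as [|Hn]; [lra|]. apply Rabs_pos_lt in Hn. lra.
Qed.

Lemma chart_zero_axis {theta delta : R} (Hs : small theta delta) (z : R * R) :
  in_box delta z -> chart theta delta z = 0 -> snd z = 0 -> z = (1, 0).
Proof.
  intros Hz Hc Hy. apply (chart_injective Hs); [easy|apply (in_box_cusp Hs)|now rewrite (chart_cusp Hs)|easy].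
Qed.

(** The label and the drift along the leaf give [|Gam x| <= 1/100 + 2 * delta ^ 2 <= 3/200], and
    [6 * 3/200 < (1/2) ^ 3]. The strict conclusion drives the bootstrap of [forward_flow]. *)
Lemma abscissa_close {theta delta : R} (Hs : small theta delta) (z : R * R) :
  1 / 2 <= fst z <= 3 / 2 -> -delta <= snd z <= delta -> Rabs (chart theta delta z) <= 1 / 100 ->
  Rabs (fst z - 1) < 1 / 2.
Proof.
  intros Hx Hy Hk. destruct (Hs) as [Hd _].
  pose proof (chart_bound Hs z delta (Rle_refl _) Hy) as H.
  assert (Hy' : Rabs (snd z) <= delta) by now apply Rabs_le.
  assert (HG : Rabs (Gam (fst z)) <= 3 / 200).
  { replace (Gam (fst z)) with ((Gam (fst z) - chart theta delta z) + chart theta delta z) by ring.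
    apply Rle_trans with (1 := Rabs_triang _ _). nra. }
  apply cube_lt_inv. pose proof (Gam_dist (fst z) ltac:(lra)). lra.
Qed.

(** A solution of the clamped system is a true one while it stays in the box. Its ordinate
    decreases, and its constant label keeps the abscissa strictly inside, so it can leave only
    through the bottom edge. *)
Lemma forward_flow {theta delta : R} (Hs : small theta delta) (z : R * R) :
  in_box delta z -> Rabs (chart theta delta z) <= 1 / 100 ->
  exists g, g 0 = z /\
    (forall t, 0 <= t -> continuity_pt (fun t => snd (g t)) t) /\
    (forall s t, 0 <= s -> s <= t -> snd (g t) <= snd (g s)) /\
    (forall T, 0 <= T -> -delta <= snd (g T) ->
       solution_on (cusp_system theta) (fun t => 0 <= t <= T) g /\
       forall t, 0 <= t <= T -> in_box delta (g t) /\ chart theta delta (g t) = chart theta delta z).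
Proof.
  intros Hz Hk. destruct (clamped_solution Hs (fst z) (snd z)) as [X [Y [HX0 [HY0 HXY]]]].
  set (g := fun t => (X t, Y t)). exists g.
  assert (Hmon : forall s t, 0 <= s -> s <= t -> Y t <= Y s).
  { intros s t H1 H2. enough (- Y s <= - Y t) by lra.
    apply (derive_nondecreasing (fun t => - Y t) (fun t => - velc theta delta (X t) (Y t))); [easy| |].
    - intros r Hr. apply (is_derive_opp Y), HXY. lra.
    - intros r Hr. pose proof (velc_nonpos Hs (X r) (Y r)). lra. }
  split; [unfold g; rewrite HX0, HY0; now rewrite <- surjective_pairing|].
  split; [intros t Ht; apply (derive_continuity_pt Y t _ (proj2 (HXY t Ht)))|].
  split; [exact Hmon|].
  intros T HT HyT.
  assert (Hy : forall t, 0 <= t <= T -> -delta <= Y t <= delta).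
  { intros t Ht. split.
    - apply Rle_trans with (1 := HyT). apply Hmon; lra.
    - apply Rle_trans with (Y 0); [apply Hmon; lra|]. rewrite HY0. apply Hz. }
  assert (Hloc : forall t, 0 <= t <= T -> (forall s, 0 <= s <= t -> 1 / 2 <= X s <= 3 / 2) ->
    solution_on (cusp_system theta) (fun s => 0 <= s <= t) g /\
    forall s, 0 <= s <= t -> in_box delta (g s) /\ chart theta delta (g s) = chart theta delta z).
  { intros t Ht Hx.
    assert (Hsol : solution_on (cusp_system theta) (fun s => 0 <= s <= t) g).
    { apply cusp_solution_iff. intros s Hst. simpl.
      rewrite <- (velc_id theta delta) by (apply Hx || apply Hy; lra). apply HXY. lra. }
    assert (Hbox : forall s, 0 <= s <= t -> in_box delta (g s)).
    { intros s Hst. split; [now apply Hx|apply Hy; lra]. }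
    split; [easy|]. intros s Hst. split; [now apply Hbox|].
    rewrite (chart_constant Hs g 0 t 0 s) by (easy || lra).
    unfold g. rewrite HX0, HY0. now rewrite <- surjective_pairing. }
  assert (Hx : forall t, 0 <= t <= T -> Rabs (X t - 1) < 1 / 2).
  { apply (continuous_induction (fun t => Rabs (X t - 1))).
    - intros t Ht. apply (continuity_pt_comp (fun t => X t - 1) Rabs); [|apply Rcontinuity_abs].
      apply continuity_pt_minus; [apply (derive_continuity_pt X t (Y t)), HXY; lra|].
      apply continuity_pt_const. intros u v; reflexivity.
    - rewrite HX0. now apply (abscissa_close Hs z); try apply Hz.
    - intros t Ht Hle.
      assert (Hle' : forall s, 0 <= s <= t -> 1 / 2 <= X s <= 3 / 2).
      { intros s Hst. specialize (Hle s Hst). apply Rabs_le_between in Hle. lra. }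
      destruct (Hloc t Ht Hle') as [_ Hb]. destruct (Hb t ltac:(lra)) as [[B1 B2] B3].
      apply (abscissa_close Hs (g t)); try easy. now rewrite B3. }
  apply Hloc; [lra|]. intros s Hst. specialize (Hx s Hst). apply Rabs_lt_between in Hx. lra.
Qed.

(** A solution kept in the box for ever cannot have [y] bounded away from 0 with either sign, as [x]
    would then move at a definite speed through a bounded range; and a nonzero label would produce a
    definite speed as well. *)
Lemma forward_confined {theta delta : R} (Hs : small theta delta) (g : R -> R * R) (k : R) :
  solution_on (cusp_system theta) (fun t => 0 <= t) g ->
  (forall t, 0 <= t -> in_box delta (g t) /\ chart theta delta (g t) = k) ->
  k = 0 /\ (forall t, 0 <= t -> 0 <= snd (g t)) /\
  forall a, 0 < a -> exists t, 0 <= t /\ snd (g t) < a.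
Proof.
  intros Hg Hb.
  assert (Hmon : forall s t, 0 <= s -> s <= t -> snd (g t) <= snd (g s)).
  { intros s t H1 H2. apply (ordinate_nonincreasing Hs g 0 t); try lra.
    - intros r Hr. apply Hg. lra.
    - intros r Hr. apply Hb. lra. }
  rewrite cusp_solution_iff in Hg.
  assert (Hpos : forall t, 0 <= t -> 0 <= snd (g t)).
  { intros t Ht. apply Rnot_lt_le. intros Hn. set (m := - snd (g t)).
    assert (Hm : 0 < m) by (unfold m; lra).
    set (T := t + 2 / m). assert (HT : 0 < 2 / m) by (apply Rdiv_lt_0_compat; lra).
    assert (A : - fst (g t) + m * (T - t) <= - fst (g T)).
    { apply (derive_growth (fun t => - fst (g t)) (fun t => - snd (g t))); [unfold T; lra| |].
      - intros s Hst. apply (is_derive_opp (fun t => fst (g t))), Hg. lra.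
      - intros s Hst. assert (snd (g s) <= snd (g t)) by (apply Hmon; lra). unfold m. lra. }
    replace (m * (T - t)) with 2 in A by (unfold T; field; lra).
    destruct (Hb t Ht) as [[B1 _] _]. destruct (Hb T ltac:(unfold T; lra)) as [[B2 _] _]. lra. }
  assert (Hsmall : forall a, 0 < a -> exists t, 0 <= t /\ snd (g t) < a).
  { intros a Ha. apply NNPP. intros Hn.
    assert (Hge : forall t, 0 <= t -> a <= snd (g t)).
    { intros t Ht. apply Rnot_lt_le. intros Hlt. apply Hn. now exists t. }
    assert (HT : 0 < 2 / a) by (apply Rdiv_lt_0_compat; lra).
    assert (A : fst (g 0) + a * (2 / a - 0) <= fst (g (2 / a))).
    { apply (derive_growth (fun t => fst (g t)) (fun t => snd (g t))); [lra| |].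
      - intros s Hst. apply Hg. lra.
      - intros s Hst. apply Hge. lra. }
    replace (a * (2 / a - 0)) with 2 in A by (field; lra).
    destruct (Hb 0 ltac:(lra)) as [[B1 _] _]. destruct (Hb (2 / a) ltac:(lra)) as [[B2 _] _]. lra. }
  split; [|easy].
  apply NNPP. intros Hk. apply Rabs_pos_lt in Hk. set (m := Rabs k) in *.
  assert (HT : 0 < 2 / m) by (apply Rdiv_lt_0_compat; lra).
  (* [x - y] grows at a rate bounded below: where [y] is small, [(x^2 - 1)^2] is not. *)
  assert (A : (fst (g 0) - snd (g 0)) + m * (2 / m - 0) <= fst (g (2 / m)) - snd (g (2 / m))).
  { apply (derive_growth (fun t => fst (g t) - snd (g t))
      (fun t => snd (g t) - vel theta (fst (g t)) (snd (g t)))); [lra| |].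
    - intros t Ht. apply (is_derive_minus (fun t => fst (g t)) (fun t => snd (g t))); apply Hg; lra.
    - intros t Ht. destruct (Hb t ltac:(lra)) as [[B1 B2] B3]. specialize (Hpos t ltac:(lra)).
      destruct (Hs) as [Hd _].
      pose proof (chart_bound Hs (g t) delta (Rle_refl _) B2) as C.
      rewrite (Rabs_pos_eq (snd (g t))), B3 in C by easy.
      pose proof (small_mult Hs _ B2) as Ht'.
      set (x := fst (g t)) in *. set (y := snd (g t)) in *.
      assert (D : m - Rabs (Gam x - k) <= Rabs (Gam x)).
      { unfold m. replace k with (Gam x + - (Gam x - k)) at 1 by ring.
        pose proof (Rabs_triang (Gam x) (- (Gam x - k))). rewrite Rabs_Ropp in *. lra. }
      assert (Hu : - (3 / 4) <= x ^ 2 - 1 <= 5 / 4) by (simpl; nra).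
      assert (F : 6 * Rabs (Gam x) <= 5 / 4 * (x ^ 2 - 1) ^ 2).
      { unfold Gam, Rdiv at 1. rewrite Rabs_mult, (Rabs_pos_eq (/ 6)) by lra.
        revert Hu. generalize (x ^ 2 - 1). intros u Hu.
        replace (u ^ 3) with (u * u ^ 2) by ring.
        rewrite Rabs_mult, (Rabs_pos_eq (u ^ 2)) by apply pow2_ge_0.
        assert (Rabs u <= 5 / 4) by (apply Rabs_le; lra). pose proof (pow2_ge_0 u). nra. }
      unfold vel. set (q := (x ^ 2 - 1) ^ 2) in *.
      assert (0 <= q) by apply pow2_ge_0.
      assert (q * (theta * y - x) <= - (49 / 100) * q) by nra.
      nra. }
  (* A gain of 2 is impossible: in the box [x - y] varies by at most [1 + 2 * delta]. *)
  replace (m * (2 / m - 0)) with 2 in A by (field; lra).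
  destruct (Hb 0 ltac:(lra)) as [[B1 B1'] _]. destruct (Hb (2 / m) ltac:(lra)) as [[B2 B2'] _].
  destruct Hs as [Hd _]. lra.
Qed.

(** If the solution from [z] never came down to the ordinate of [w], it would be confined to the
    box. Then its label is 0 and its ordinate stays nonnegative while becoming arbitrarily small,
    against each case of the last hypothesis. *)
Lemma leaf_reach {theta delta : R} (Hs : small theta delta) (z w : R * R) :
  in_box delta z -> in_box delta w -> Rabs (chart theta delta z) <= 1 / 100 ->
  chart theta delta z = chart theta delta w -> snd w <= snd z ->
  (chart theta delta z = 0 -> snd z = snd w \/ 0 < snd w \/ snd z < 0) ->
  exists g T, 0 <= T /\ solution_on (cusp_system theta) (fun t => 0 <= t <= T) g /\
    g 0 = z /\ g T = w /\
    forall t, 0 <= t <= T -> in_box delta (g t) /\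
      chart theta delta (g t) = chart theta delta z /\ snd w <= snd (g t) <= snd z.
Proof.
  intros Hz Hw Hk Hc Hy H0.
  destruct (forward_flow Hs z Hz Hk) as [g [G0 [G1 [G2 G3]]]].
  assert (HT : exists T, 0 <= T /\ snd (g T) = snd w).
  { apply NNPP. intros Hn.
    assert (Hgt : forall t, 0 <= t -> snd w < snd (g t)).
    { intros t Ht. apply Rnot_le_lt. intros Hle.
      destruct (ivt_decr (fun t => snd (g t)) 0 t (snd w) Ht) as [T [HT HT']].
      - intros s Hst. apply G1. lra.
      - cbv beta. rewrite G0. lra.
      - apply Hn. exists T. split; [lra|easy]. }
    assert (Hb : forall T, 0 <= T -> -delta <= snd (g T)).
    { intros T HT. specialize (Hgt T HT). destruct Hw as [_ Hw]. lra. }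
    destruct (forward_confined Hs g (chart theta delta z)) as [F1 [F2 F3]].
    - intros t Ht. destruct (G3 t Ht (Hb t Ht)) as [S _]. apply S. lra.
    - intros t Ht. destruct (G3 t Ht (Hb t Ht)) as [_ S]. apply S. lra.
    - destruct (H0 F1) as [E|[E|E]].
      + apply Hn. exists 0. rewrite G0. split; [lra|easy].
      + destruct (F3 _ E) as [t [Ht Ht']]. specialize (Hgt t Ht). lra.
      + specialize (F2 0 (Rle_refl _)). rewrite G0 in F2. lra. }
  destruct HT as [T [HT HTy]].
  destruct (G3 T HT) as [S1 S2]; [rewrite HTy; apply Hw|].
  exists g, T. split; [easy|]. split; [easy|]. split; [easy|]. split.
  - destruct (S2 T ltac:(lra)) as [B1 B2].
    apply (chart_injective Hs); [easy|easy|now rewrite B2|easy].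
  - intros t Ht. destruct (S2 t Ht) as [B1 B2]. split; [easy|]. split; [easy|].
    rewrite <- HTy, <- G0. split; apply G2; lra.
Qed.

Lemma cusp_equilibrium_const (theta : R) (g : R -> R * R) (a b t0 : R) :
  a <= t0 <= b -> solution_on (cusp_system theta) (fun t => a <= t <= b) g ->
  g t0 = (1, 0) -> forall t, a <= t <= b -> g t = (1, 0).
Proof.
  intros Ht0 Hg H0. apply (cusp_unique theta g (fun _ => (1, 0)) a b t0); try easy.
  apply cusp_solution_iff. intros t Ht. simpl. unfold vel.
  replace ((1 ^ 2 - 1) ^ 2 * (theta * 0 - 1)) with 0 by ring.
  split; apply is_derive_Reals, derivable_pt_lim_const.
Qed.

Lemma filterlim_pair_infty (g : R -> R * R) (x y : R) :
  (forall eps, 0 < eps -> exists T, forall t, T < t ->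
     Rabs (fst (g t) - x) < eps /\ Rabs (snd (g t) - y) < eps) ->
  filterlim g (Rbar_locally p_infty) (locally ((x, y) : R * R)).
Proof.
  intros H P [eps HP]. destruct (H eps (cond_pos eps)) as [T HT].
  exists T. intros t Ht. apply HP. destruct (HT t Ht). now split.
Qed.

Lemma separatrix_tends {theta delta : R} (Hs : small theta delta) (z : R * R) :
  in_box delta z -> chart theta delta z = 0 -> 0 < snd z ->
  exists g, solution_on (cusp_system theta) (fun t => 0 <= t) g /\ g 0 = z /\
    filterlim g (Rbar_locally p_infty) (locally ((1, 0) : R * R)) /\
    forall t, 0 <= t -> in_box delta (g t) /\ chart theta delta (g t) = 0 /\ 0 < snd (g t) <= snd z.
Proof.
  intros Hz Hk Hy. destruct (Hs) as [Hd _].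
  destruct (forward_flow Hs z Hz) as [g [G0 [G1 [G2 G3]]]]; [rewrite Hk, Rabs_R0; lra|].
  rewrite Hk in G3.
  assert (Hpos : forall t, 0 <= t -> 0 < snd (g t)).
  { intros t Ht. apply Rnot_le_lt. intros Hle.
    (* On the leaf with label 0 the ordinate 0 is attained only at the equilibrium, which no other
       solution reaches in finite time. *)
    destruct (ivt_decr (fun t => snd (g t)) 0 t 0 Ht) as [T [HT HT']].
    - intros s Hst. apply G1. lra.
    - cbv beta. rewrite G0. lra.
    - destruct (G3 T ltac:(lra)) as [S1 S2]; [rewrite HT'; lra|].
      destruct (S2 T ltac:(lra)) as [B1 B2].
      pose proof (cusp_equilibrium_const theta g 0 T T ltac:(lra) S1
        (chart_zero_axis Hs _ B1 B2 HT') 0 ltac:(lra)) as E.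
      rewrite G0 in E. rewrite E in Hy. simpl in Hy. lra. }
  assert (Hall : forall t, 0 <= t -> solution_on (cusp_system theta) (fun s => 0 <= s <= t) g /\
    forall s, 0 <= s <= t -> in_box delta (g s) /\ chart theta delta (g s) = 0).
  { intros t Ht. apply G3; [easy|]. specialize (Hpos t Ht). lra. }
  assert (Hsol : solution_on (cusp_system theta) (fun t => 0 <= t) g).
  { intros t Ht. destruct (Hall t Ht) as [S _]. apply S. lra. }
  assert (Hbox : forall t, 0 <= t -> in_box delta (g t) /\ chart theta delta (g t) = 0).
  { intros t Ht. destruct (Hall t Ht) as [_ S]. apply S. lra. }
  exists g. split; [easy|]. split; [easy|]. split.
  - apply filterlim_pair_infty. intros eps Heps.
    destruct (forward_confined Hs g 0 Hsol Hbox) as [_ [_ F]].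
    (* The cube is for the abscissa: on this leaf [|x - 1| ^ 3 <= 6 * |Gam x| <= 12 * delta * y],
       and [12 * delta < 1]. *)
    assert (He : 0 < Rmin eps (eps ^ 3)) by (apply Rmin_pos; [easy|now apply pow_lt]).
    destruct (F _ He) as [T [HT HTy]]. exists T. intros t Ht.
    assert (Hyt : 0 < snd (g t) < Rmin eps (eps ^ 3)).
    { split; [apply Hpos; lra|]. apply Rle_lt_trans with (2 := HTy). apply G2; lra. }
    pose proof (Rmin_l eps (eps ^ 3)). pose proof (Rmin_r eps (eps ^ 3)).
    destruct (Hbox t ltac:(lra)) as [[B1 B2] B3]. split.
    + apply cube_lt_inv. apply Rle_lt_trans with (1 := Gam_dist (fst (g t)) ltac:(lra)).
      pose proof (chart_bound Hs (g t) delta (Rle_refl _) B2) as C.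
      rewrite B3, Rminus_0_r, (Rabs_pos_eq (snd (g t))) in C by lra. nra.
    + rewrite Rminus_0_r, Rabs_pos_eq by lra. lra.
  - intros t Ht. destruct (Hbox t Ht). split; [easy|]. split; [easy|].
    split; [now apply Hpos|]. rewrite <- G0. apply G2; lra.
Qed.

(** * Symmetries and separatrices *)

Definition scale (a b : R) (z : R * R) : R * R := (a * fst z, b * snd z).

(** The diagonal linear map [scale a b] carries [F] to [F'] with time multiplied by [sigma]. One
    notion covers time shift, time reversal, the reflection in the x-axis and the rotation by a half
    turn. *)
Definition conjugate (a b sigma : R) (F F' : vector_field) : Prop :=
  forall z, F' (scale a b z) = (sigma * (a * fst (F z)), sigma * (b * snd (F z))).

Lemma solution_conjugate (a b sigma s : R) (F F' : vector_field) (I J : R -> Prop)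
    (g h : R -> R * R) :
  conjugate a b sigma F F' -> solution_on F I g -> (forall t, J t -> I (sigma * t + s)) ->
  (forall t, h t = scale a b (g (sigma * t + s))) -> solution_on F' J h.
Proof.
  intros HF Hg HJ Hh t Ht. specialize (Hg _ (HJ t Ht)).
  rewrite (surjective_pairing (F _)) in Hg. apply is_derive_pair in Hg. destruct Hg as [G1 G2].
  assert (Ha : is_derive (fun t => sigma * t + s) t sigma) by (auto_derive; [easy|ring]).
  rewrite Hh, HF. apply (is_derive_ext (fun t => scale a b (g (sigma * t + s)))); [now intros r|].
  apply is_derive_pair. unfold scale; simpl. split.
  - pose proof (is_derive_scal _ _ a _ (is_derive_comp _ _ t _ _ G1 Ha)) as D.
    replace (sigma * (a * fst (F (g (sigma * t + s))))) with
      (a * scal sigma (fst (F (g (sigma * t + s))))); [exact D|].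
    unfold scal; simpl; unfold mult; simpl. ring.
  - pose proof (is_derive_scal _ _ b _ (is_derive_comp _ _ t _ _ G2 Ha)) as D.
    replace (sigma * (b * snd (F (g (sigma * t + s))))) with
      (b * scal sigma (snd (F (g (sigma * t + s))))); [exact D|].
    unfold scal; simpl; unfold mult; simpl. ring.
Qed.

Lemma solution_subset (F : vector_field) (I J : R -> Prop) (g : R -> R * R) :
  solution_on F I g -> (forall t, J t -> I t) -> solution_on F J g.
Proof. intros Hg H t Ht. apply Hg, H, Ht. Qed.

Lemma scale_1 (z : R * R) : scale 1 1 z = z.
Proof. destruct z. unfold scale; simpl. now rewrite !Rmult_1_l. Qed.

Lemma solution_shift (F : vector_field) (I J : R -> Prop) (g : R -> R * R) (s : R) :
  solution_on F I g -> (forall t, J t -> I (t + s)) -> solution_on F J (fun t => g (t + s)).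
Proof.
  intros Hg H. apply (solution_conjugate 1 1 1 s F F I J g); try easy.
  - intros z. rewrite scale_1, !Rmult_1_l. apply surjective_pairing.
  - intros t Ht. rewrite Rmult_1_l. now apply H.
  - intros t. now rewrite scale_1, Rmult_1_l.
Qed.

Lemma reach_in_conjugate (a b : R) (F F' : vector_field) (D D' : R * R -> Prop) (z w : R * R) :
  conjugate a b 1 F F' -> (forall u, D u -> D' (scale a b u)) ->
  reach_in F D z w -> reach_in F' D' (scale a b z) (scale a b w).
Proof.
  intros HF HD [g [T [HT [Hg [Hd [H0 H1]]]]]].
  exists (fun t => scale a b (g t)), T. split; [easy|]. split; [|split; [|now rewrite H0, H1]].
  - apply (solution_conjugate a b 1 0 F F' _ _ g) with (2 := Hg); [easy| |].
    + intros t Ht. lra.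
    + intros t. do 2 f_equal. ring.
  - intros t Ht. now apply HD, Hd.
Qed.

Lemma reach_in_conjugate_reverse (a b : R) (F F' : vector_field) (D D' : R * R -> Prop)
    (z w : R * R) :
  conjugate a b (-1) F F' -> (forall u, D u -> D' (scale a b u)) ->
  reach_in F D z w -> reach_in F' D' (scale a b w) (scale a b z).
Proof.
  intros HF HD [g [T [HT [Hg [Hd [H0 H1]]]]]].
  exists (fun t => scale a b (g (- t + T))), T. split; [easy|]. split; [|split; [|split]].
  - apply (solution_conjugate a b (-1) T F F' _ _ g) with (2 := Hg); [easy| |].
    + intros t Ht. lra.
    + intros t. do 2 f_equal. ring.
  - intros t Ht. apply HD, Hd. lra.
  - now rewrite Ropp_0, Rplus_0_l, H1.
  - now rewrite Rplus_opp_l, H0.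
Qed.

Lemma reach_in_reverse (F : vector_field) (D : R * R -> Prop) (z w : R * R) :
  reach_in (reverse F) D z w <-> reach_in F D w z.
Proof.
  split; intros H.
  - apply (reach_in_conjugate_reverse 1 1 _ F D D) in H; [now rewrite !scale_1 in H| |].
    + intros u. rewrite scale_1. unfold reverse. simpl.
      rewrite (surjective_pairing (F u)) at 1. f_equal; ring.
    + intros u. now rewrite scale_1.
  - apply (reach_in_conjugate_reverse 1 1 _ (reverse F) D D) in H; [now rewrite !scale_1 in H| |].
    + intros u. rewrite scale_1. unfold reverse. f_equal; ring.
    + intros u. now rewrite scale_1.
Qed.

Definition mirror : R * R -> R * R := scale 1 (-1).

Lemma mirror_mirror (z : R * R) : mirror (mirror z) = z.
Proof. destruct z. unfold mirror, scale; simpl. f_equal; ring. Qed.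

Lemma cusp_conjugate_mirror (theta : R) :
  conjugate 1 (-1) (-1) (cusp_system theta) (cusp_system (- theta)).
Proof. intros [x y]. unfold cusp_system, scale; simpl. f_equal; ring. Qed.

Lemma reach_mirror (theta : R) (z w : R * R) :
  reach (cusp_system theta) z w <-> reach (cusp_system (- theta)) (mirror w) (mirror z).
Proof.
  split; intros H.
  - now apply (reach_in_conjugate_reverse 1 (-1) _ _ (fun _ => True) (fun _ => True) z w
      (cusp_conjugate_mirror theta)).
  - pose proof (cusp_conjugate_mirror (- theta)) as C. rewrite Ropp_involutive in C.
    apply (reach_in_conjugate_reverse 1 (-1) _ _ (fun _ => True) (fun _ => True) _ _ C) in H; [|easy].
    fold mirror in H. now rewrite !mirror_mirror in H.
Qed.

Lemma orbit_mirror (theta : R) (z w : R * R) :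
  orbit (cusp_system theta) z w <-> orbit (cusp_system (- theta)) (mirror z) (mirror w).
Proof.
  unfold orbit. rewrite (reach_mirror theta z w), (reach_mirror theta w z). tauto.
Qed.

Lemma tends_backward_mirror (theta : R) (z : R * R) :
  tends_backward (cusp_system theta) (1, 0) z <->
  tends_forward (cusp_system (- theta)) (1, 0) (mirror z).
Proof.
  assert (Hm : forall (g : R -> R * R) (F : (R -> Prop) -> Prop), filterlim g F (locally ((1, 0) : R * R)) ->
    filterlim (fun t => mirror (g t)) F (locally ((1, 0) : R * R))).
  { intros g F Hg P [eps HP]. apply (Hg (fun z => P (mirror z))).
    exists eps. intros y [Hy1 Hy2]. apply HP. split; simpl.
    - rewrite Rmult_1_l. exact Hy1.
    - unfold ball in *; simpl in *. unfold AbsRing_ball, abs, minus, plus, opp in *; simpl in *.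
      replace (-1 * snd y + - 0) with (- (snd y + - 0)) by ring. now rewrite Rabs_Ropp. }
  split; intros [g [Hg [H0 Hl]]].
  - exists (fun t => mirror (g (- t))). split; [|split].
    + apply (solution_conjugate 1 (-1) (-1) 0 _ _ _ _ g _ (cusp_conjugate_mirror theta) Hg).
      * intros t Ht. lra.
      * intros t. unfold mirror. do 2 f_equal. ring.
    + now rewrite Ropp_0, H0.
    + apply Hm. intros P HP. destruct (Hl P HP) as [M HM]. exists (- M).
      intros t Ht. apply HM. lra.
  - pose proof (cusp_conjugate_mirror (- theta)) as C. rewrite Ropp_involutive in C.
    exists (fun t => mirror (g (- t))). split; [|split].
    + apply (solution_conjugate 1 (-1) (-1) 0 _ _ _ _ g _ C Hg).
      * intros t Ht. lra.
      * intros t. unfold mirror. do 2 f_equal. ring.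
    + now rewrite Ropp_0, H0, mirror_mirror.
    + apply Hm. intros P HP. destruct (Hl P HP) as [M HM]. exists (- M).
      intros t Ht. apply HM. lra.
Qed.

Lemma is_derive_glue (f1 f2 : R -> R) (T t l : R) :
  f1 T = f2 T -> (t <= T -> is_derive f1 t l) -> (T <= t -> is_derive f2 t l) ->
  is_derive (fun t => if Rle_dec t T then f1 t else f2 t) t l.
Proof.
  intros HT H1 H2. destruct (Rtotal_order t T) as [Hlt|[->|Hgt]].
  - apply (is_derive_ext_loc f1); [|apply H1; lra].
    exists (mkposreal (T - t) ltac:(lra)). intros s Hs.
    change (Rabs (s - t) < T - t) in Hs. apply Rabs_lt_between in Hs.
    destruct Rle_dec; [easy|lra].
  - specialize (H1 (Rle_refl _)). specialize (H2 (Rle_refl _)).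
    apply is_derive_Reals in H1. apply is_derive_Reals in H2. apply is_derive_Reals.
    intros eps Heps. destruct (H1 eps Heps) as [d1 Hd1]. destruct (H2 eps Heps) as [d2 Hd2].
    exists (mkposreal _ (Rmin_stable_in_posreal d1 d2)). simpl. intros h Hh Hhd.
    pose proof (Rmin_l d1 d2). pose proof (Rmin_r d1 d2).
    destruct (Rle_dec T T) as [_|]; [|lra].
    destruct Rle_dec; [apply Hd1; lra|]. rewrite HT. apply Hd2; lra.
  - apply (is_derive_ext_loc f2); [|apply H2; lra].
    exists (mkposreal (t - T) ltac:(lra)). intros s Hs.
    change (Rabs (s - t) < t - T) in Hs. apply Rabs_lt_between in Hs.
    destruct Rle_dec; [lra|easy].
Qed.

(** The field is autonomous, so the two pieces have the same derivative where they meet and the join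
    is differentiable there. It prolongs a convergent solution backwards along its orbit. *)
Lemma solution_glue (F : vector_field) (g1 g2 : R -> R * R) (T : R) :
  solution_on F (fun t => 0 <= t <= T) g1 -> solution_on F (fun t => 0 <= t) g2 ->
  g1 T = g2 0 ->
  solution_on F (fun t => 0 <= t) (fun t => if Rle_dec t T then g1 t else g2 (t - T)).
Proof.
  intros H1 H2 H0.
  assert (H2' : solution_on F (fun t => T <= t) (fun t => g2 (t - T))).
  { apply (solution_shift F (fun t => 0 <= t)); [easy|]. intros t Ht. lra. }
  intros t Ht. set (l := F _).
  assert (D1 : t <= T -> is_derive g1 t l).
  { intros Hle. unfold l. destruct Rle_dec; [apply H1; lra|easy]. }
  assert (D2 : T <= t -> is_derive (fun t => g2 (t - T)) t l).
  { intros Hle. unfold l. destruct Rle_dec; [|now apply H2'].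
    replace t with T by lra. rewrite H0. replace 0 with (T - T) by ring. apply H2'. lra. }
  rewrite (surjective_pairing l) in D1, D2 |- *.
  apply is_derive_pair. split.
  - apply (is_derive_ext (fun t => if Rle_dec t T then fst (g1 t) else fst (g2 (t - T)))).
    { intros s. destruct (Rle_dec s T); reflexivity. }
    apply (is_derive_glue (fun t => fst (g1 t)) (fun t => fst (g2 (t - T)))).
    + now rewrite H0, Rminus_diag.
    + intros Hle. exact (proj1 (proj1 (is_derive_pair _ _ _ _) (D1 Hle))).
    + intros Hle. exact (proj1 (proj1 (is_derive_pair _ _ _ _) (D2 Hle))).
  - apply (is_derive_ext (fun t => if Rle_dec t T then snd (g1 t) else snd (g2 (t - T)))).
    { intros s. destruct (Rle_dec s T); reflexivity. }
    apply (is_derive_glue (fun t => snd (g1 t)) (fun t => snd (g2 (t - T)))).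
    + now rewrite H0, Rminus_diag.
    + intros Hle. exact (proj2 (proj1 (is_derive_pair _ _ _ _) (D1 Hle))).
    + intros Hle. exact (proj2 (proj1 (is_derive_pair _ _ _ _) (D2 Hle))).
Qed.

(** Backward uniqueness: of two solutions arriving at [c], the one with the shorter travel time is
    the end of the other. *)
Lemma reach_comparable (theta : R) (a b c : R * R) :
  reach (cusp_system theta) a c -> reach (cusp_system theta) b c ->
  reach (cusp_system theta) a b \/ reach (cusp_system theta) b a.
Proof.
  assert (W : forall a b g1 g2 T1 T2, 0 <= T1 -> T1 <= T2 ->
    solution_on (cusp_system theta) (fun t => 0 <= t <= T1) g1 ->
    solution_on (cusp_system theta) (fun t => 0 <= t <= T2) g2 ->
    g1 0 = a -> g2 0 = b -> g1 T1 = g2 T2 -> reach (cusp_system theta) b a).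
  { intros a' b' g1 g2 T1 T2 H1 H12 S1 S2 E1 E2 E. exists g2, (T2 - T1).
    split; [lra|]. split; [apply (solution_subset _ _ _ _ S2); intros; lra|].
    split; [easy|]. split; [easy|]. rewrite <- E1. symmetry.
    replace (T2 - T1) with (0 + (T2 - T1)) by ring.
    apply (cusp_unique theta g1 (fun t => g2 (t + (T2 - T1))) 0 T1 T1); [lra|easy| |..|lra].
    - apply (solution_shift _ _ _ _ _ S2). intros; lra.
    - rewrite E. f_equal. ring. }
  intros [g1 [T1 [H1 [S1 [_ [E1 F1]]]]]] [g2 [T2 [H2 [S2 [_ [E2 F2]]]]]].
  destruct (Rle_or_lt T1 T2).
  - right. apply (W a b g1 g2 T1 T2); try easy. now rewrite F1, F2.
  - left. apply (W b a g2 g1 T2 T1); try easy; [lra|now rewrite F1, F2].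
Qed.

Lemma Gam_small (x : R) : Rabs (x - 1) <= 1 / 2 -> Rabs (Gam x) <= 3 * Rabs (x - 1).
Proof.
  intros H. assert (H' := H). apply Rabs_le_between in H'.
  replace (Gam x) with ((x - 1) * ((x + 1) * (x ^ 2 - 1) ^ 2 / 6)) by (unfold Gam; field).
  rewrite Rabs_mult. rewrite Rmult_comm. apply Rmult_le_compat_r; [apply Rabs_pos|].
  assert (Hu : - (3 / 4) <= x ^ 2 - 1 <= 5 / 4) by (simpl; nra).
  assert (0 <= (x ^ 2 - 1) ^ 2 <= 2).
  { split; [apply pow2_ge_0|]. revert Hu. generalize (x ^ 2 - 1). intros u Hu. simpl. nra. }
  apply Rabs_le. unfold Rdiv. nra.
Qed.

(** Every solution converging to the cusp ends on the stable half of the leaf 0. The label is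
    constant near the cusp and tends to 0; the ordinate is nonincreasing with limit 0, hence
    nonnegative, and it vanishes only for the constant solution. *)
Lemma tends_forward_enters {theta delta : R} (Hs : small theta delta) (g : R -> R * R) :
  solution_on (cusp_system theta) (fun t => 0 <= t) g ->
  filterlim g (Rbar_locally p_infty) (locally ((1, 0) : R * R)) -> g 0 <> (1, 0) ->
  exists T, 0 <= T /\ in_box delta (g T) /\ chart theta delta (g T) = 0 /\ 0 < snd (g T).
Proof.
  intros Hg Hl H0. destruct (Hs) as [Hd _].
  assert (Hev : forall eps, 0 < eps -> exists T, forall t, T < t ->
    Rabs (fst (g t) - 1) < eps /\ Rabs (snd (g t)) < eps).
  { intros eps Heps. destruct (Hl (ball ((1, 0) : R * R) eps)) as [T HT].
    { exists (mkposreal eps Heps). now intros. }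
    exists T. intros t Ht. destruct (HT t Ht) as [B1 B2]. split; [exact B1|].
    rewrite <- (Rminus_0_r (snd (g t))). exact B2. }
  destruct (Hev delta ltac:(lra)) as [T1 HT1].
  set (T := Rmax 0 T1 + 1). pose proof (Rmax_l 0 T1). pose proof (Rmax_r 0 T1).
  assert (Hb : forall t, T <= t -> in_box delta (g t)).
  { intros t Ht. destruct (HT1 t ltac:(unfold T in Ht; lra)) as [B1 B2].
    apply Rabs_lt_between in B1. apply Rabs_lt_between in B2. unfold in_box. lra. }
  assert (HT : 0 <= T) by (unfold T; lra).
  assert (Hsol : forall t, solution_on (cusp_system theta) (fun s => T <= s <= t) g).
  { intros t s Hst. apply Hg. lra. }
  set (k := chart theta delta (g T)).
  assert (Hk : k = 0).
  { apply NNPP. intros Hn. apply Rabs_pos_lt in Hn.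
    (* At this distance [|Gam x| <= 3/4 * |k|], and the drift along the leaf adds less than
       [|k| / 8], which is too little for a label [k]. *)
    destruct (Hev (Rmin (1 / 2) (Rabs k / 4))) as [T2 HT2]; [apply Rmin_pos; lra|].
    set (t := Rmax T T2 + 1). pose proof (Rmax_l T T2). pose proof (Rmax_r T T2).
    assert (Ht : T <= t) by (unfold t; lra).
    destruct (HT2 t ltac:(unfold t; lra)) as [B1 B2].
    pose proof (Rmin_l (1 / 2) (Rabs k / 4)). pose proof (Rmin_r (1 / 2) (Rabs k / 4)).
    pose proof (chart_bound Hs (g t) delta (Rle_refl _) (proj2 (Hb t Ht))) as C.
    rewrite (chart_constant Hs g T t T t) in C by (easy || (intros; apply Hb; lra) || lra).
    fold k in C.
    pose proof (Gam_small (fst (g t)) ltac:(lra)) as D.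
    pose proof (Rabs_triang (Gam (fst (g t))) (- (Gam (fst (g t)) - k))) as E.
    rewrite Rabs_Ropp in E. replace (Gam (fst (g t)) + - (Gam (fst (g t)) - k)) with k in E by ring.
    assert (2 * delta * Rabs (snd (g t)) <= Rabs (snd (g t)) / 2)
      by (pose proof (Rabs_pos (snd (g t))); nra).
    lra. }
  exists T. split; [easy|]. split; [apply Hb; lra|]. split; [easy|].
  apply Rnot_le_lt. intros Hle.
  destruct (Req_dec (snd (g T)) 0) as [Hz|Hz].
  - apply H0. apply (cusp_equilibrium_const theta g 0 T T); [lra| | |lra].
    + intros s Hst. apply Hg. lra.
    + apply (chart_zero_axis Hs); [apply Hb; lra|easy|easy].
  - destruct (Hev (- snd (g T))) as [T2 HT2]; [lra|].
    set (t := Rmax T T2 + 1). pose proof (Rmax_l T T2). pose proof (Rmax_r T T2).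
    destruct (HT2 t ltac:(unfold t; lra)) as [_ B2]. apply Rabs_lt_between in B2.
    assert (snd (g t) <= snd (g T)); [|lra].
    apply (ordinate_nonincreasing Hs g T t); try easy; try (unfold t; lra).
    intros r Hr. apply Hb. lra.
Qed.

Lemma point_on_leaf {theta delta : R} (Hs : small theta delta) (k y : R) :
  Rabs k <= 1 / 100 -> -delta <= y <= delta ->
  in_box delta (xi (leaf_from theta delta k y), y) /\
  chart theta delta (xi (leaf_from theta delta k y), y) = k.
Proof.
  intros Hk Hy. split; [split; [apply xi_range|easy]|].
  unfold chart; simpl. rewrite Gam_xi; [now apply leaf_label_from|].
  pose proof (leaf_from_bound Hs k y delta (Rle_refl _) Hy) as B.
  assert (Hy' : Rabs y <= delta) by now apply Rabs_le. destruct (Hs) as [Hd _].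
  replace (leaf_from theta delta k y) with ((leaf_from theta delta k y - k) + k) by ring.
  apply Rle_trans with (1 := Rabs_triang _ _). nra.
Qed.

(** The point where the leaf 0 crosses the top of the strip; it represents the stable separatrix. *)
Definition entry (theta delta : R) : R * R := (xi (leaf_from theta delta 0 delta), delta).

Lemma entry_spec {theta delta : R} (Hs : small theta delta) :
  in_box delta (entry theta delta) /\ chart theta delta (entry theta delta) = 0.
Proof.
  destruct (Hs) as [Hd _]. apply (point_on_leaf Hs); [rewrite Rabs_R0; lra|lra].
Qed.

Lemma entry_reach {theta delta : R} (Hs : small theta delta) (z : R * R) :
  in_box delta z -> chart theta delta z = 0 -> 0 < snd z ->
  reach (cusp_system theta) (entry theta delta) z.
Proof.
  intros Hz Hk Hy. destruct (entry_spec Hs) as [E1 E2].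
  destruct (leaf_reach Hs (entry theta delta) z) as [g [T [H1 [H2 [H3 [H4 _]]]]]]; try easy.
  - rewrite E2, Rabs_R0. lra.
  - now rewrite E2.
  - apply Hz.
  - intros _. right; now left.
  - exists g, T. easy.
Qed.

Lemma entry_tends {theta delta : R} (Hs : small theta delta) :
  exists g, solution_on (cusp_system theta) (fun t => 0 <= t) g /\ g 0 = entry theta delta /\
    filterlim g (Rbar_locally p_infty) (locally ((1, 0) : R * R)).
Proof.
  destruct (entry_spec Hs) as [E1 E2]. destruct (Hs) as [Hd _].
  destruct (separatrix_tends Hs _ E1 E2) as [g [G1 [G2 [G3 _]]]]; [simpl; lra|].
  now exists g.
Qed.

(** A convergent solution meets the leaf 0 at a point also reached from [entry], so both starting
    points are comparable. Conversely, convergence is inherited by later points through a shift and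
    by earlier ones through gluing. *)
Lemma tends_forward_iff_orbit {theta delta : R} (Hs : small theta delta) (z : R * R) :
  z <> (1, 0) ->
  (tends_forward (cusp_system theta) (1, 0) z <-> orbit (cusp_system theta) (entry theta delta) z).
Proof.
  intros Hz. split.
  - intros [g [G1 [G2 G3]]].
    destruct (tends_forward_enters Hs g G1 G3) as [T [HT [B1 [B2 B3]]]]; [now rewrite G2|].
    apply (reach_comparable theta _ _ (g T)).
    + now apply entry_reach.
    + exists g, T. split; [easy|]. split; [|now rewrite G2].
      apply (solution_subset _ _ _ _ G1). intros; lra.
  - destruct (entry_tends Hs) as [g [G1 [G2 G3]]].
    intros [[h [T [HT [H1 [_ [H2 H3]]]]]]|[h [T [HT [H1 [_ [H2 H3]]]]]]].
    + exists (fun t => g (t + T)). split; [|split].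
      * apply (solution_shift _ _ _ _ _ G1). intros; lra.
      * rewrite <- H3, Rplus_0_l.
        apply (cusp_unique theta g h 0 T 0); try easy; try lra.
        -- apply (solution_subset _ _ _ _ G1). intros; lra.
        -- now rewrite G2, H2.
      * intros P HP. destruct (G3 P HP) as [M HM]. exists (M - T). intros t Ht. apply HM. lra.
    + exists (fun t => if Rle_dec t T then h t else g (t - T)). split; [|split].
      * apply solution_glue; try easy. now rewrite G2, H3.
      * destruct Rle_dec; [easy|lra].
      * intros P HP. destruct (G3 P HP) as [M HM]. exists (Rmax T (M + T)). intros t Ht.
        pose proof (Rmax_l T (M + T)). pose proof (Rmax_r T (M + T)).
        destruct Rle_dec; [lra|]. apply HM. lra.
Qed.

Lemma entry_orbit_avoids_cusp {theta delta : R} (Hs : small theta delta) :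
  ~ orbit (cusp_system theta) (entry theta delta) (1, 0).
Proof.
  assert (Hne : entry theta delta <> (1, 0)).
  { intros E. apply (f_equal snd) in E. simpl in E. destruct Hs as [Hd _]. lra. }
  intros [[h [T [HT [H1 [_ [H2 H3]]]]]]|[h [T [HT [H1 [_ [H2 H3]]]]]]]; apply Hne.
  - rewrite <- H2. apply (cusp_equilibrium_const theta h 0 T T); try easy; lra.
  - rewrite <- H3. apply (cusp_equilibrium_const theta h 0 T 0); try easy; lra.
Qed.

(** * Energy, and the absence of a homoclinic orbit *)

Definition energy (z : R * R) : R := snd z ^ 2 / 2 + Gam (fst z).

Lemma energy_derive (theta : R) (g : R -> R * R) (t : R) :
  is_derive (fun t => fst (g t)) t (snd (g t)) ->
  is_derive (fun t => snd (g t)) t (vel theta (fst (g t)) (snd (g t))) ->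
  is_derive (fun t => energy (g t)) t (theta * (snd (g t) ^ 2 * (fst (g t) ^ 2 - 1) ^ 2)).
Proof.
  intros H1 H2. unfold energy.
  replace (theta * (snd (g t) ^ 2 * (fst (g t) ^ 2 - 1) ^ 2)) with
    (vel theta (fst (g t)) (snd (g t)) * snd (g t) +
     snd (g t) * (fst (g t) * (fst (g t) ^ 2 - 1) ^ 2)) by (unfold vel; ring).
  apply (is_derive_plus (fun t => snd (g t) ^ 2 / 2) (fun t => Gam (fst (g t)))).
  - apply (is_derive_comp (fun y => y ^ 2 / 2) (fun t => snd (g t))); [|exact H2].
    auto_derive; [easy|field].
  - apply (is_derive_comp Gam (fun t => fst (g t))); [|exact H1].
    unfold Gam. auto_derive; [easy|field].
Qed.

(** The sign [sigma] makes [sigma * energy] nondecreasing along solutions; it tends to 0, the energy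
    of the cusp, and so stays nonpositive. *)
Lemma energy_limit (theta sigma : R) (g : R -> R * R) :
  solution_on (cusp_system theta) (fun t => 0 <= t) g ->
  filterlim g (Rbar_locally p_infty) (locally ((1, 0) : R * R)) ->
  0 <= sigma * theta -> forall s t, 0 <= s -> s <= t ->
  sigma * energy (g s) <= sigma * energy (g t) <= 0.
Proof.
  intros Hg Hl Hst.
  assert (Hmon : forall s t, 0 <= s -> s <= t -> sigma * energy (g s) <= sigma * energy (g t)).
  { rewrite cusp_solution_iff in Hg. intros s t H1 H2.
    apply (derive_nondecreasing (fun t => sigma * energy (g t))
      (fun t => sigma * (theta * (snd (g t) ^ 2 * (fst (g t) ^ 2 - 1) ^ 2)))); [easy| |].
    - intros r Hr. apply is_derive_scal. apply energy_derive; apply Hg; lra.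
    - intros r Hr. rewrite <- Rmult_assoc. apply Rmult_le_pos; [easy|].
      apply Rmult_le_pos; apply pow2_ge_0. }
  intros s t H1 H2. split; [now apply Hmon|].
  apply Rnot_lt_le. intros Hpos.
  set (e := sigma * energy (g t)) in *.
  (* Within [eps] of the cusp [|energy| <= 3 * eps + eps / 4]; multiplied by [|sigma|] this is at
     most [13/16 * e], less than [e]. *)
  set (eps := Rmin (1 / 2) (e / (4 * (Rabs sigma + 1)))).
  assert (Hsg := Rabs_pos sigma).
  assert (Heps : 0 < eps) by (apply Rmin_pos; [lra|apply Rdiv_lt_0_compat; lra]).
  destruct (Hl (ball ((1, 0) : R * R) eps)) as [T HT].
  { exists (mkposreal eps Heps). now intros. }
  set (r := Rmax t T + 1). pose proof (Rmax_l t T). pose proof (Rmax_r t T).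
  destruct (HT r ltac:(unfold r; lra)) as [B1 B2].
  change (Rabs (fst (g r) - 1) < eps) in B1. change (Rabs (snd (g r) - 0) < eps) in B2.
  rewrite Rminus_0_r in B2.
  pose proof (Hmon t r ltac:(lra) ltac:(unfold r; lra)) as Hle. fold e in Hle.
  pose proof (Rmin_l (1 / 2) (e / (4 * (Rabs sigma + 1)))) as M1. fold eps in M1.
  pose proof (Rmin_r (1 / 2) (e / (4 * (Rabs sigma + 1)))) as M2. fold eps in M2.
  assert (He : Rabs (energy (g r)) <= 13 / 4 * eps).
  { unfold energy. apply Rle_trans with (1 := Rabs_triang _ _).
    pose proof (Gam_small (fst (g r)) ltac:(lra)).
    assert (Rabs (snd (g r) ^ 2 / 2) <= eps / 4); [|lra].
    unfold Rdiv. rewrite Rabs_mult, (Rabs_pos_eq (/ 2)) by lra.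
    rewrite <- RPow_abs. pose proof (Rabs_pos (snd (g r))). simpl. nra. }
  assert (Hf : Rabs (sigma * energy (g r)) < e).
  { rewrite Rabs_mult. apply Rle_lt_trans with (Rabs sigma * (13 / 4 * eps)).
    - now apply Rmult_le_compat_l.
    - assert ((Rabs sigma + 1) * eps <= e / 4).
      { apply Rmult_le_compat_l with (r := Rabs sigma + 1) in M2; [|lra].
        replace ((Rabs sigma + 1) * (e / (4 * (Rabs sigma + 1)))) with (e / 4) in M2 by (field; lra).
        lra. }
      lra. }
  pose proof (Rle_abs (sigma * energy (g r))). lra.
Qed.

(* A common orbit would be homoclinic to the cusp, hence contained in the zero level of
   the energy; but there it cannot cross the x-axis to come back. *)
Lemma no_homoclinic {theta delta : R} (Hs : small theta delta) :
  ~ tends_backward (cusp_system theta) (1, 0) (entry theta delta).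
Proof.
  rewrite tends_backward_mirror. intros [h [H1 [H2 H3]]].
  destruct (entry_tends Hs) as [g [G1 [G2 G3]]]. destruct (Hs) as [Hd _].
  assert (HE : energy (g 0) = energy (h 0)).
  { rewrite G2, H2. unfold energy, mirror, scale. cbn [fst snd].
    rewrite Rmult_1_l. f_equal. field. }
  (* The solution [g] and the mirrored solution [h], with parameter [- theta], start at the same
     energy. One bounds it by 0 from one side, the other bounds [energy (h t)] from the opposite
     side. *)
  assert (Hz : forall t, 0 <= t -> energy (h t) = 0).
  { intros t Ht. destruct (Rle_or_lt 0 theta).
    - pose proof (energy_limit theta 1 g G1 G3 ltac:(lra) 0 0 ltac:(lra) ltac:(lra)).
      pose proof (energy_limit (- theta) (-1) h H1 H3 ltac:(lra) 0 t ltac:(lra) Ht). lra.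
    - pose proof (energy_limit theta (-1) g G1 G3 ltac:(lra) 0 0 ltac:(lra) ltac:(lra)).
      pose proof (energy_limit (- theta) 1 h H1 H3 ltac:(lra) 0 t ltac:(lra) Ht). lra. }
  assert (Hy0 : snd (h 0) = - delta) by (rewrite H2; simpl; ring).
  assert (Hx0 : 1 / 2 <= fst (h 0) < 1).
  { assert (E := Hz 0 (Rle_refl _)). unfold energy in E. rewrite Hy0 in E.
    assert (Hx : 1 / 2 <= fst (h 0)).
    { rewrite H2. simpl. pose proof (xi_range (leaf_from theta delta 0 delta)). lra. }
    split; [easy|]. apply Rnot_le_lt. intros Hge.
    assert (0 <= Gam (fst (h 0))).
    { unfold Gam. apply Rdiv_le_0_compat; [|lra]. apply pow_le. simpl. nra. }
    assert (0 < (- delta) ^ 2) by (simpl; nra). lra. }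
  assert (H1' := H1). rewrite cusp_solution_iff in H1'.
  assert (Hneg : forall t, 0 <= t -> snd (h t) < 0).
  { intros t Ht. apply Rnot_le_lt. intros Hle.
    destruct (ivt_incr (fun t => snd (h t)) 0 t 0 Ht) as [T [HT HT0]].
    - intros s Hst. apply (derive_continuity_pt _ _ _ (proj2 (H1' s (proj1 Hst)))).
    - cbv beta. lra.
    - assert (E := Hz T (proj1 HT)). unfold energy in E. rewrite HT0 in E.
      assert (Ec : (fst (h T) ^ 2 - 1) ^ 3 = 0) by (unfold Gam in E; simpl in E |- *; lra).
      assert (Hx : fst (h T) ^ 2 - 1 = 0).
      { apply NNPP. intros Hn. now apply (pow_nonzero _ 3) in Hn. }
      assert (Hc : h 0 = (fst (h T), 0)); [|rewrite Hc in Hy0; simpl in Hy0; lra].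
      (* Zero energy on the axis only yields [x ^ 2 = 1], so the equilibrium met could be either of
         the two; the argument covers both. *)
      apply (cusp_unique (- theta) h (fun _ => (fst (h T), 0)) 0 T T); [lra| | | |lra].
      + apply (solution_subset _ _ _ _ H1). intros; lra.
      + apply cusp_solution_iff. intros s _. cbn [fst snd]. unfold vel. rewrite Hx.
        replace (0 ^ 2 * (- theta * 0 - fst (h T))) with 0 by ring.
        split; apply is_derive_Reals, derivable_pt_lim_const.
      + rewrite <- HT0. apply surjective_pairing. }
  destruct (H3 (ball ((1, 0) : R * R) (1 - fst (h 0)))) as [T HT].
  { exists (mkposreal (1 - fst (h 0)) ltac:(lra)). now intros. }
  set (r := Rmax 0 T + 1). pose proof (Rmax_l 0 T). pose proof (Rmax_r 0 T).
  destruct (HT r ltac:(unfold r; lra)) as [B1 _].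
  change (Rabs (fst (h r) - 1) < 1 - fst (h 0)) in B1. apply Rabs_lt_between in B1.
  assert (- fst (h 0) <= - fst (h r)); [|lra].
  apply (derive_nondecreasing (fun t => - fst (h t)) (fun t => - snd (h t))); [unfold r; lra| |].
  - intros s Hst. apply (is_derive_opp (fun t => fst (h t))), H1'. lra.
  - intros s Hst. specialize (Hneg s ltac:(lra)). lra.
Qed.

(** * Hyperbolic sectors *)

Definition stable_arc (theta delta eta : R) (w : R * R) : Prop :=
  1 / 2 <= fst w <= 3 / 2 /\ chart theta delta w = 0 /\ 0 < snd w <= eta.

Definition unstable_arc (theta delta eta : R) (w : R * R) : Prop :=
  1 / 2 <= fst w <= 3 / 2 /\ chart theta delta w = 0 /\ -eta <= snd w < 0.

Lemma unstable_arc_mirror {theta delta eta : R} (Hs : small theta delta) (w : R * R) :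
  eta <= delta ->
  unstable_arc theta delta eta w <-> stable_arc (- theta) delta eta (mirror w).
Proof.
  intros He. unfold unstable_arc, stable_arc, mirror, scale, chart. cbn [fst snd].
  rewrite Rmult_1_l. replace (-1 * snd w) with (- snd w) by ring.
  split; intros [H1 [H2 H3]]; (split; [easy|]; split; [|lra]); rewrite <- H2.
  - apply (leaf_label_reflect Hs). lra.
  - symmetry. apply (leaf_label_reflect Hs). lra.
Qed.

Lemma stable_arc_reach {theta delta eta : R} (Hs : small theta delta)
    (z := (xi (leaf_from theta delta 0 eta), eta)) :
  0 < eta <= delta ->
  tends_forward (cusp_system theta) (1, 0) z /\
  forall w, stable_arc theta delta eta w <-> reach (cusp_system theta) z w.
Proof.
  intros He. destruct (point_on_leaf Hs 0 eta) as [B C]; [rewrite Rabs_R0; lra|lra|].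
  fold z in B, C.
  destruct (separatrix_tends Hs z B C) as [g [G1 [G2 [G3 G4]]]]; [simpl; lra|].
  split; [now exists g|]. intros w. split.
  - intros [W1 [W2 W3]].
    destruct (leaf_reach Hs z w) as [h [T [H1 [H2 [H3 [H4 _]]]]]]; try easy.
    + unfold in_box. lra.
    + rewrite C, Rabs_R0. lra.
    + now rewrite C.
    + intros _. right; now left.
    + now exists h, T.
  - intros [h [T [HT [H1 [_ [H2 H3]]]]]].
    assert (E : h T = g T).
    { apply (cusp_unique theta h g 0 T 0); try easy; try lra.
      - apply (solution_subset _ _ _ _ G1). intros; lra.
      - now rewrite H2, G2. }
    rewrite <- H3, E. destruct (G4 T HT) as [[K1 K2] [K3 K4]]. easy.
Qed.

Lemma stable_arc_ending {theta delta eta : R} (Hs : small theta delta) :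
  0 < eta <= delta -> arc_ending_at (cusp_system theta) (1, 0) (stable_arc theta delta eta).
Proof.
  intros He. exists (xi (leaf_from theta delta 0 eta), eta). split.
  - intros E. apply (f_equal snd) in E. simpl in E. lra.
  - left. now apply stable_arc_reach.
Qed.

Lemma unstable_arc_ending {theta delta eta : R} (Hs : small theta delta) :
  0 < eta <= delta -> arc_ending_at (cusp_system theta) (1, 0) (unstable_arc theta delta eta).
Proof.
  intros He. set (z := (xi (leaf_from (- theta) delta 0 eta), eta)).
  destruct (stable_arc_reach (small_opp Hs) He) as [H1 H2]. fold z in H1, H2.
  exists (mirror z). split.
  - intros E. apply (f_equal snd) in E. simpl in E. lra.
  - right. rewrite tends_backward_mirror, mirror_mirror. split; [easy|].
    intros w. rewrite (unstable_arc_mirror Hs) by lra.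
    rewrite (reach_mirror theta w), mirror_mirror. apply H2.
Qed.

(* Both the saddle and the cusp become horizontal flows in the coordinates
   [(k, m) = (u v, u - v)] and [(k, m) = (+- chart, y)], the line [k = 0] being cut
   at the equilibrium [m = 0]; this is the reachability relation of such a flow. *)
Definition horizontal_reach (k m k' m' : R) : Prop :=
  k = k' /\ m <= m' /\ (k = 0 -> m = m' \/ 0 < m \/ m' < 0).

(** Bounds on [(k, m) = (u v, u - v)], chosen to match those on [(e * chart, y)] in [sector]. *)
Definition saddle_region (eta : R) (z : R * R) : Prop :=
  fst z * snd z <= eta ^ 2 /\ -eta <= fst z - snd z <= eta.

Definition quadrant (eta : R) (z : R * R) : Prop :=
  saddle_region eta z /\ 0 <= fst z /\ 0 <= snd z.

Lemma saddle_flow (u v t : R) : is_derive (fun t => ((u * exp t, v * exp (- t)) : R * R)) t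
  (saddle (u * exp t, v * exp (- t))).
Proof.
  unfold saddle; simpl. apply is_derive_pair. simpl. split; auto_derive; easy || ring.
Qed.

Lemma saddle_solution (g : R -> R * R) (T : R) :
  0 <= T -> solution_on saddle (fun t => 0 <= t <= T) g ->
  g T = (fst (g 0) * exp T, snd (g 0) * exp (- T)).
Proof.
  intros HT Hg.
  assert (Hd : forall t, 0 <= t <= T ->
    is_derive (fun t => fst (g t)) t (fst (g t)) /\ is_derive (fun t => snd (g t)) t (- snd (g t))).
  { intros t Ht. specialize (Hg t Ht). unfold saddle in Hg. now apply is_derive_pair in Hg. }
  assert (Hc : forall f : R -> R, (forall t, 0 <= t <= T -> is_derive f t 0) -> f T = f 0).
  { intros f Hf. apply Rminus_diag_uniq.
    pose proof (derive_bound f (fun _ => 0) (fun _ => 0) (fun _ => 0) 0 T HT Hf) as B.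
    rewrite Rminus_0_r in B.
    assert (Rabs (f T - f 0) <= 0).
    { apply B; intros t Ht; [apply is_derive_Reals, derivable_pt_lim_const|rewrite Rabs_R0; lra]. }
    destruct (Req_dec (f T - f 0) 0) as [|Hn]; [easy|]. apply Rabs_pos_lt in Hn. lra. }
  assert (A1 : fst (g T) * exp (- T) = fst (g 0) * exp (- 0)).
  { apply (Hc (fun t => fst (g t) * exp (- t))). intros t Ht.
    replace 0 with (fst (g t) * exp (- t) + fst (g t) * (- exp (- t))) by ring.
    apply (is_derive_mult (fun t => fst (g t)) (fun t => exp (- t)));
      [now apply Hd|auto_derive; [easy|ring]|intros; apply Rmult_comm]. }
  assert (A2 : snd (g T) * exp T = snd (g 0) * exp 0).
  { apply (Hc (fun t => snd (g t) * exp t)). intros t Ht.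
    replace 0 with (- snd (g t) * exp t + snd (g t) * exp t) by ring.
    apply (is_derive_mult (fun t => snd (g t)) exp);
      [now apply Hd|auto_derive; [easy|ring]|intros; apply Rmult_comm]. }
  rewrite Ropp_0, exp_0, Rmult_1_r in A1. rewrite exp_0, Rmult_1_r in A2.
  rewrite <- A1, <- A2, !Rmult_assoc, <- !exp_plus.
  rewrite Rplus_opp_l, Rplus_opp_r, exp_0, !Rmult_1_r. apply surjective_pairing.
Qed.

(** The flow preserves [u v] and increases [u - v]. Off the axes the travel time is [ln (u' / u)];
    on an axis it is found from the nonzero coordinate. The path stays in the quadrant because
    [u - v] remains between its end values. *)
Lemma saddle_reach_iff (eta : R) (z w : R * R) :
  quadrant eta z -> quadrant eta w ->
  reach_in saddle (quadrant eta) z w <->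
  horizontal_reach (fst z * snd z) (fst z - snd z) (fst w * snd w) (fst w - snd w).
Proof.
  destruct z as [u v]. destruct w as [u' v'].
  intros [[Hz1 Hz2] [Hu Hv]] [[Hw1 Hw2] [Hu' Hv']]. cbn [fst snd] in *. split.
  - intros [g [T [HT [Hg [_ [H0 H1]]]]]].
    pose proof (saddle_solution g T HT Hg) as E. rewrite H0, H1 in E. cbn [fst snd] in E.
    injection E as E1 E2. clear H0 H1 Hg.
    assert (HeT : 1 <= exp T) by (pose proof (exp_ineq1_le T); lra).
    assert (Hprod : exp T * exp (- T) = 1) by (rewrite <- exp_plus, Rplus_opp_r; apply exp_0).
    pose proof (exp_pos (- T)) as Hm.
    assert (HeT' : exp (- T) <= 1) by nra.
    split; [|split].
    + rewrite E1, E2. transitivity (u * v * (exp T * exp (- T))); [rewrite Hprod|]; ring.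
    + rewrite E1, E2. nra.
    + intros Hk. destruct (Rmult_integral _ _ Hk) as [Hz|Hz].
      * destruct (Req_dec v 0) as [Hv0|Hv0].
        -- left. rewrite E1, E2, Hz, Hv0. ring.
        -- right; right. rewrite E1, E2, Hz. assert (0 < v) by lra. nra.
      * destruct (Req_dec u 0) as [Hu0|Hu0].
        -- left. rewrite E1, E2, Hz, Hu0. ring.
        -- right; left. lra.
  - intros [Hk [Hm H0]].
    assert (HT : exists T, 0 <= T /\ u' = u * exp T /\ v' = v * exp (- T)).
    { assert (Hpos : 0 < u -> 0 < u' -> u <= u' -> exists T, 0 <= T /\ u' = u * exp T /\ v' = v * exp (- T)).
      { intros P1 P2 P3. exists (ln (u' / u)).
        assert (Hq : 1 <= u' / u) by (apply -> Rle_div_r; lra).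
        assert (Hl : 0 <= ln (u' / u)) by (rewrite <- ln_1; apply ln_le; lra).
        rewrite exp_Ropp, exp_ln by lra. split; [easy|].
        split; [field; lra|]. apply (Rmult_eq_reg_l u'); [|lra].
        rewrite <- Hk. field. lra. }
      destruct (Req_dec (u * v) 0) as [Hz|Hz].
      - destruct (H0 Hz) as [E|[E|E]].
        (* Equal [m] and equal [k] force equal points, since [(u + v) ^ 2 = m ^ 2 + 4 * k]. *)
        + assert (Hs : u + v = u' + v').
          { assert (S : (u + v) * (u + v) = (u' + v') * (u' + v')).
            { replace ((u + v) * (u + v)) with ((u - v) * (u - v) + 4 * (u * v)) by ring.
              rewrite E, Hk. ring. }
            nra. }
          exists 0. rewrite Ropp_0, exp_0. lra.
        + assert (v = 0) by nra. assert (v' = 0) by nra. apply Hpos; nra.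
        + assert (u = 0) by nra. assert (u' = 0) by nra.
          exists (ln (v / v')).
          assert (Hv0 : 0 < v') by lra. assert (Hvv : v' <= v) by lra.
          assert (Hq : 1 <= v / v') by (apply -> Rle_div_r; lra).
          split; [rewrite <- ln_1; apply ln_le; lra|].
          split; [subst; ring|]. rewrite exp_Ropp, exp_ln by lra. field. lra.
      - assert (Hu0 : 0 < u) by (destruct (Req_dec u 0) as [->|]; lra).
        assert (Hu1 : 0 < u') by (destruct (Req_dec u' 0) as [->|]; lra).
        apply Hpos; try easy. apply Rnot_lt_le. intros Hlt.
        assert (v' < v) by lra.
        (* This sum is [u * v - u' * v'], which vanishes. *)
        assert (0 < u * (v - v') + v' * (u - u')); [|lra].
        apply Rplus_lt_le_0_compat; [apply Rmult_lt_0_compat|apply Rmult_le_pos]; lra. }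
    destruct HT as [T [HT [E1 E2]]].
    exists (fun t => (u * exp t, v * exp (- t))), T. split; [easy|]. split; [|split; [|split]].
    + intros t _. apply saddle_flow.
    + intros t Ht. unfold quadrant, saddle_region. cbn [fst snd].
      assert (Hprod : exp t * exp (- t) = 1) by (rewrite <- exp_plus, Rplus_opp_r; apply exp_0).
      assert (M1 : 1 <= exp t) by (pose proof (exp_ineq1_le t); lra).
      assert (M2 : exp t <= exp T) by (destruct (Req_dec t T) as [->|]; [lra|left; apply exp_increasing; lra]).
      assert (M3 : exp (- T) <= exp (- t))
        by (destruct (Req_dec t T) as [->|]; [lra|left; apply exp_increasing; lra]).
      pose proof (exp_pos (- t)). assert (M4 : exp (- t) <= 1) by nra.
      split; [split|].
      * replace (u * exp t * (v * exp (- t))) with (u * v * (exp t * exp (- t))) by ring.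
        rewrite Hprod. lra.
      * rewrite E1, E2 in Hw2. nra.
      * split; apply Rmult_le_pos; lra.
    + now rewrite Ropp_0, exp_0, !Rmult_1_r.
    + now rewrite E1, E2.
Qed.

(** [e] is 1 or -1 and selects the side of the separatrices. The two sectors overlap exactly where
    the label is 0, that is, in the two arcs and the cusp. *)
Definition sector (theta delta eta e : R) (z : R * R) : Prop :=
  1 / 2 <= fst z <= 3 / 2 /\ -eta <= snd z <= eta /\ 0 <= e * chart theta delta z <= eta ^ 2.

Lemma sector_in_box {theta delta eta e : R} (z : R * R) :
  eta <= delta -> sector theta delta eta e z -> in_box delta z.
Proof. intros He [H1 [H2 _]]. unfold in_box. lra. Qed.

Lemma sector_chart {theta delta eta e : R} (Hs : small theta delta) (z : R * R) :
  0 < eta <= delta -> e = 1 \/ e = -1 -> sector theta delta eta e z ->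
  Rabs (chart theta delta z) <= 1 / 100.
Proof.
  intros He H1 [_ [_ H2]]. destruct Hs as [Hd _].
  assert (eta ^ 2 <= 1 / 100) by (simpl; nra).
  apply Rabs_le. destruct H1 as [-> | ->]; lra.
Qed.

(** Time is reversed so that [y] increases, as [u - v] does for the saddle. On the leaf 0 a passage
    through ordinate 0 would hit the equilibrium, which leaves only the constant path. *)
Lemma cusp_reach_iff {theta delta eta e : R} (Hs : small theta delta) (z w : R * R) :
  0 < eta <= delta -> e = 1 \/ e = -1 ->
  sector theta delta eta e z -> sector theta delta eta e w ->
  reach_in (reverse (cusp_system theta)) (sector theta delta eta e) z w <->
  horizontal_reach (e * chart theta delta z) (snd z) (e * chart theta delta w) (snd w).
Proof.
  intros He He1 Hz Hw. rewrite reach_in_reverse. split.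
  - intros [g [T [HT [Hg [HD [H0 H1]]]]]].
    assert (Hb : forall t, 0 <= t <= T -> in_box delta (g t)).
    { intros t Ht. apply (sector_in_box _ (proj2 He) (HD t Ht)). }
    assert (Hc : forall t, 0 <= t <= T -> chart theta delta (g t) = chart theta delta w).
    { intros t Ht. rewrite <- H0. apply (chart_constant Hs g 0 T); try easy; lra. }
    split; [|split].
    + rewrite <- H1, Hc by lra. reflexivity.
    + rewrite <- H0, <- H1. apply (ordinate_nonincreasing Hs g 0 T); try easy; lra.
    + intros Hk. assert (Hk0 : chart theta delta z = 0) by (destruct He1 as [-> | ->]; lra).
      destruct (Rlt_or_le 0 (snd z)) as [|Hzle]; [right; now left|].
      destruct (Rlt_or_le (snd w) 0) as [|Hwle]; [right; now right|]. left.
      destruct (ivt_decr (fun t => snd (g t)) 0 T 0 HT) as [t [Ht Ht0]].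
      * intros s Hst. rewrite cusp_solution_iff in Hg.
        apply (derive_continuity_pt _ _ _ (proj2 (Hg s Hst))).
      * cbv beta. rewrite H0, H1. lra.
      * assert (E : g t = (1, 0)).
        { apply (chart_zero_axis Hs); [now apply Hb| |easy].
          rewrite Hc, <- (Hc T), H1 by lra. easy. }
        pose proof (cusp_equilibrium_const theta g 0 T t Ht Hg E) as Ec.
        rewrite <- H0, <- H1, !Ec by lra. reflexivity.
  - intros [Hk [Hm H0]].
    assert (Hc : chart theta delta w = chart theta delta z) by (destruct He1 as [-> | ->]; lra).
    destruct (leaf_reach Hs w z) as [g [T [G1 [G2 [G3 [G4 G5]]]]]]; try easy.
    + now apply (sector_in_box _ (proj2 He) Hw).
    + now apply (sector_in_box _ (proj2 He) Hz).
    + now apply (sector_chart Hs w He He1).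
    + intros Hz0. destruct H0 as [H0|H0].
      * rewrite <- Hc, Hz0. ring.
      * now left.
      * now right.
    + exists g, T. split; [easy|]. split; [easy|]. split; [|easy].
      intros t Ht. destruct (G5 t Ht) as [[B1 B2] [B3 B4]].
      destruct Hz as [_ [Hz _]]. destruct Hw as [_ [Hw1 Hw2]].
      split; [easy|]. split; [lra|]. now rewrite B3.
Qed.

(** Matches horizontal coordinates: [(u, v)] goes to the point with label [e * (u v)] and ordinate
    [u - v]. The half-axis [v = 0] lands on the stable arc, [u = 0] on the unstable one. *)
Definition sector_map (theta delta e : R) (z : R * R) : R * R :=
  (xi (leaf_from theta delta (e * (fst z * snd z)) (fst z - snd z)), fst z - snd z).

(* Solves [u v = k], [u - v = m] for [k >= 0] in the closed quadrant. *)
Definition sector_inverse (theta delta e : R) (z : R * R) : R * R :=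
  let r := sqrt (snd z ^ 2 + 4 * (e * chart theta delta z)) in
  ((r + snd z) / 2, (r - snd z) / 2).

Lemma sector_map_spec {theta delta eta e : R} (Hs : small theta delta) (z : R * R) :
  0 < eta <= delta -> e = 1 \/ e = -1 -> quadrant eta z ->
  sector theta delta eta e (sector_map theta delta e z) /\
  e * chart theta delta (sector_map theta delta e z) = fst z * snd z.
Proof.
  intros He He1 [[H1 H2] [H3 H4]].
  assert (Hk : 0 <= fst z * snd z) by now apply Rmult_le_pos.
  assert (Heta : eta ^ 2 <= 1 / 100) by (destruct Hs as [Hd _]; simpl; nra).
  destruct (point_on_leaf Hs (e * (fst z * snd z)) (fst z - snd z)) as [B C].
  - apply Rabs_le. destruct He1 as [-> | ->]; lra.
  - lra.
  - assert (E : e * chart theta delta (sector_map theta delta e z) = fst z * snd z).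
    { unfold sector_map. rewrite C. destruct He1 as [-> | ->]; ring. }
    split; [|easy]. destruct B as [B1 _]. unfold sector. rewrite E. simpl snd. simpl fst. easy.
Qed.

Lemma sector_inverse_spec {theta delta eta e : R} (w : R * R) :
  0 < eta -> sector theta delta eta e w ->
  quadrant eta (sector_inverse theta delta e w) /\
  fst (sector_inverse theta delta e w) * snd (sector_inverse theta delta e w) = e * chart theta delta w /\
  fst (sector_inverse theta delta e w) - snd (sector_inverse theta delta e w) = snd w.
Proof.
  intros He [H1 [H2 H3]]. unfold sector_inverse, quadrant, saddle_region. cbn [fst snd].
  set (m := snd w) in *. set (k := e * chart theta delta w) in *.
  set (r := sqrt (m ^ 2 + 4 * k)).
  assert (Hr : r * r = m ^ 2 + 4 * k) by (apply sqrt_sqrt; pose proof (pow2_ge_0 m); lra).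
  assert (Hr0 : 0 <= r) by apply sqrt_pos.
  assert (E1 : (r + m) / 2 * ((r - m) / 2) = k).
  { replace ((r + m) / 2 * ((r - m) / 2)) with ((r * r - m ^ 2) / 4) by field. rewrite Hr. field. }
  assert (E2 : (r + m) / 2 - (r - m) / 2 = m) by field.
  assert (Hm : - r <= m <= r) by (simpl in Hr; split; nra).
  rewrite E1, E2. repeat split; lra.
Qed.

Lemma sector_inverse_map {theta delta eta e : R} (Hs : small theta delta) (z : R * R) :
  0 < eta <= delta -> e = 1 \/ e = -1 -> quadrant eta z ->
  sector_inverse theta delta e (sector_map theta delta e z) = z.
Proof.
  intros He He1 Hz. destruct (sector_map_spec Hs z He He1 Hz) as [_ E].
  unfold sector_inverse. rewrite E. simpl snd.
  destruct z as [u v]. destruct Hz as [_ [Hu Hv]]. simpl fst in *. simpl snd in *.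
  replace ((u - v) ^ 2 + 4 * (u * v)) with ((u + v) ^ 2) by ring.
  rewrite sqrt_pow2 by lra. f_equal; field.
Qed.

Lemma sector_map_inverse {theta delta eta e : R} (Hs : small theta delta) (w : R * R) :
  0 < eta <= delta -> e = 1 \/ e = -1 -> sector theta delta eta e w ->
  sector_map theta delta e (sector_inverse theta delta e w) = w.
Proof.
  intros He He1 Hw. destruct (sector_inverse_spec w (proj1 He) Hw) as [Q [E1 E2]].
  destruct (sector_map_spec Hs _ He He1 Q) as [S E].
  apply (chart_injective Hs).
  - now apply (sector_in_box _ (proj2 He) S).
  - now apply (sector_in_box _ (proj2 He) Hw).
  - rewrite E1 in E. destruct He1 as [-> | ->]; lra.
  - unfold sector_map. simpl snd. exact E2.
Qed.

Lemma continuous_pair_fun (f g : R * R -> R) (z : R * R) :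
  continuous f z -> continuous g z -> continuous (fun z => ((f z, g z) : R * R)) z.
Proof.
  intros Hf Hg P [eps HP].
  assert (Lf : locally z (fun w => ball (f z) eps (f w))) by (apply Hf; now exists eps).
  assert (Lg : locally z (fun w => ball (g z) eps (g w))) by (apply Hg; now exists eps).
  unfold filtermap. apply (filter_imp (fun w => ball (f z) eps (f w) /\ ball (g z) eps (g w))).
  - intros w [H1 H2]. apply HP. now split.
  - exact (filter_and _ _ Lf Lg).
Qed.

Lemma continuous_lipschitz_2 (F : R -> R -> R) (f g : R * R -> R) (z : R * R) :
  (forall a b a' b', Rabs (F a b - F a' b') <= 2 * Rabs (a - a') + Rabs (b - b')) ->
  continuous f z -> continuous g z -> continuous (fun z => F (f z) (g z)) z.
Proof.
  intros HF Hf Hg P [eps HP].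
  assert (He : 0 < eps / 4) by (pose proof (cond_pos eps); lra).
  assert (Lf : locally z (fun w => ball (f z) (eps / 4) (f w)))
    by (apply Hf; now exists (mkposreal _ He)).
  assert (Lg : locally z (fun w => ball (g z) (eps / 4) (g w)))
    by (apply Hg; now exists (mkposreal _ He)).
  unfold filtermap. apply (filter_imp (fun w => ball (f z) (eps / 4) (f w) /\ ball (g z) (eps / 4) (g w))).
  - intros w [H1 H2]. apply HP.
    change (Rabs (f w - f z) < eps / 4) in H1. change (Rabs (g w - g z) < eps / 4) in H2.
    apply Rle_lt_trans with (1 := HF _ _ _ _). pose proof (cond_pos eps). lra.
  - exact (filter_and _ _ Lf Lg).
Qed.

Lemma continuous_on_everywhere (D : R * R -> Prop) (f : R * R -> R * R) :
  (forall z, continuous f z) -> continuous_on D f.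
Proof.
  intros H z _ P HP. unfold filtermap. apply filter_le_within. exact (H z P HP).
Qed.

Lemma continuous_fst_R (z : R * R) : continuous (fun z : R * R => fst z) z.
Proof. apply (continuous_fst (U := R_UniformSpace) (V := R_UniformSpace)). Qed.

Lemma continuous_snd_R (z : R * R) : continuous (fun z : R * R => snd z) z.
Proof. apply (continuous_snd (U := R_UniformSpace) (V := R_UniformSpace)). Qed.

Lemma continuous_sector_map {theta delta : R} (Hs : small theta delta) (e : R) (z : R * R) :
  continuous (sector_map theta delta e) z.
Proof.
  assert (Hd : continuous (fun z : R * R => fst z - snd z) z).
  { apply (continuous_minus (fun z : R * R => fst z) (fun z => snd z));
      [apply continuous_fst_R|apply continuous_snd_R]. }
  apply continuous_pair_fun; [|exact Hd].
  apply (continuous_comp (fun z : R * R => leaf_from theta delta (e * (fst z * snd z)) (fst z - snd z)) xi);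
    [|apply continuous_xi].
  apply (continuous_lipschitz_2 (leaf_from theta delta)); [|clear Hd|exact Hd].
  - intros. now apply leaf_from_lipschitz.
  - apply (continuous_mult (fun _ : R * R => e) (fun z => fst z * snd z)); [apply continuous_const|].
    apply (continuous_mult (fun z : R * R => fst z) (fun z => snd z));
      [apply continuous_fst_R|apply continuous_snd_R].
Qed.

Lemma continuous_chart {theta delta : R} (Hs : small theta delta) (z : R * R) :
  continuous (chart theta delta) z.
Proof.
  apply (continuous_lipschitz_2 (leaf_label theta delta) (fun z => Gam (fst z)) (fun z => snd z)).
  - intros. now apply leaf_label_lipschitz.
  - apply (continuous_comp (fun z : R * R => fst z) Gam); [apply continuous_fst_R|].
    apply (ex_derive_continuous Gam). unfold Gam. auto_derive. easy.
  - apply continuous_snd_R.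
Qed.

Lemma continuous_sector_inverse {theta delta : R} (Hs : small theta delta) (e : R) (z : R * R) :
  continuous (sector_inverse theta delta e) z.
Proof.
  assert (Hr : continuous (fun z : R * R => sqrt (snd z ^ 2 + 4 * (e * chart theta delta z))) z).
  { apply (continuous_comp (fun z : R * R => snd z ^ 2 + 4 * (e * chart theta delta z)) sqrt);
      [|apply continuous_sqrt].
    apply (continuous_plus (fun z : R * R => snd z ^ 2) (fun z => 4 * (e * chart theta delta z))).
    - apply (continuous_comp (fun z : R * R => snd z) (fun y => y ^ 2)); [apply continuous_snd_R|].
      apply (ex_derive_continuous (fun y => y ^ 2)). auto_derive. easy.
    - apply (continuous_mult (fun _ : R * R => 4) (fun z => e * chart theta delta z)); [apply continuous_const|].
      apply (continuous_mult (fun _ : R * R => e) (chart theta delta)); [apply continuous_const|].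
      now apply continuous_chart. }
  unfold sector_inverse. apply continuous_pair_fun; unfold Rdiv.
  - apply (continuous_mult (fun z : R * R => sqrt (snd z ^ 2 + 4 * (e * chart theta delta z)) + snd z)
      (fun _ => / 2)); [|apply continuous_const].
    apply (continuous_plus (fun z : R * R => sqrt (snd z ^ 2 + 4 * (e * chart theta delta z))));
      [exact Hr|apply continuous_snd_R].
  - apply (continuous_mult (fun z : R * R => sqrt (snd z ^ 2 + 4 * (e * chart theta delta z)) - snd z)
      (fun _ => / 2)); [|apply continuous_const].
    apply (continuous_minus (fun z : R * R => sqrt (snd z ^ 2 + 4 * (e * chart theta delta z))));
      [exact Hr|apply continuous_snd_R].
Qed.

(** Both flows have the same reachability relation in horizontal coordinates, so [sector_map] is the
    equivalence. The strict [eta < delta] leaves room for orbits to exit: a leaf with nonzero label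
    is followed to the ordinates [- delta] and [delta], outside the sector. *)
Lemma sector_hyperbolic {theta delta eta e : R} (Hs : small theta delta) :
  0 < eta < delta -> e = 1 \/ e = -1 ->
  hyperbolic_sector (cusp_system theta) (1, 0) (sector theta delta eta e)
    (stable_arc theta delta eta) (unstable_arc theta delta eta).
Proof.
  intros He' He1. assert (He : 0 < eta <= delta) by lra.
  assert (Heta : eta ^ 2 <= 1 / 100) by (destruct Hs as [Hd _]; simpl; nra).
  assert (Hmap : forall w z, quadrant eta z -> in_box delta w ->
    e * chart theta delta w = fst z * snd z -> snd w = fst z - snd z ->
    w = sector_map theta delta e z).
  { intros w z Hz Hw H1 H2. destruct (sector_map_spec Hs z He He1 Hz) as [S E].
    apply (chart_injective Hs); [easy|now apply (sector_in_box _ (proj2 He) S)| |easy].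
    rewrite <- H1 in E. destruct He1 as [-> | ->]; lra. }
  assert (Hmap' : forall z, quadrant eta z ->
    1 / 2 <= fst (sector_map theta delta e z) <= 3 / 2 /\
    (fst z * snd z = 0 -> chart theta delta (sector_map theta delta e z) = 0)).
  { intros z Hz. destruct (sector_map_spec Hs z He He1 Hz) as [[S _] E]. split; [easy|].
    intros H0. rewrite H0 in E. destruct He1 as [-> | ->]; lra. }
  split; [now apply stable_arc_ending|]. split; [now apply unstable_arc_ending|]. split.
  - exists (saddle_region eta), (sector_map theta delta e). split.
    { exists (mkposreal (eta / 2) ltac:(lra)). intros [u v] [H1 H2].
      change (Rabs (u - 0) < eta / 2) in H1. change (Rabs (v - 0) < eta / 2) in H2.
      rewrite Rminus_0_r in H1, H2. apply Rabs_lt_between in H1. apply Rabs_lt_between in H2.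
      split; cbn [fst snd]; [simpl; nra|lra]. }
    cbv zeta. fold (quadrant eta). split; [right|split; [|split]].
    + split.
      * exists (sector_inverse theta delta e). split; [|split; [|split]].
        -- apply continuous_on_everywhere. intros z. now apply continuous_sector_map.
        -- apply continuous_on_everywhere. intros z. now apply continuous_sector_inverse.
        -- intros z Hz. split; [now apply sector_map_spec|now apply (sector_inverse_map (eta := eta) Hs)].
        -- intros w Hw. split; [now apply sector_inverse_spec|now apply (sector_map_inverse (eta := eta) Hs)].
      * intros z w Hz Hw. change (quadrant eta z) in Hz. change (quadrant eta w) in Hw.
        rewrite (saddle_reach_iff eta z w Hz Hw).
        destruct (sector_map_spec Hs z He He1 Hz) as [Sz Ez].
        destruct (sector_map_spec Hs w He He1 Hw) as [Sw Ew].
        rewrite (cusp_reach_iff Hs _ _ He He1 Sz Sw), Ez, Ew. reflexivity.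
    + symmetry. apply Hmap.
      * unfold quadrant, saddle_region; simpl. nra.
      * apply (in_box_cusp Hs).
      * rewrite (chart_cusp Hs). simpl. ring.
      * simpl. ring.
    + intros w. split.
      * intros [H1 [H2 H3]]. exists (snd w).
        assert (Q : quadrant eta (snd w, 0)) by (unfold quadrant, saddle_region; simpl; nra).
        split; [apply H3|]. split; [exact Q|]. apply Hmap; [easy|unfold in_box; lra| |].
        -- rewrite H2. simpl. ring.
        -- simpl. ring.
      * intros [u [Hu [Q ->]]]. change (quadrant eta (u, 0)) in Q.
        destruct (Hmap' _ Q) as [M1 M2]. split; [easy|]. split; [apply M2; simpl; ring|].
        destruct Q as [[_ Q] _]. simpl in Q |- *. lra.
    + intros w. split.
      * intros [H1 [H2 H3]]. exists (- snd w).
        assert (Q : quadrant eta (0, - snd w)) by (unfold quadrant, saddle_region; simpl; nra).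
        split; [lra|]. split; [exact Q|]. apply Hmap; [easy|unfold in_box; lra| |].
        -- rewrite H2. simpl. ring.
        -- simpl. ring.
      * intros [v [Hv [Q ->]]]. change (quadrant eta (0, v)) in Q.
        destruct (Hmap' _ Q) as [M1 M2]. split; [easy|]. split; [apply M2; simpl; ring|].
        destruct Q as [[_ Q] _]. simpl in Q |- *. lra.
  - intros z Hz Hp HA HB.
    assert (Hbox : in_box delta z) by now apply (sector_in_box _ (proj2 He) Hz).
    assert (Hk := sector_chart Hs z He He1 Hz).
    assert (Hk0 : chart theta delta z <> 0).
    { intros H0. destruct Hz as [Z1 [Z2 _]]. destruct (Rtotal_order (snd z) 0) as [Hl|[Hl|Hl]].
      - apply HB. repeat split; lra.
      - now apply Hp, (chart_zero_axis Hs).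
      - apply HA. repeat split; lra. }
    split.
    + destruct (point_on_leaf Hs (chart theta delta z) (- delta) Hk ltac:(lra)) as [B C].
      exists (xi (leaf_from theta delta (chart theta delta z) (- delta)), - delta). split.
      * destruct (leaf_reach Hs z _ Hbox B Hk) as [g [T [G1 [G2 [G3 [G4 _]]]]]].
        -- now rewrite C.
        -- simpl. apply Hbox.
        -- easy.
        -- now exists g, T.
      * intros [_ [S _]]. simpl in S. lra.
    + destruct (point_on_leaf Hs (chart theta delta z) delta Hk ltac:(lra)) as [B C].
      exists (xi (leaf_from theta delta (chart theta delta z) delta), delta). split.
      * destruct (leaf_reach Hs _ z B Hbox) as [g [T [G1 [G2 [G3 [G4 _]]]]]].
        -- now rewrite C.
        -- easy.
        -- simpl. apply Hbox.
        -- rewrite C. easy.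
        -- now exists g, T.
      * intros [_ [S _]]. simpl in S. lra.
Qed.

(** * Assembly of the cusp at [(1, 0)] *)

Lemma small_exists (theta : R) : exists delta, small theta delta.
Proof.
  pose proof (Rabs_pos theta) as Ht.
  assert (Hq : 0 < / (200 * (Rabs theta + 1))) by (apply Rinv_0_lt_compat; lra).
  set (q := / (200 * (Rabs theta + 1))) in *.
  exists (Rmin (1 / 20) q). split; [split; [apply Rmin_pos; lra|apply Rmin_l]|].
  apply Rle_trans with (Rabs theta * q).
  - apply Rmult_le_compat_l; [easy|apply Rmin_r].
  - assert ((Rabs theta + 1) * q = 1 / 200) by (unfold q; field; lra). lra.
Qed.

Lemma cusp_at_one (theta : R) : is_cusp (cusp_system theta) (1, 0).
Proof.
  destruct (small_exists theta) as [delta Hs]. destruct (Hs) as [Hd _].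
  split.
  { split; [unfold is_equilibrium, cusp_system; f_equal; ring|].
    exists (mkposreal (1 / 2) ltac:(lra)). intros [x y] [Hx _] Hz.
    change (Rabs (x - 1) < 1 / 2) in Hx. apply Rabs_lt_between in Hx.
    unfold is_equilibrium, cusp_system in Hz. injection Hz as Hy Hz. subst y. f_equal.
    assert (Hx' : x * (x ^ 2 - 1) ^ 2 = 0) by lra.
    apply Rmult_integral in Hx'. destruct Hx' as [|Hx']; [lra|].
    assert (Hq : x ^ 2 - 1 = 0) by (apply NNPP; intros Hn; now apply (pow_nonzero _ 2) in Hn).
    assert ((x - 1) * (x + 1) = 0) by (simpl in Hq; lra). nra. }
  set (Gs := orbit (cusp_system theta) (entry theta delta)).
  (* The unstable separatrix is the mirror image of the stable one for [- theta]. *)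
  set (Gu := fun w => orbit (cusp_system (- theta)) (entry (- theta) delta) (mirror w)).
  assert (Hm0 : mirror (1, 0) = (1, 0)) by (unfold mirror, scale; simpl; f_equal; ring).
  assert (Hf : forall z, z <> (1, 0) -> (tends_forward (cusp_system theta) (1, 0) z <-> Gs z)).
  { intros z Hz. now apply tends_forward_iff_orbit. }
  assert (Hb : forall z, z <> (1, 0) -> (tends_backward (cusp_system theta) (1, 0) z <-> Gu z)).
  { intros z Hz. rewrite tends_backward_mirror. apply (tends_forward_iff_orbit (small_opp Hs)).
    intros E. apply Hz. now rewrite <- (mirror_mirror z), E, Hm0. }
  exists Gs, Gu. split; [now exists (entry theta delta)|].
  split.
  { exists (mirror (entry (- theta) delta)). intros w.
    rewrite (orbit_mirror theta), mirror_mirror. reflexivity. }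
  split; [now apply entry_orbit_avoids_cusp|].
  split; [unfold Gu; rewrite Hm0; apply (entry_orbit_avoids_cusp (small_opp Hs))|].
  split.
  (* If the two orbits coincided, [entry] would tend to the cusp in backward time as well. *)
  { intros E. apply (no_homoclinic Hs). apply Hb.
    - intros E'. apply (f_equal snd) in E'. simpl in E'. lra.
    - apply E. left. destruct (entry_tends Hs) as [g [G1 [G2 _]]].
      exists g, 0. split; [lra|]. split; [|easy].
      apply (solution_subset _ _ _ _ G1). intros; lra. }
  split; [exact Hf|]. split; [exact Hb|].
  intros eps Heps.
  (* The terms provide, in turn, [eta < delta], the bound on [y], and the bound on [x]: in a sector
     [|x - 1| ^ 3 <= 6 * (2 * eta ^ 2 + eta ^ 2) <= 18 * eta], at most [eps ^ 3 / 2]. *)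
  set (eta := Rmin (delta / 2) (Rmin (eps / 2) (eps ^ 3 / 36))).
  assert (Heta : 0 < eta /\ eta <= delta / 2 /\ eta <= eps / 2 /\ eta <= eps ^ 3 / 36).
  { assert (0 < eps ^ 3) by now apply pow_lt.
    unfold eta. split; [repeat apply Rmin_pos; lra|]. split; [apply Rmin_l|].
    split; (apply Rle_trans with (1 := Rmin_r _ _)); [apply Rmin_l|apply Rmin_r]. }
  clearbody eta.
  exists (fun z => sector theta delta eta 1 z \/ sector theta delta eta (-1) z),
    (sector theta delta eta 1), (sector theta delta eta (-1)),
    (stable_arc theta delta eta), (unstable_arc theta delta eta).
  split; [|split; [|split; [|split; [|split; [|split; [|split]]]]]].
  - assert (Hpos : 0 < eta ^ 2) by (apply pow_lt; lra).
    assert (L1 : locally ((1, 0) : R * R) (fun z => ball (chart theta delta (1, 0)) (eta ^ 2) (chart theta delta z))).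
    { apply (continuous_chart Hs). now exists (mkposreal _ Hpos). }
    assert (L2 : locally ((1, 0) : R * R) (ball ((1, 0) : R * R) eta)).
    { exists (mkposreal eta ltac:(lra)). now intros. }
    apply (filter_imp (fun z => ball (chart theta delta (1, 0)) (eta ^ 2) (chart theta delta z) /\
      ball ((1, 0) : R * R) eta z)); [|exact (filter_and _ _ L1 L2)].
    intros z [H1 [H2 H3]]. rewrite (chart_cusp Hs) in H1.
    change (Rabs (chart theta delta z - 0) < eta ^ 2) in H1.
    change (Rabs (fst z - 1) < eta) in H2. change (Rabs (snd z - 0) < eta) in H3.
    rewrite Rminus_0_r in H1, H3. apply Rabs_lt_between in H1.
    apply Rabs_lt_between in H2. apply Rabs_lt_between in H3.
    unfold sector. destruct (Rle_or_lt 0 (chart theta delta z)); [left|right]; lra.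
  - assert (Hin : forall e, e = 1 \/ e = -1 -> forall z, sector theta delta eta e z ->
      ball ((1, 0) : R * R) eps z).
    { intros e He1 z [H1 [H2 H3]]. split.
      - change (Rabs (fst z - 1) < eps). apply cube_lt_inv.
        apply Rle_lt_trans with (1 := Gam_dist (fst z) ltac:(lra)).
        pose proof (chart_bound Hs z eta ltac:(lra) H2) as C.
        assert (Hy : Rabs (snd z) <= eta) by now apply Rabs_le.
        assert (Hk : Rabs (chart theta delta z) <= eta ^ 2)
          by (apply Rabs_le; destruct He1 as [-> | ->]; lra).
        pose proof (Rabs_triang (Gam (fst z) - chart theta delta z) (chart theta delta z)) as Tr.
        replace (Gam (fst z) - chart theta delta z + chart theta delta z) with (Gam (fst z)) in Tr by ring.
        assert (2 * eta * Rabs (snd z) <= 2 * eta ^ 2) by (simpl; nra).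
        assert (eta ^ 2 <= eta) by (simpl; nra).
        assert (0 < eps ^ 3) by now apply pow_lt. lra.
      - change (Rabs (snd z - 0) < eps). rewrite Rminus_0_r.
        apply Rle_lt_trans with eta; [now apply Rabs_le|lra]. }
    intros z [H|H]; [apply (Hin 1)|apply (Hin (-1))]; auto.
  - intros z [H1 [H2 H3]]. left. apply (entry_reach Hs); [unfold in_box; lra|easy|apply H3].
  - intros z H. apply (unstable_arc_mirror Hs) in H; [|lra]. destruct H as [H1 [H2 H3]].
    left. apply (entry_reach (small_opp Hs)); [unfold in_box; lra|easy|apply H3].
  - apply (sector_hyperbolic Hs); [lra|now left].
  - apply (sector_hyperbolic Hs); [lra|now right].
  - reflexivity.
  - intros z Hz. split.
    + intros [[H1 [H2 H3]] [_ [_ H4]]].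
      assert (Hk : chart theta delta z = 0) by lra.
      destruct (Rtotal_order (snd z) 0) as [Hl|[Hl|Hl]].
      * right. repeat split; lra.
      * exfalso. apply Hz. apply (chart_zero_axis Hs); [unfold in_box; lra|easy|easy].
      * left. repeat split; lra.
    + assert (0 < eta ^ 2) by (apply pow_lt; lra).
      intros [[H1 [H2 H3]]|[H1 [H2 H3]]]; unfold sector; rewrite H2; lra.
Qed.

(** * Transport to the other equilibrium *)

Definition antipode : R * R -> R * R := scale (-1) (-1).

Lemma antipode_antipode (z : R * R) : antipode (antipode z) = z.
Proof. destruct z. unfold antipode, scale; simpl. f_equal; ring. Qed.

Lemma ball_antipode (z w : R * R) (eps : R) :
  ball (z : R * R) eps w -> ball (antipode z : R * R) eps (antipode w).
Proof.
  destruct z as [x y]. destruct w as [x' y']. intros [H1 H2].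
  change (Rabs (x' - x) < eps) in H1. change (Rabs (y' - y) < eps) in H2.
  split; [change (Rabs (-1 * x' - -1 * x) < eps)|change (Rabs (-1 * y' - -1 * y) < eps)].
  - replace (-1 * x' - -1 * x) with (- (x' - x)) by ring. now rewrite Rabs_Ropp.
  - replace (-1 * y' - -1 * y) with (- (y' - y)) by ring. now rewrite Rabs_Ropp.
Qed.

Lemma locally_antipode (z : R * R) (P : R * R -> Prop) :
  locally (antipode z : R * R) P -> locally (z : R * R) (fun w => P (antipode w)).
Proof.
  intros [eps H]. exists eps. intros w Hw. apply H, ball_antipode, Hw.
Qed.

Lemma filterlim_antipode {T : Type} (F : (T -> Prop) -> Prop) (g : T -> R * R) (p : R * R) :
  filterlim g F (locally (p : R * R)) ->
  filterlim (fun t => antipode (g t)) F (locally (antipode p : R * R)).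
Proof.
  intros H P HP. apply (H (fun w => P (antipode w))). now apply locally_antipode.
Qed.

(** The system is invariant under the half turn without change of [theta] or of the direction of
    time, so stable and unstable objects keep their roles in the transport. *)
Definition odd_field (F : vector_field) : Prop := conjugate (-1) (-1) 1 F F.

Lemma odd_field_antipode (F : vector_field) (z : R * R) :
  odd_field F -> F (antipode z) = antipode (F z).
Proof. intros H. unfold antipode. rewrite (H z). unfold scale. f_equal; ring. Qed.

Lemma odd_field_reverse (F : vector_field) : odd_field F -> odd_field (reverse F).
Proof. intros H z. unfold reverse. rewrite (H z). cbn [fst snd]. f_equal; ring. Qed.

Lemma reach_in_antipode (F : vector_field) (D : R * R -> Prop) (z w : R * R) :
  odd_field F ->
  reach_in F D z w <-> reach_in F (fun u => D (antipode u)) (antipode z) (antipode w).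
Proof.
  intros HF. split; intros H.
  - apply (reach_in_conjugate (-1) (-1) F F D); [easy| |easy].
    intros u Hu. fold antipode. now rewrite antipode_antipode.
  - apply (reach_in_conjugate (-1) (-1) F F (fun u => D (antipode u)) D) in H; [|easy|easy].
    fold antipode in H. now rewrite !antipode_antipode in H.
Qed.

Lemma reach_antipode (F : vector_field) (z w : R * R) :
  odd_field F -> reach F z w <-> reach F (antipode z) (antipode w).
Proof. intros HF. exact (reach_in_antipode F (fun _ => True) z w HF). Qed.

Lemma orbit_antipode (F : vector_field) (z w : R * R) :
  odd_field F -> orbit F z w <-> orbit F (antipode z) (antipode w).
Proof.
  intros HF. unfold orbit. rewrite (reach_antipode F z w HF), (reach_antipode F w z HF). tauto.
Qed.

Lemma solution_antipode (F : vector_field) (I : R -> Prop) (g : R -> R * R) :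
  odd_field F -> solution_on F I g -> solution_on F I (fun t => antipode (g t)).
Proof.
  intros HF Hg. apply (solution_conjugate (-1) (-1) 1 0 F F I I g); try easy.
  - intros t Ht. now rewrite Rmult_1_l, Rplus_0_r.
  - intros t. now rewrite Rmult_1_l, Rplus_0_r.
Qed.

Lemma tends_forward_antipode (F : vector_field) (p z : R * R) :
  odd_field F -> tends_forward F p z <-> tends_forward F (antipode p) (antipode z).
Proof.
  intros HF. assert (W : forall p z, tends_forward F p z -> tends_forward F (antipode p) (antipode z)).
  { intros p' z' [g [H1 [H2 H3]]]. exists (fun t => antipode (g t)).
    split; [now apply solution_antipode|]. split; [now rewrite H2|now apply filterlim_antipode]. }
  split; [apply W|]. intros H. apply W in H. now rewrite !antipode_antipode in H.
Qed.

Lemma tends_backward_antipode (F : vector_field) (p z : R * R) :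
  odd_field F -> tends_backward F p z <-> tends_backward F (antipode p) (antipode z).
Proof.
  intros HF. assert (W : forall p z, tends_backward F p z -> tends_backward F (antipode p) (antipode z)).
  { intros p' z' [g [H1 [H2 H3]]]. exists (fun t => antipode (g t)).
    split; [now apply solution_antipode|]. split; [now rewrite H2|now apply filterlim_antipode]. }
  split; [apply W|]. intros H. apply W in H. now rewrite !antipode_antipode in H.
Qed.

Lemma antipode_neq (z p : R * R) : z <> antipode p -> antipode z <> p.
Proof. intros H E. apply H. now rewrite <- E, antipode_antipode. Qed.

Lemma arc_ending_at_antipode (F : vector_field) (p : R * R) (A : R * R -> Prop) :
  odd_field F -> arc_ending_at F p A ->
  arc_ending_at F (antipode p) (fun w => A (antipode w)).
Proof.
  intros HF [z [Hz H]]. exists (antipode z). split.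
  - apply antipode_neq. now rewrite antipode_antipode.
  - destruct H as [[H1 H2]|[H1 H2]]; [left|right].
    + split; [now apply (tends_forward_antipode F p z HF)|]. intros w.
      rewrite H2, (reach_antipode F z _ HF), antipode_antipode. reflexivity.
    + split; [now apply (tends_backward_antipode F p z HF)|]. intros w.
      rewrite H2, (reach_antipode F _ z HF), antipode_antipode. reflexivity.
Qed.

(** The half turn acts on the target only: the model flow [F1] and its domain [Q] are unchanged, and
    [h] is followed by [antipode]. *)
Lemma topological_equivalence_antipode (F1 F2 : vector_field) (Q S : R * R -> Prop)
    (h : R * R -> R * R) :
  odd_field F2 -> topological_equivalence F1 Q F2 S h ->
  topological_equivalence F1 Q F2 (fun w => S (antipode w)) (fun z => antipode (h z)).
Proof.
  intros HF [[k [Hh [Hk [H1 H2]]]] H3]. split.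
  - exists (fun w => k (antipode w)). split; [|split; [|split]].
    + intros z Hz. exact (filterlim_antipode _ _ _ (Hh z Hz)).
    + intros w Hw P HP. exact (locally_antipode w _ (Hk _ Hw P HP)).
    + intros z Hz. rewrite antipode_antipode. now apply H1.
    + intros w Hw. destruct (H2 _ Hw) as [A B]. rewrite B, antipode_antipode. easy.
  - intros z w Hz Hw. rewrite (H3 z w Hz Hw). now apply reach_in_antipode.
Qed.

Lemma hyperbolic_sector_antipode (F : vector_field) (p : R * R) (S A B : R * R -> Prop) :
  odd_field F -> hyperbolic_sector F p S A B ->
  hyperbolic_sector F (antipode p) (fun z => S (antipode z))
    (fun z => A (antipode z)) (fun z => B (antipode z)).
Proof.
  intros HF [HA [HB [[U [h [HU [Hh [H0 [Hu Hv]]]]]] Hex]]].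
  assert (Hsw : forall w u : R * R, antipode w = u <-> w = antipode u).
  { intros w u. split; [intros <-|intros ->]; now rewrite antipode_antipode. }
  split; [now apply arc_ending_at_antipode|]. split; [now apply arc_ending_at_antipode|]. split.
  - exists U, (fun z => antipode (h z)). split; [easy|]. split; [|split; [|split]].
    + destruct Hh as [Hh|Hh]; [left|right];
        (apply topological_equivalence_antipode; [|exact Hh]); [easy|now apply odd_field_reverse].
    + now rewrite H0.
    + intros w. rewrite Hu. split; intros [u [K1 [K2 K3]]]; exists u; split; try easy;
        (split; [easy|]); now apply Hsw.
    + intros w. rewrite Hv. split; intros [u [K1 [K2 K3]]]; exists u; split; try easy;
        (split; [easy|]); now apply Hsw.
  - intros z Hz Hp HnA HnB.
    destruct (Hex _ Hz (antipode_neq _ _ Hp) HnA HnB) as [[w [W1 W2]] [w' [W1' W2']]].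
    split; [exists (antipode w)|exists (antipode w')]; rewrite antipode_antipode; (split; [|easy]).
    + apply (reach_antipode F _ _ HF) in W1. now rewrite antipode_antipode in W1.
    + apply (reach_antipode F _ _ HF) in W1'. now rewrite antipode_antipode in W1'.
Qed.

Lemma is_cusp_antipode (F : vector_field) (p : R * R) :
  odd_field F -> is_cusp F p -> is_cusp F (antipode p).
Proof.
  intros HF [[He Hi] [Gs [Gu [Os [Ou [Ns [Nu [Hne [Hs [Hu Hloc]]]]]]]]]].
  assert (H00 : antipode (0, 0) = (0, 0)) by (unfold antipode, scale; simpl; f_equal; ring).
  assert (Horb : forall G, is_orbit F G -> is_orbit F (fun w => G (antipode w))).
  { intros G [z Hz]. exists (antipode z). intros w.
    rewrite Hz, (orbit_antipode F z _ HF), antipode_antipode. reflexivity. }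
  split.
  { split.
    - unfold is_equilibrium in *. now rewrite odd_field_antipode, He.
    - apply (filter_imp (fun w => is_equilibrium F (antipode w) -> antipode w = p)).
      + intros w H Hw. rewrite <- (antipode_antipode w). f_equal. apply H.
        unfold is_equilibrium in *. now rewrite odd_field_antipode, Hw.
      + apply (locally_antipode (antipode p) (fun w => is_equilibrium F w -> w = p)).
        now rewrite antipode_antipode. }
  exists (fun w => Gs (antipode w)), (fun w => Gu (antipode w)).
  split; [now apply Horb|]. split; [now apply Horb|].
  rewrite antipode_antipode. split; [easy|]. split; [easy|]. split; [|split; [|split]].
  - intros H. apply Hne. intros z. specialize (H (antipode z)).
    now rewrite antipode_antipode in H.
  - intros z Hz. rewrite (tends_forward_antipode F _ z HF), antipode_antipode.
    now apply Hs, antipode_neq.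
  - intros z Hz. rewrite (tends_backward_antipode F _ z HF), antipode_antipode.
    now apply Hu, antipode_neq.
  - intros eps Heps.
    destruct (Hloc eps Heps) as [N [S1 [S2 [A [B [L1 [L2 [L3 [L4 [L5 [L6 [L7 L8]]]]]]]]]]]].
    exists (fun z => N (antipode z)), (fun z => S1 (antipode z)), (fun z => S2 (antipode z)),
      (fun z => A (antipode z)), (fun z => B (antipode z)).
    split; [apply locally_antipode; now rewrite antipode_antipode|].
    split; [intros z Hz; rewrite <- (antipode_antipode z); now apply ball_antipode, L2|].
    split; [intros z; apply L3|]. split; [intros z; apply L4|].
    split; [now apply hyperbolic_sector_antipode|]. split; [now apply hyperbolic_sector_antipode|].
    split; [intros z; apply L7|]. intros z Hz. now apply L8, antipode_neq.
Qed.

Theorem theorem2p2 (theta : R) :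
  is_cusp (cusp_system theta) (-1, 0) /\ is_cusp (cusp_system theta) (1, 0).
Proof.
  split; [|apply cusp_at_one].
  replace ((-1, 0) : R * R) with (antipode (1, 0)) by (unfold antipode, scale; simpl; f_equal; ring).
  apply is_cusp_antipode; [|apply cusp_at_one].
  intros [x y]. unfold cusp_system, scale. cbn [fst snd]. f_equal; ring.
Qed.
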